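(* Let $1<p<\infty$. For each $\omega\in\widehat{\mathcal D}$ there exists $\nu\in\widehat{\mathcal D}$ such that $T_\omega:A^p_\nu\to L^p_\nu$ is bounded but $T_\omega$ is not bounded from $L^p_\nu$ to $L^{p,\infty}_\nu$.
   Context: $\mathbb D$ is the open unit disc and $dA(z)=\frac{dx\,dy}{\pi}$. A weight is a function $\omega:\mathbb D\to[0,\infty)$ integrable over $\mathbb D$; it is radial if $\omega(z)=\omega(|z|)$ for all $z$. For a radial weight, $\widehat\omega(z)=\int_{|z|}^1\omega(s)\,ds$, assumed positive for all $z\in\mathbb D$. A radial weight $\omega$ belongs to $\widehat{\mathcal D}$ if there is $C>1$ with $\widehat\omega(r)\le C\,\widehat\omega\left(\frac{1+r}{2}\right)$ for all $0\le r<1$. $L^p_\nu$ is the space of complex-valued measurable $f$ on $\mathbb D$ with $\|f\|_{L^p_\nu}^p=\int_{\mathbb D}|f|^p\nu\,dA<\infty$, and $A^p_\nu$ is the subspace of analytic functions in $L^p_\nu$. The radial averaging operator is $$T_\omega(f)(z)=\frac{1}{\widehat\omega(z)}\int_{|z|}^1 f\left(s\tfrac{z}{|z|}\right)\omega(s)\,ds,\quad z\in\mathbb D\setminus\{0\}.$$ $T_\omega:A^p_\nu\to L^p_\nu$ is bounded if $\|T_\omega f\|_{L^p_\nu}\le C\|f\|_{A^p_\nu}$ for all $f\in A^p_\nu$ with $C$ independent of $f$. $T_\omega$ is bounded from $L^p_\nu$ to $L^{p,\infty}_\nu$ if there is $C$ with $\nu(\{z\in\mathbb D:|T_\omega(f)(z)|>\lambda\})\le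 C\lambda^{-p}\|f\|_{L^p_\nu}^p$ for all $\lambda>0$ and $f\in L^p_\nu$, where $\nu(E)=\int_E\nu\,dA$; here $f$ ranges over genuine measurable functions (not classes modulo $\nu$-null sets), and for non-negative $f$ the value $T_\omega(f)(z)=+\infty$ is allowed. *)

(* Defs.v *)
From HB Require Import structures.
From mathcomp Require Import all_boot all_order all_algebra.
From mathcomp Require Import all_classical all_reals all_analysis.
From mathcomp Require Import complex.

Set Implicit Arguments.
Unset Strict Implicit.
Unset Printing Implicit Defensive.

Import Order.TTheory GRing.Theory Num.Theory.
Import numFieldNormedType.Exports.

Local Open Scope classical_set_scope.
Local Open Scope ring_scope.
Local Open Scope complex_scope.

(* MathComp-Analysis world.  Complex numbers are [R[i]] over [R : realType];
   the norm [`|z|] of [R[i]] is itself a (real) element of [R[i]]. *)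

Definition modc (R : realType) (z : R[i]) : R := complex.Re `|z|.

Definition disc (R : realType) : set R[i] := [set z | `|z| < 1].

Definition cpt (R : realType) (x : R * R) : R[i] := x.1 +i* x.2.

Definition plane_leb (R : realType) :
    {measure set (measurableTypeR R * measurableTypeR R) -> \bar R} :=
  ((@lebesgue_measure R) \x (@lebesgue_measure R))%E.

Definition plane_disc (R : realType) :
    set (measurableTypeR R * measurableTypeR R) :=
  @cpt R @^-1` @disc R.

(* [\int_D F dA] with [dA = dx dy / pi].  The library integral of a
   non-negative function is a supremum over Borel simple minorants, so it is
   also correct for functions that are only Lebesgue measurable. *)
Definition dA_int (R : realType) (F : R[i] -> \bar R) : \bar R :=
  ((pi^-1)%:E * \int[@plane_leb R]_(x in @plane_disc R) F (cpt x))%E.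

(* The library's [measurable_fun] is Borel measurability; Lebesgue
   measurability is recovered as equality a.e. with a Borel function. *)
Definition disc_measurable (R : realType) (g : R[i] -> R) : Prop :=
  exists2 h : measurableTypeR R * measurableTypeR R -> measurableTypeR R,
    measurable_fun (@plane_disc R) h &
    {ae @plane_leb R, forall x, plane_disc x -> g (cpt x) = h x}.

(* Functions on the disc are total functions on [R[i]]; their values off the
   disc are never used. *)
Definition weight (R : realType) (w : R[i] -> R) : Prop :=
  [/\ forall z, disc z -> 0 <= w z,
      disc_measurable w &
      (dA_int (fun z => (w z)%:E) < +oo)%E].

Definition radial (R : realType) (w : R[i] -> R) : Prop :=
  forall z, disc z -> w z = w `|z|.

(* Extended-real valued: integrability of [w] over the disc alone does not
   exclude [hat w 0 = +oo]. *)
Definition hat (R : realType) (w : R[i] -> R) (z : R[i]) : \bar R :=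
  (\int[@lebesgue_measure R]_(s in `[modc z, 1%R[) (w s%:C)%:E)%E.

Definition radial_weight (R : realType) (w : R[i] -> R) : Prop :=
  [/\ weight w, radial w & forall z, disc z -> (0 < hat w z)%E].

Definition Dhat (R : realType) (w : R[i] -> R) : Prop :=
  radial_weight w /\
  exists2 C : R, 1 < C &
    forall r : R, 0 <= r < 1 ->
      (hat w r%:C <= C%:E * hat w ((1 + r) / 2)%:C)%E.

(* Takes the modulus [g = |f|], so that the value [+oo] is allowed. *)
Definition Lp_norm (R : realType) (nu : R[i] -> R) (p : R)
    (g : R[i] -> \bar R) : \bar R :=
  ((dA_int (fun z => g z `^ p * (nu z)%:E)) `^ p^-1)%E.

Definition absf (R : realType) (f : R[i] -> R[i]) (z : R[i]) : \bar R :=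
  (modc (f z))%:E.

(* Actual functions, not classes modulo null sets. *)
Definition Lp_space (R : realType) (nu : R[i] -> R) (p : R)
    (f : R[i] -> R[i]) : Prop :=
  [/\ disc_measurable (fun z => complex.Re (f z)),
      disc_measurable (fun z => complex.Im (f z)) &
      (Lp_norm nu p (absf f) < +oo)%E].

(* [R[i]^o] is [R[i]] as a normed space over itself: [derivable] in the
   direction [1] is complex differentiability. *)
Definition analytic_disc (R : realType) (f : R[i] -> R[i]) : Prop :=
  forall z, disc z -> derivable (f : R[i]^o -> R[i]^o) z 1.

Definition Ap_space (R : realType) (nu : R[i] -> R) (p : R)
    (f : R[i] -> R[i]) : Prop :=
  analytic_disc f /\ Lp_space nu p f.

Definition Tintegrand (R : realType) (w : R[i] -> R) (f : R[i] -> R[i])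
    (z : R[i]) (s : R) : R[i] :=
  f (s%:C * (z / `|z|)) * (w s%:C)%:C.

(* The averaging operator where its integral converges absolutely; the value
   at [z = 0], where it is undefined, is a dummy at a null set. *)
Definition Tavg (R : realType) (w : R[i] -> R) (f : R[i] -> R[i])
    (z : R[i]) : R[i] :=
  ((\int[@lebesgue_measure R]_(s in `[modc z, 1%R[)
      complex.Re (Tintegrand w f z s)) +i*
   (\int[@lebesgue_measure R]_(s in `[modc z, 1%R[)
      complex.Im (Tintegrand w f z s))) / (fine (hat w z))%:C.

(* [|Tavg w f z|], set to [+oo] when the integral does not converge absolutely;
   for [f >= 0] this is the [[0, +oo]]-valued average.  The convention for
   other [f] does not affect which weak-type bounds hold: replace [f] by [|f|],
   which has the same norm and a larger average. *)
Definition absT (R : realType) (w : R[i] -> R) (f : R[i] -> R[i])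
    (z : R[i]) : \bar R :=
  if (\int[@lebesgue_measure R]_(s in `[modc z, 1%R[)
        (modc (Tintegrand w f z s))%:E < +oo)%E
  then (modc (Tavg w f z))%:E else +oo%E.

Definition T_bounded_Ap_Lp (R : realType) (w nu : R[i] -> R) (p : R) : Prop :=
  exists C : R, forall f : R[i] -> R[i], Ap_space nu p f ->
    (Lp_norm nu p (absT w f) <= C%:E * Lp_norm nu p (absf f))%E.

Definition weight_measure (R : realType) (nu : R[i] -> R) (E : set R[i])
  : \bar R := dA_int (fun z => (\1_E z * nu z)%:E).

Definition T_bounded_Lp_weakLp (R : realType) (w nu : R[i] -> R) (p : R)
  : Prop :=
  exists C : R, forall (lam : R) (f : R[i] -> R[i]),
    0 < lam -> Lp_space nu p f ->
    (weight_measure nu [set z | disc z /\ lam%:E < absT w f z]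
       <= (C * lam `^ (- p))%:E * Lp_norm nu p (absf f) `^ p)%E.

(* Main.v *)
(** Let [k] be the density of [w] along a ray and [K r] its integral over
    [[r, 1)].  Fix [1/2 < b < c < 1] with [K b < K (1/2)] and let [nu] be the
    radial weight with profile [1] on [[0, 1/2)], [0] on [[1/2, b)],
    [1 + k / sqrt K] on [[b, c)] and [k / sqrt K] on [[c, 1)].

    The indicator of the annulus [1/2 <= |z| < b] has norm zero in [L^p_nu], but
    its average is bounded below on [|z| < 1/2], where [nu] is positive: no weak
    type bound can hold.

    An analytic function on [|z| <= b] is bounded by its mean over the annulus
    [b < |z| < c], by Cauchy's formula, hence by its norm in [A^p_nu].  The part
    of the average over [b <= |z|] is handled on each ray by Jensen's inequality,
    Tonelli's theorem and [\int_b^s k K^(-3/2) <= 6 K(s)^(-1/2)]; this last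
    estimate is the reason for the factor [1 / sqrt K].

    Cauchy's formula is obtained by Goursat's bisection in the coordinates
    [(t, u)] of the cone with vertex [z] over a quarter of the circle, where [u]
    is the slope.  The same slope coordinate gives polar integration by linear
    changes of variables only. *)

From HB Require Import structures.
Require Import Defs.
From mathcomp Require Import all_boot all_order all_algebra.
From mathcomp Require Import all_classical all_reals all_analysis.
From mathcomp Require Import measurable_realfun.
From mathcomp Require Import complex.
From mathcomp Require Import ring lra.

Set Implicit Arguments.
Unset Strict Implicit.
Unset Printing Implicit Defensive.

Import Order.TTheory GRing.Theory Num.Theory.
Import numFieldNormedType.Exports.
Import Normc.

Local Open Scope classical_set_scope.
Local Open Scope ring_scope.
Local Open Scope complex_scope.

(** * The complex modulus and complex differentiability *)

(** The exponent 1/2 on [K] is a choice inside (0, 1): with k / K^a in its place, the tail of [nu]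
    is finite only for a < 1, while a bound of \int_b^s k K^(-1-a) by a multiple of K(s)^(-a) needs
    a > 0. The resulting tail of [nu] is comparable to sqrt K near 1, so [nu] inherits the doubling
    of [w]. The summand 1 on [b, c) is there because [k] may vanish on that interval, and the norm
    would then not see the annulus mean.

    Two obstacles shape the rest. First, [w] is measurable only up to a null set of the plane, and
    the segment on which [hat] integrates is such a set; polar coordinates supply almost every ray,
    and radiality carries a good one to the real axis. Second, measurability of [absT] is not
    established, so its integrals are bounded above through measurable minorants.

    No chain rule for [K] is used: integrals of k K^(-a) are estimated crudely where [K] drops by a
    bounded factor, and the pieces are added up. *)

Section ComplexNorm.
Variable R : realType.
Implicit Types (z w : R[i]) (f : R[i] -> R[i]).

Lemma normc_ge0 z : 0 <= normc z.
Proof. by case: z => x y; exact: sqrtr_ge0. Qed.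

Lemma ler_normcD z w : normc (z + w) <= normc z + normc w.
Proof. exact: (le_normcD z w). Qed.

Lemma normcB z w : normc (z - w) = normc (w - z).
Proof. by rewrite -(normcN (z - w)) opprB. Qed.

Lemma ler_Re_normc z : `|complex.Re z| <= normc z.
Proof.
by case: z => x y /=; rewrite -sqrtr_sqr ler_sqrt ?lerDl ?addr_ge0 ?sqr_ge0.
Qed.

Lemma ler_Im_normc z : `|complex.Im z| <= normc z.
Proof.
by case: z => x y /=; rewrite -sqrtr_sqr ler_sqrt ?lerDr ?addr_ge0 ?sqr_ge0.
Qed.

Lemma normc_le_ReIm z : normc z <= `|complex.Re z| + `|complex.Im z|.
Proof.
case: z => x y /=; rewrite -(@ger0_norm _ (`|x| + `|y|)) ?addr_ge0//.
rewrite -sqrtr_sqr ler_sqrt ?sqr_ge0// sqrrD !real_normK ?num_real//.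
by rewrite lerD2r lerDl mulrn_wge0 ?mulr_ge0.
Qed.

Lemma normcR (x : R) : normc x%:C = `|x|.
Proof. by rewrite /= expr0n/= addr0 sqrtr_sqr. Qed.

Lemma sqr_normc z : normc z ^+ 2 = complex.Re z ^+ 2 + complex.Im z ^+ 2.
Proof. by case: z => x y /=; rewrite sqr_sqrtr ?addr_ge0 ?sqr_ge0. Qed.

Lemma discE z : disc z = (normc z < 1).
Proof. by rewrite /disc/= normc_def; case: z => x y; rewrite -[1]/(1%:C) ltcR. Qed.

Lemma modcE z : modc z = normc z.
Proof. by rewrite /modc normc_def; case: z. Qed.

(** First-order expansion with real epsilons and radii. The bisection uses only this pointwise
    statement, never continuity of the derivative. *)
Lemma derivable_expansion f z : derivable (f : R[i]^o -> R[i]^o) z 1 ->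
  exists a : R[i], forall e : R, 0 < e -> exists2 d : R, 0 < d &
    forall w, normc (w - z) < d ->
      normc (f w - f z - a * (w - z)) <= e * normc (w - z).
Proof.
move=> /cvgrPdist_lt dz.
set a := lim _ in dz; exists a => e e0.
have e0C : (0 : R[i]) < e%:C by rewrite -[0]/(0%:C) ltcR.
have := dz _ e0C.
move=> [[d d']/= d0 dH].
(* In the order of [R[i]] a positive element is real, so the radius of the neighbourhood has zero
   imaginary part. *)
have {d0} [d0 d'0] : 0 < d /\ d' = 0.
  by move: d0; rewrite ltcE/= => /andP[/eqP -> ->].
subst d'; exists d => // w wz.
have [->|wz0] := eqVneq w z; first by rewrite !subrr mulr0 subrr normc0 mulr0.
have h0 : w - z != 0 by rewrite subr_eq0.
have := dH (w - z); rewrite /ball/= sub0r normrN normc_def.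
case: (w - z) wz h0 (subrK z w) => x y wz h0 wK /(_ _ h0).
rewrite ltcR => /(_ wz).
rewrite scaler1 wK /GRing.scale/= -/a normc_def => H.
have {H} : normc (a - (x +i* y)^-1 * (f w - f z)) < e.
  by move: H; case: (a - _) => u v; rewrite ltcR.
rewrite -normcB => /ltW H.
have -> : f w - f z - a * (x +i* y) =
   ((x +i* y)^-1 * (f w - f z) - a) * (x +i* y).
  by rewrite mulrBl mulrAC mulVf// mul1r.
by rewrite normcM ler_wpM2r ?normc_ge0.
Qed.

End ComplexNorm.

(** * Goursat's bisection *)

Section Bisection.
Variable R : realType.

Lemma nested_intervals (x h : nat -> R) :
  (forall n, 0 <= h n) ->
  (forall n, x n <= x n.+1 /\ x n.+1 + h n.+1 <= x n + h n) ->
  exists t, forall n, x n <= t <= x n + h n.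
Proof.
move=> h0 xh.
have mono m n : x n <= x (n + m)%N /\ x (n + m)%N + h (n + m)%N <= x n + h n.
  elim: m => [|m [IH1 IH2]]; first by rewrite addn0.
  rewrite addnS; have [? ?] := xh (n + m)%N.
  by split; [apply: (le_trans IH1)|apply: le_trans IH2].
have le_x n k : x k <= x n + h n.
  have [le_nk|/ltnW le_kn] := leqP n k.
    have [_] := mono (k - n)%N n; rewrite subnKC//; apply: le_trans.
    by rewrite lerDl.
  have [le1 _] := mono (n - k)%N k; rewrite subnKC// in le1.
  by apply: (le_trans le1); rewrite lerDl.
exists (sup (range x)) => n; apply/andP; split.
  apply: ub_le_sup; last by exists n.
  by exists (x 0%N + h 0%N) => _ [k _ <-].
apply: ge_sup; first by exists (x 0%N), 0%N.
by move=> _ [k _ <-].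
Qed.

Variables (E : R -> R -> R -> R -> R) (a b c d : R).
Hypotheses (ab : a <= b) (cd : c <= d).
Hypothesis E_split_l : forall t1 t2 t3 u1 u2,
  a <= t1 -> t1 <= t2 -> t2 <= t3 -> t3 <= b -> c <= u1 -> u1 <= u2 -> u2 <= d ->
  E t1 t3 u1 u2 = E t1 t2 u1 u2 + E t2 t3 u1 u2.
Hypothesis E_split_r : forall t1 t2 u1 u2 u3,
  a <= t1 -> t1 <= t2 -> t2 <= b -> c <= u1 -> u1 <= u2 -> u2 <= u3 -> u3 <= d ->
  E t1 t2 u1 u3 = E t1 t2 u1 u2 + E t1 t2 u2 u3.
Hypothesis E_local : forall t u, a <= t <= b -> c <= u <= d ->
  forall e, 0 < e -> exists2 r, 0 < r & forall t1 t2 u1 u2,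
    a <= t1 -> t1 <= t -> t <= t2 -> t2 <= b ->
    c <= u1 -> u1 <= u -> u <= u2 -> u2 <= d ->
    t2 - t1 < r -> u2 - u1 < r ->
    `|E t1 t2 u1 u2| <= e * ((t2 - t1) + (u2 - u1)) ^+ 2.

(** The two splitting hypotheses cut the rectangle into four congruent ones; by the triangle
    inequality one of them carries at least a quarter of the modulus. *)
Let quarter x h y k q : 0 <= h -> 0 <= k -> a <= x -> x + (h + h) <= b ->
  c <= y -> y + (k + k) <= d -> 4 * q <= `|E x (x + (h + h)) y (y + (k + k))| ->
  exists x' y', [/\ x <= x', x' + h <= x + (h + h), y <= y',
    y' + k <= y + (k + k) & q <= `|E x' (x' + h) y' (y' + k)|].
Proof.
move=> h0 k0 ax xb cy yd; rewrite !addrA in xb yd *.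
have -> : E x (x + h + h) y (y + k + k) =
    E x (x + h) y (y + k) + E x (x + h) (y + k) (y + k + k) +
    (E (x + h) (x + h + h) y (y + k) + E (x + h) (x + h + h) (y + k) (y + k + k)).
  rewrite (@E_split_l x (x + h)); [|lra..].
  rewrite (@E_split_r x (x + h) y (y + k)); [|lra..].
  rewrite (@E_split_r (x + h) (x + h + h) y (y + k)); [|lra..].
  by [].

move=> HE.
have [H1|H1] := leP q `|E x (x + h) y (y + k)|.
  by exists x, y; split => //; lra.
have [H2|H2] := leP q `|E x (x + h) (y + k) (y + k + k)|.
  by exists x, (y + k); split => //; lra.
have [H3|H3] := leP q `|E (x + h) (x + h + h) y (y + k)|.
  by exists (x + h), y; split => //; lra.
have [H4|H4] := leP q `|E (x + h) (x + h + h) (y + k) (y + k + k)|.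
  by exists (x + h), (y + k); split => //; lra.
exfalso; move: HE; rewrite leNgt => /negP; apply.
apply: (le_lt_trans (ler_normD _ _)).
have := ler_normD (E x (x + h) y (y + k)) (E x (x + h) (y + k) (y + k + k)).
have := ler_normD (E (x + h) (x + h + h) y (y + k)) (E (x + h) (x + h + h) (y + k) (y + k + k)).
lra.
Qed.

Let half_expn (m : R) n : m / 2 ^+ n = m / 2 ^+ n.+1 + m / 2 ^+ n.+1.
Proof. by rewrite exprS invfM mulrCA; set q := m / _; lra. Qed.

(** A state (n, x, y) stands for the dyadic rectangle of level n with lower left corner (x, y); it
    is bad when it carries at least the fraction 4^-n of the total. *)
Let bad (s : nat * R * R) : Prop := let: (n, x, y) := s in
  [/\ a <= x, x + (b - a) / 2 ^+ n <= b, c <= y, y + (d - c) / 2 ^+ n <= d &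
      `|E a b c d| / 4 ^+ n <=
      `|E x (x + (b - a) / 2 ^+ n) y (y + (d - c) / 2 ^+ n)|].

Let sub (s s' : nat * R * R) : Prop :=
  let: (n, x, y) := s in let: (n', x', y') := s' in
  [/\ n' = n.+1, x <= x', x' + (b - a) / 2 ^+ n' <= x + (b - a) / 2 ^+ n,
      y <= y' & y' + (d - c) / 2 ^+ n' <= y + (d - c) / 2 ^+ n].

Let dyadic_ge0 m n : 0 <= m -> 0 <= m / 2 ^+ n :> R.
Proof. by move=> m0; rewrite divr_ge0// exprn_ge0. Qed.

Let bad_sub s : bad s -> exists s', bad s' /\ sub s s'.
Proof.
case: s => [[n x] y]; rewrite /bad /sub.
have L1 : 0 <= (b - a) / 2 ^+ n.+1 by rewrite dyadic_ge0 ?subr_ge0.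
have M1 : 0 <= (d - c) / 2 ^+ n.+1 by rewrite dyadic_ge0 ?subr_ge0.
rewrite !(half_expn _ n) => -[ax xb cy yd HE].
have e4 : `|E a b c d| / 4 ^+ n = 4 * (`|E a b c d| / 4 ^+ n.+1).
  by rewrite exprS invfM mulrCA mulVKf.
rewrite e4 in HE.
have [x' [y' [xx xx' yy yy' E']]] := quarter L1 M1 ax xb cy yd HE.
exists (n.+1, x', y'); split; split => //.
- exact: le_trans xx.
- exact: le_trans xx' _.
- exact: le_trans yy.
- exact: le_trans yy' _.
Qed.

(** Bad rectangles shrink to a point (t, u). There [E_local] bounds [E] by e * s^2 / 4^n, which is
    less than the share |E a b c d| / 4^n that a bad rectangle keeps. With [E] abstract, complex
    analysis enters only through [E_local]. *)
Lemma bisection_eq0 : E a b c d = 0.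
Proof.
apply/eqP; rewrite -normr_eq0; apply/negPn/negP => E0.
have m0 : 0 < `|E a b c d| by rewrite lt0r E0 normr_ge0.
have bad0 : bad (0%N, a, c).
  rewrite /bad !expr0 !divr1; split => //; try lra.
  by rewrite ![_ + (_ - _)]addrC !subrK.
have nxt (s : {s | bad s}) : {s' : {s | bad s} | sub (sval s) (sval s')}.
  apply: cid; case: s => s bs /=; have [s' [bs' ss']] := bad_sub bs.
  by exists (exist _ s' bs').
have [F [F0 FS]] := dependent_choice nxt (exist _ _ bad0).
have Fn n : (sval (F n)).1.1 = n.
  elim: n => [|n IH]; first by rewrite F0.
  by move: (FS n) IH; case: (sval _) => [[? ?] ?]; case: (sval _) => [[? ?] ?] /= [-> _ _ _ _] ->.
pose x n := (sval (F n)).1.2; pose y n := (sval (F n)).2.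
have badF n : bad (n, x n, y n).
  by have := svalP (F n); rewrite -[X in bad (X, _, _)](Fn n) /x /y; case: (sval _) => [[? ?] ?].
have subF n : sub (n, x n, y n) (n.+1, x n.+1, y n.+1).
  have := FS n; rewrite -[X in sub (X, _, _)](Fn n) -[X in sub _ (X, _, _)](Fn n.+1) /x /y.
  by case: (sval _) => [[? ?] ?]; case: (sval _) => [[? ?] ?].
have [t Ht] : exists t, forall n, x n <= t <= x n + (b - a) / 2 ^+ n.
  apply: (nested_intervals (h := fun n => (b - a) / 2 ^+ n)) => n.
    by rewrite dyadic_ge0 ?subr_ge0.
  by have [] := subF n.
have [u Hu] : exists t, forall n, y n <= t <= y n + (d - c) / 2 ^+ n.
  apply: (nested_intervals (h := fun n => (d - c) / 2 ^+ n)) => n.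
    by rewrite dyadic_ge0 ?subr_ge0.
  by have [] := subF n.
have tab : a <= t <= b.
  by have /andP[/(le_trans _)] := Ht 0%N; have [? /(le_trans _)] := badF 0%N; move=> h _ _ _ k1 k2; rewrite k1//= h.
have ucd : c <= u <= d.
  by have /andP[/(le_trans _)] := Hu 0%N; have [_ _ ? /(le_trans _)] := badF 0%N; move=> h _ k1 k2; rewrite k1//= h.
pose s := (b - a) + (d - c).
have s0 : 0 <= s by rewrite /s; lra.
(* Makes e * s^2 strictly smaller than |E a b c d|; the [+ 1] covers a rectangle reduced to a
   point. *)
pose e := `|E a b c d| / (s ^+ 2 + 1) / 2.
have s1 : 0 < s ^+ 2 + 1 by rewrite ltr_wpDl ?sqr_ge0.
have e0 : 0 < e by rewrite /e divr_gt0// divr_gt0.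
have [r r0 Hr] := E_local tab ucd e0.
have [n Hn] : exists n, s / 2 ^+ n < r.
  have [k Hk] : exists k : nat, s / r < k%:R.
    by exists (Num.bound (s / r)); apply: archi_boundP; rewrite divr_ge0 ?(ltW r0).
  exists k; rewrite ltr_pdivrMr ?exprn_gt0// mulrC -ltr_pdivrMr//.
  apply: (lt_le_trans Hk); rewrite -natrX ler_nat ltnW// ltn_expl//.
have [xa xb yc yd HEn] := badF n.
have /andP[t1 t2] := Ht n; have /andP[u1 u2] := Hu n.
have HE : `|E a b c d| / 4 ^+ n <= e * (s / 2 ^+ n) ^+ 2.
  apply: (le_trans HEn).
  have -> : s / 2 ^+ n = (b - a) / 2 ^+ n + (d - c) / 2 ^+ n by exact: mulrDl.
  have dL x1 (l : R) : x1 + l - x1 = l by rewrite addrC addKr.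
  have := Hr _ _ _ _ xa t1 t2 xb yc u1 u2 yd; rewrite !dL; apply;
    apply: le_lt_trans Hn; rewrite ler_pM2r ?invr_gt0 ?exprn_gt0//;
    by rewrite ?lerDl ?lerDr subr_ge0.
have e4 : (2 ^+ n) ^+ 2 = 4 ^+ n :> R by rewrite -exprM mulnC exprM -natrX.
move: HE; rewrite expr_div_n e4 mulrA ler_pM2r ?invr_gt0 ?exprn_gt0//.
apply/negP; rewrite -ltNge /e.
rewrite mulrAC ltr_pdivrMr// mulrAC ltr_pdivrMr//.
have := sqr_ge0 s; nra.
Qed.

End Bisection.

(** * Integrals of continuous functions over segments *)

Section ContinuousIntegral.
Variable R : realType.
Local Notation mu := (@lebesgue_measure R).
Implicit Types (g h : R -> R) (a b : R).

(** Continuity in a full neighbourhood of each point, end points included: the integrands used below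
    are continuous slightly beyond their interval, so subspace topologies enter only through
    [cont_on_within]. *)
Definition cont_on a b g := forall x, a <= x <= b -> {for x, continuous g}.

Definition rint a b g : R := \int[mu]_(x in `[a, b]) g x.

Lemma cont_on_within a b g : cont_on a b g -> {within `[a, b], continuous g}.
Proof.
move=> cg; apply: continuous_in_subspaceT => x.
by rewrite inE/= in_itv/= => xab; exact: cg.
Qed.

Lemma cont_on_integrable a b g : cont_on a b g ->
  mu.-integrable `[a, b] (EFin \o g).
Proof.
move=> cg; apply: continuous_compact_integrable; first exact: segment_compact.
exact: cont_on_within.
Qed.

Lemma rint_split a b c g : a <= b -> b <= c -> cont_on a c g ->
  rint a c g = rint a b g + rint b c g.
Proof.
move=> ab bc cg; have ig := cont_on_integrable cg.
have H : \int[mu]_(t in `[a, c]) g t - \int[mu]_(t in `[a, b]) g t =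
    \int[mu]_(x in `]b, c]) g x.
  by rewrite Rintegral_itvB ?bnd_simp.
rewrite /rint (_ : \int[mu]_(x in `[b, c]) g x = \int[mu]_(x in `]b, c]) g x).
  by rewrite -H addrC subrK.
rewrite -Rintegral_itv_obnd_cbnd//.
by apply: integrableS ig => //; apply: subset_itvScc; rewrite bnd_simp.
Qed.

Lemma rintB a b g h : cont_on a b g -> cont_on a b h ->
  rint a b (fun x => g x - h x) = rint a b g - rint a b h.
Proof. by move=> cg ch; rewrite /rint RintegralB//; exact: cont_on_integrable. Qed.

Lemma rintZ a b r g : cont_on a b g ->
  rint a b (fun x => r * g x) = r * rint a b g.
Proof. by move=> cg; rewrite /rint RintegralZl//; exact: cont_on_integrable. Qed.

Lemma ler_rint a b g h : cont_on a b g -> cont_on a b h ->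
  (forall x, a <= x <= b -> g x <= h x) -> rint a b g <= rint a b h.
Proof.
move=> cg ch gh; apply: le_Rintegral => //; exact: cont_on_integrable.
Qed.

Lemma cont_on_cst a b r : cont_on a b (fun=> r).
Proof. by move=> x _; exact: cst_continuous. Qed.

Lemma rint_cst a b r : a <= b -> rint a b (fun=> r) = r * (b - a).
Proof.
move=> ab; rewrite /rint Rintegral_cst//= lebesgue_measure_itv/= lte_fin.
have [//|ba] := ltP a b; suff -> : a = b by rewrite subrr.
by apply/eqP; rewrite eq_le ab.
Qed.

Lemma ler_norm_rint a b g M : a <= b -> cont_on a b g ->
  (forall x, a <= x <= b -> `|g x| <= M) -> `|rint a b g| <= M * (b - a).
Proof.
move=> ab cg gM; rewrite -rint_cst//.
rewrite ler_norml -[- rint _ _ _]mulN1r -rintZ; last exact: cont_on_cst.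
apply/andP; split; apply: ler_rint => //; try exact: cont_on_cst.
- by move=> x /gM; rewrite mulN1r ler_norml => /andP[].
- by move=> x /gM; rewrite ler_norml => /andP[].
Qed.

Lemma rint_FTC a b g G : a <= b -> cont_on a b g ->
  (forall x, is_derive x (1 : R) G (g x)) -> rint a b g = G b - G a.
Proof.
rewrite le_eqVlt => /predU1P[<- _ _|ab cg dG].
  by rewrite subrr /rint set_itv1 Rintegral_set1.
have dG' x : derivable G x 1 by have := dG x => -[].
have cG : continuous G by move=> x; apply/differentiable_continuous/derivable1_diffP.
rewrite /rint /Rintegral (@continuous_FTC2 _ g G)//.
- exact: cont_on_within.
- split; first by move=> x _; exact: dG'.
  + exact/cvg_at_right_filter/cG.
  + exact/cvg_at_left_filter/cG.
- by move=> x _; rewrite derive1E; have := dG x => -[].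
Qed.

End ContinuousIntegral.

Section ComplexContinuity.
Variable R : realType.

Lemma continuous_Re : continuous (@complex.Re R : (R[i])^o -> R^o).
Proof.
move=> z; apply/(@cvgrPdist_lt _ R^o _ (nbhs (z : (R[i])^o))) => e e0; exists e%:C => /=; first by rewrite ltcR.
move=> w; rewrite /ball/= normc_def.
have := ler_Re_normc (z - w); case: (z) => a b; case: (w) => c d /= H.
by rewrite ltcR; exact: le_lt_trans.
Qed.

Lemma continuous_Im : continuous (@complex.Im R : (R[i])^o -> R^o).
Proof.
move=> z; apply/(@cvgrPdist_lt _ R^o _ (nbhs (z : (R[i])^o))) => e e0; exists e%:C => /=; first by rewrite ltcR.
move=> w; rewrite /ball/= normc_def.
have := ler_Im_normc (z - w); case: (z) => a b; case: (w) => c d /= H.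
by rewrite ltcR; exact: le_lt_trans.
Qed.

Lemma ler_dist_normc (z w : R[i]) : `|normc z - normc w| <= normc (z - w).
Proof.
have Hz : normc z <= normc (z - w) + normc w by rewrite -{1}(subrK w z) ler_normcD.
have Hw : normc w <= normc (z - w) + normc z.
  by rewrite normcB -{1}(subrK z w) ler_normcD.
by rewrite ler_norml; apply/andP; split; lra.
Qed.

Lemma continuous_normc : continuous (@normc R : (R[i])^o -> R^o).
Proof.
move=> z; apply/(@cvgrPdist_lt _ R^o _ (nbhs (z : (R[i])^o))) => e e0; exists e%:C => /=; first by rewrite ltcR.
move=> w; rewrite /ball/= normc_def => H.
have {}H : normc (z - w) < e by move: H; case: (z - w) => u v; rewrite ltcR.
exact: le_lt_trans (ler_dist_normc z w) H.
Qed.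

Lemma continuous_realC : continuous ((fun x => x%:C) : R^o -> (R[i])^o).
Proof.
move=> z; apply/(@cvgrPdist_lt _ (R[i])^o) => -[e e'].
rewrite ltcE/= => /andP[/eqP -> e0]; near=> w.
rewrite -rmorphB/= normc_def/= expr0n/= addr0 sqrtr_sqr ltcR; near: w.
by exists e => //= y; rewrite /ball/=.
Unshelve. all: by end_near. Qed.

Lemma continuous_analytic (f : R[i] -> R[i]) z : analytic_disc f -> disc z ->
  {for z, continuous (f : (R[i])^o -> (R[i])^o)}.
Proof.
move=> af zd; apply/(@differentiable_continuous _ _ (R[i])^o)/derivable1_diffP.
exact: af.
Qed.

End ComplexContinuity.

(** * Cauchy estimate on circles *)

Section UnitArc.
Variable R : realType.
Implicit Types u v : R.

(** The cosine of the angle whose tangent is [u]. *)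
Definition csec u : R := (Num.sqrt (1 + u ^+ 2))^-1.

(* [gam u] is the point of the unit circle on the ray of slope [u]; in terms of
   the angle, [d theta = csec u ^+ 2 du]. *)
Definition gam u : R[i] := csec u +i* (u * csec u).

Let sec_ge1 u : 1 <= Num.sqrt (1 + u ^+ 2).
Proof. by rewrite -{1}sqrtr1 ler_sqrt ?lerDl ?sqr_ge0// addr_ge0 ?sqr_ge0. Qed.

Let sec_gt0 u : 0 < Num.sqrt (1 + u ^+ 2).
Proof. exact: lt_le_trans (sec_ge1 u). Qed.

Lemma csec_gt0 u : 0 < csec u.
Proof. by rewrite invr_gt0. Qed.

Lemma csec_le1 u : csec u <= 1.
Proof. by rewrite invf_le1. Qed.

Lemma sqr_csec u : csec u ^+ 2 = (1 + u ^+ 2)^-1.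
Proof. by rewrite exprVn sqr_sqrtr// addr_ge0 ?sqr_ge0. Qed.

Lemma sqr_csec_le1 u : csec u ^+ 2 <= 1.
Proof. by rewrite exprn_ile1 ?csec_le1// ltW ?csec_gt0. Qed.

Lemma csecK u : csec u ^+ 2 * (1 + u ^+ 2) = 1.
Proof. by rewrite sqr_csec mulVf// gt_eqF// ltr_wpDr ?sqr_ge0. Qed.

Lemma sqr_csec_ge2 u : -1 <= u <= 1 -> 2^-1 <= csec u ^+ 2.
Proof.
move=> u1; rewrite sqr_csec lef_pV2 ?posrE ?ltr_wpDr ?sqr_ge0//.
by have := sqr_ge0 u; nra.
Qed.

Lemma normc_gam u : normc (gam u) = 1.
Proof.
apply/eqP; rewrite -(@eqrXn2 _ 2) ?normc_ge0// sqr_normc/= expr1n exprMn.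
by rewrite -{1}[csec u ^+ 2]mul1r -mulrDl mulrC csecK.
Qed.

(** Slopes in [-1, 1] are angles in [-pi/4, pi/4]; turning this arc by ['i] puts its start on its
    end, so four copies close up to a circle. *)
Lemma gam1 : gam 1 = 'i * gam (-1).
Proof. by apply/eqP; rewrite eq_complex/= /csec sqrrN; apply/andP; split; apply/eqP; ring. Qed.

Lemma is_derive_csec u : is_derive u (1 : R) csec (- (u * csec u ^+ 3)).
Proof.
have u0 : 0 < 1 + u ^+ 2 by rewrite ltr_wpDr ?sqr_ge0.
have d1 : is_derive u (1 : R) (fun v : R => 1 + v ^+ 2) (u *+ 2).
  apply: is_derive_eq; rewrite /GRing.scale/=. ring.
have d2 := @is_derive1_sqrt _ _ u0.
have d3 : is_derive u (1 : R) (fun v : R => Num.sqrt (1 + v ^+ 2)) ((2 * Num.sqrt (1 + u ^+ 2))^-1 * (u *+ 2)).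
  exact: (@is_derive1_comp _ Num.sqrt (fun v : R => 1 + v ^+ 2)).
have sn0 : Num.sqrt (1 + u ^+ 2) != 0 by rewrite gt_eqF.
have := is_deriveV (f := fun v : R => Num.sqrt (1 + v ^+ 2)) sn0.
move=> /(_ _ _ d3) d4; apply: (is_derive_eq d4).
rewrite /csec /GRing.scale/=; field; rewrite sn0//.
Qed.

Lemma is_derive_ucsec u : is_derive u (1 : R) (fun v => v * csec v) (csec u ^+ 3).
Proof.
have d := is_derive_csec u.
apply: is_derive_eq.
rewrite /GRing.scale/= mulr1 -{2}[csec u]mulr1 -(csecK u); ring.
Qed.

(** The imaginary part of d (a * gam) / du = 'i * a * gam * csec^2. *)
Lemma is_derive_gam (a : R[i]) u :
  is_derive u (1 : R) (fun v => complex.Im (a * gam v))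
    (complex.Re (a * gam u) * csec u ^+ 2).
Proof.
have d1 := is_derive_csec u; have d2 := is_derive_ucsec u.
have -> : (fun v => complex.Im (a * gam v)) =
    (fun v => complex.Re a * (v * csec v) + complex.Im a * csec v).
  by apply/funext => v; case: a => x y /=; rewrite mulrCA; ring.
apply: is_derive_eq.
case: a => x y; rewrite /GRing.scale/= ; ring.
Qed.

Lemma continuous_csec : continuous (csec : R^o -> R^o).
Proof.
move=> u; apply/differentiable_continuous/derivable1_diffP.
by have [] := is_derive_csec u.
Qed.

Lemma continuous_gam : continuous (gam : R^o -> (R[i])^o).
Proof.
have -> : (gam : R -> R[i]) = fun u => (csec u)%:C * (1 +i* u).
  by apply/funext => u; apply/eqP; rewrite eq_complex/=; apply/andP; split; apply/eqP; ring.
have -> : (fun u => (csec u)%:C * (1 +i* u)) = fun u => (csec u)%:C * (1 + 'i * u%:C).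
  by apply/funext => u; congr (_ * _); apply/eqP; rewrite eq_complex/=; apply/andP; split; apply/eqP; ring.
move=> u; apply: (@cvgM (R[i]) R^o).
  apply: (@continuous_comp R^o R^o (R[i])^o csec (fun x => x%:C)).
    exact: continuous_csec.
  exact: continuous_realC.
apply: (@cvgD _ (R[i])^o); first exact: cvg_cst.
by apply: (@cvgM (R[i]) R^o); [exact: cvg_cst|exact: continuous_realC].
Qed.

Lemma gam_lipschitz u v : normc (gam u - gam v) <= 2 * `|u - v|.
Proof.
have cu := csec_gt0 u; have cv := csec_gt0 v.
have -> : gam u - gam v = (csec u * (u - v))%:C * 'i + ((csec u - csec v)%:C * (1 +i* v)).
  by apply/eqP; rewrite eq_complex/=; apply/andP; split; apply/eqP; ring.
apply: (le_trans (ler_normcD _ _)); rewrite !normcM !normcR.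
have -> : normc ('i : R[i]) = 1 by rewrite /= expr0n expr1n add0r sqrtr1.
have -> : normc (1 +i* v) = (csec v)^-1 by rewrite /= expr1n /csec invrK.
rewrite mulr1 normrM (gtr0_norm cu) mulr2n mulrDl mul1r lerD//.
  by rewrite -[leRHS]mul1r ler_wpM2r// csec_le1.
have -> : csec u - csec v = csec u * csec v * ((csec v)^-1 - (csec u)^-1).
  by field; rewrite !gt_eqF.
rewrite !normrM (gtr0_norm cu) (gtr0_norm cv) mulrAC mulfK ?gt_eqF//.
apply: (@le_trans _ _ (1 * `|(csec v)^-1 - (csec u)^-1|)).
  by rewrite ler_wpM2r// csec_le1.
rewrite mul1r /csec !invrK.
(* The inverse of [csec] at x is the modulus of 1 +i* x, hence 1-Lipschitz by the reverse triangle
   inequality. *)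
have nE (x : R) : Num.sqrt (1 + x ^+ 2) = normc (1 +i* x) by rewrite /= expr1n.
rewrite !nE (le_trans (ler_dist_normc _ _))//.
have -> : (1 +i* v) - (1 +i* u) = 'i * (v - u)%:C.
  by apply/eqP; rewrite eq_complex/=; apply/andP; split; apply/eqP; ring.
rewrite normcM normcR distrC.
by rewrite /= expr0n expr1n add0r sqrtr1 mul1r.
Qed.

End UnitArc.

Lemma ler_dist_rint (R : realType) (a b M : R) (g h : R -> R) :
  a <= b -> cont_on a b g -> cont_on a b h ->
  (forall x, a <= x <= b -> `|g x - h x| <= M) ->
  `|rint a b g - rint a b h| <= M * (b - a).
Proof.
move=> ab cg ch H; rewrite -rintB//; apply: ler_norm_rint => // x xab.
by apply: (@cvgB _ R^o); [exact: cg|exact: ch].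
Qed.

Section Cone.
Variable R : realType.
Implicit Types (z e : R[i]) (rho t u : R).

Definition arc rho e u : R[i] := rho%:C * e * gam u.

Definition cone z rho e t u : R[i] := z + t%:C * (arc rho e u - z).

(* In the coordinates [(t, u)] of [cone z rho e] the Cauchy form is
   [dw / (w - z) = dt / t + i * cauchy_kernel du]. *)
Definition cauchy_kernel z rho e u : R[i] :=
  arc rho e u * (csec u ^+ 2)%:C / (arc rho e u - z).

End Cone.

Section SectorGoursat.
Let mulr_split (F : fieldType) (x y a t s c d : F) : d != 0 ->
  (x - y - a * t * d) * (s * c / d) =
  x * (s * c / d) - y * (s * c / d) - t * (a * s * c).
Proof. by move=> d0; field. Qed.

Let addr_split (S : comRingType) (a1 a2 b1 b2 c1 c2 c3 : S) :
  a1 + a2 - (b1 + b2) - (c3 - c1) = a1 - b1 - (c2 - c1) + (a2 - b2 - (c3 - c2)).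
Proof. by ring. Qed.

Let addr_split_r (S : comRingType) (a1 a2 a3 b1 b2 d1 d2 : S) :
  a3 - a1 - (b1 + b2 - (d1 + d2)) = a2 - a1 - (b1 - d1) + (a3 - a2 - (b2 - d2)).
Proof. by ring. Qed.

Variables (R : realType) (f : R[i] -> R[i]) (z e : R[i]) (rho : R).
Hypotheses (af : analytic_disc f) (ez : normc e = 1).
Hypotheses (zrho : normc z < rho) (rho1 : rho < 1).
Implicit Types t u : R.

Local Notation zeta := (arc rho e).
Local Notation Phi := (cone z rho e).
Local Notation kappa := (cauchy_kernel z rho e).
(** The imaginary part of f dw / (w - z) is t^-1 * V dt + U du. Following this part alone keeps
    every integral real. *)
Let U t u := complex.Re (f (Phi t u) * kappa u).
Let V t u := complex.Im (f (Phi t u)).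

Let rho_gt0 : 0 < rho.
Proof. exact: le_lt_trans (normc_ge0 z) zrho. Qed.

Let normc_zeta u : normc (zeta u) = rho.
Proof. by rewrite !normcM normcR ez normc_gam !mulr1 gtr0_norm. Qed.

Let zeta_far u : rho - normc z <= normc (zeta u - z).
Proof.
rewrite lerBlDr -{1}(normc_zeta u) -{1}(subrK z (zeta u)); exact: ler_normcD.
Qed.

Let zeta_near u : normc (zeta u - z) <= 2.
Proof.
apply: (le_trans (ler_normcD _ _)); rewrite normcN normc_zeta.
by have := zrho; have := rho1; lra.
Qed.

Let zeta_neq u : zeta u - z != 0.
Proof.
apply/negP => /eqP zz; have := zeta_far u; rewrite zz normc0.
by rewrite leNgt subr_gt0 zrho.
Qed.

Let Phi_disc t u : 0 <= t <= 1 -> disc (Phi t u).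
Proof.
move=> /andP[t0 t1]; rewrite discE.
have -> : Phi t u = (1 - t)%:C * z + t%:C * zeta u.
  by rewrite /cone rmorphB/=; ring.
apply: (le_lt_trans (ler_normcD _ _)); rewrite (normcM (1 - t)%:C) (normcM t%:C) !normcR normc_zeta.
rewrite !ger0_norm ?subr_ge0//.
have zr := zrho; have r1 := rho1; nra.
Qed.

Lemma normc_kappa_le u : normc (kappa u) <= rho / (rho - normc z) * csec u ^+ 2.
Proof.
rewrite normcM normcV (normcM (zeta u)) normc_zeta normcR ger0_norm ?sqr_ge0// mulrAC.
rewrite ler_wpM2r ?sqr_ge0// ler_wpM2l ?(ltW rho_gt0)//.
rewrite lef_pV2 ?zeta_far// ?posrE ?subr_gt0//.
by apply: lt_le_trans (zeta_far u); rewrite subr_gt0.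
Qed.

(** The real part of zeta / (zeta - z) is (rho^2 - <zeta, z>) / |zeta - z|^2, estimated by
    Cauchy-Schwarz. This positive lower bound stands in for the exact constant 2 pi of Cauchy's
    formula. *)
Lemma Re_kappa_ge u :
  rho * (rho - normc z) / (rho + normc z) ^+ 2 * csec u ^+ 2 <= complex.Re (kappa u).
Proof.
have -> : complex.Re (kappa u) = complex.Re (zeta u / (zeta u - z)) * csec u ^+ 2.
  rewrite /cauchy_kernel mulrAC; case: (zeta u / _) => x y /=; ring.
rewrite ler_wpM2r ?sqr_ge0//.
have := zeta_neq u; have := zeta_far u; have := normc_zeta u.
have : normc (zeta u - z) <= rho + normc z.
  by apply: (le_trans (ler_normcD _ _)); rewrite normcN normc_zeta.
have zr := zrho; have r0 := rho_gt0.
case: (zeta u) => a b; move: zr; case: (z) => c d.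
set n := normc (c +i* d) => nr H3 H1 H2 H4.
have n0 : 0 <= n by exact: normc_ge0.
have e1 : a ^+ 2 + b ^+ 2 = rho ^+ 2 by rewrite -H1 sqr_normc.
have e2 : c ^+ 2 + d ^+ 2 = n ^+ 2 by rewrite /n sqr_normc.
have e3 : (a - c) ^+ 2 + (b - d) ^+ 2 = normc (a +i* b - c +i* d) ^+ 2 by rewrite sqr_normc.
set m := normc _ in H3 H2 e3.
have m0 : 0 < m by apply: lt_le_trans H2; rewrite subr_gt0.
have CS : a * c + b * d <= rho * n.
  rewrite -(@ger0_norm _ (rho * n)) ?mulr_ge0 ?(ltW r0)//.
  apply: (le_trans (ler_norm _)); rewrite -ler_sqr ?nnegrE//.
  rewrite !real_normK ?num_real// exprMn -e1 -e2.
  rewrite -subr_ge0; have -> : (a ^+ 2 + b ^+ 2) * (c ^+ 2 + d ^+ 2) - (a * c + b * d) ^+ 2 = (a * d - b * c) ^+ 2 by ring.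
  exact: sqr_ge0.
have -> : complex.Re ((a +i* b) / (a +i* b - c +i* d)) =
    (rho ^+ 2 - (a * c + b * d)) / m ^+ 2.
  rewrite -e1 -e3 /=; ring.
apply: (@le_trans _ _ (rho * (rho - n) / m ^+ 2)).
  rewrite ler_wpM2l ?mulr_ge0 ?(ltW r0) ?subr_ge0 ?(ltW nr)//.
  rewrite lef_pV2 ?posrE ?exprn_gt0 ?ltr_wpDr//.
  by rewrite ler_sqr ?nnegrE ?addr_ge0// ltW.
by rewrite ler_wpM2r ?invr_ge0 ?sqr_ge0//; nra.
Qed.

Let continuous_zeta : continuous (zeta : R^o -> (R[i])^o).
Proof.
move=> u; apply: (@cvgM (R[i]) R^o); first exact: cvg_cst.
exact: continuous_gam.
Qed.

Let continuous_kappa : continuous (kappa : R^o -> (R[i])^o).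
Proof.
move=> u; apply: (@cvgM (R[i]) R^o).
  apply: (@cvgM (R[i]) R^o); first exact: continuous_zeta.
  apply: (@continuous_comp R^o R^o (R[i])^o (fun x => csec x ^+ 2) (fun x => x%:C)).
    have -> : (fun x : R => csec x ^+ 2) = (fun x => csec x * csec x).
      by apply/funext => x; rewrite expr2.
    by apply: (@cvgM R R^o); exact: continuous_csec.
  exact: continuous_realC.
apply: (@cvgV (R[i]) R^o); first exact: zeta_neq.
by apply: (@cvgB _ (R[i])^o); [exact: continuous_zeta|exact: cvg_cst].
Qed.

Let continuous_fPhi_l t u : 0 <= t <= 1 ->
  {for t, continuous ((fun t => f (Phi t u)) : R^o -> (R[i])^o)}.
Proof.
move=> t01.
apply: (@continuous_comp R^o (R[i])^o (R[i])^o (Phi^~ u) f).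
  apply: (@cvgD _ (R[i])^o); first exact: cvg_cst.
  apply: (@cvgM (R[i]) R^o); first exact: continuous_realC.
  exact: cvg_cst.
exact/continuous_analytic/Phi_disc.
Qed.

Let continuous_fPhi_r t u : 0 <= t <= 1 ->
  {for u, continuous ((fun u => f (Phi t u)) : R^o -> (R[i])^o)}.
Proof.
move=> t01.
apply: (@continuous_comp R^o (R[i])^o (R[i])^o (Phi t) f).
  apply: (@cvgD _ (R[i])^o); first exact: cvg_cst.
  apply: (@cvgM (R[i]) R^o); first exact: cvg_cst.
  by apply: (@cvgB _ (R[i])^o); [exact: continuous_zeta|exact: cvg_cst].
exact/continuous_analytic/Phi_disc.
Qed.

Let continuous_U t a b : 0 <= t <= 1 -> cont_on a b (U t).
Proof.
move=> t01 u _.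
apply: (@continuous_comp R^o (R[i])^o R^o (fun u => f (Phi t u) * kappa u)).
  by apply: (@cvgM (R[i]) R^o); [exact: continuous_fPhi_r|exact: continuous_kappa].
exact: continuous_Re.
Qed.

Let continuous_V u a b : 0 < a -> b <= 1 ->
  cont_on a b (fun t => t^-1 * V t u).
Proof.
move=> a0 b1 t /andP[ta tb].
have t0 : 0 < t by exact: lt_le_trans ta.
apply: cvgM; first by apply: cvgV; [rewrite gt_eqF|exact: cvg_id].
apply: (@continuous_comp R^o (R[i])^o R^o (fun t => f (Phi t u))).
  by apply: continuous_fPhi_l; rewrite (ltW t0) (le_trans tb).
exact: continuous_Im.
Qed.

(** The integral of the form t^-1 * V dt + U du over the boundary of the rectangle [t1, t2] x
    [u1, u2]. *)
Let E t1 t2 u1 u2 := (rint u1 u2 (U t2) - rint u1 u2 (U t1)) -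
  (rint t1 t2 (fun t => t^-1 * V t u2) - rint t1 t2 (fun t => t^-1 * V t u1)).


Let E_split_l t1 t2 t3 u1 u2 : 0 < t1 -> t1 <= t2 -> t2 <= t3 -> t3 <= 1 ->
  E t1 t3 u1 u2 = E t1 t2 u1 u2 + E t2 t3 u1 u2.
Proof.
move=> t10 t12 t23 t31; rewrite /E.
rewrite (rint_split t12 t23 (continuous_V t10 t31 (u := u2))).
rewrite (rint_split t12 t23 (continuous_V t10 t31 (u := u1))).
exact: addr_split_r.
Qed.

Let E_split_r t1 t2 u1 u2 u3 : 0 < t1 -> t1 <= t2 -> t2 <= 1 ->
  u1 <= u2 -> u2 <= u3 -> E t1 t2 u1 u3 = E t1 t2 u1 u2 + E t1 t2 u2 u3.
Proof.
move=> t10 t12 t21 u12 u23; rewrite /E.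
have t1P : 0 <= t1 <= 1 by rewrite (ltW t10) (le_trans t12).
have t2P : 0 <= t2 <= 1 by rewrite t21 andbT (le_trans (ltW t10)).
rewrite (rint_split u12 u23 (continuous_U t1P)).
rewrite (rint_split u12 u23 (continuous_U t2P)).
exact: addr_split.
Qed.

Let Phi_lipschitz t u t' u' : 0 <= t <= 1 ->
  normc (Phi t' u' - Phi t u) <= 2 * (`|t' - t| + `|u' - u|).
Proof.
move=> /andP[t0 t1].
have -> : Phi t' u' - Phi t u =
   (t' - t)%:C * (zeta u' - z) + t%:C * (rho%:C * e) * (gam u' - gam u).
  by rewrite /cone /arc rmorphB/=; ring.
apply: (le_trans (ler_normcD _ _)).
rewrite (normcM (t' - t)%:C) normcM (normcM t%:C) (normcM rho%:C) ez !normcR.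
rewrite mulrDr lerD//; first by rewrite mulrC ler_wpM2r.
rewrite mulr1 (ger0_norm t0) (gtr0_norm rho_gt0).
apply: le_trans (gam_lipschitz u' u); rewrite -[leRHS]mul1r ler_wpM2r ?normc_ge0//.
by have r1 := rho1; have r0 := rho_gt0; nra.
Qed.

(** Expand [f] to first order at [Phi t u]. The affine part contributes (t2 - t1) * L to both
    differences in [E], so it cancels; what remains comes from [rr], of size eta * s, integrated
    over sides of length at most s. *)
Let E_local b t u : 0 < b -> b <= t <= 1 ->
  forall eps, 0 < eps -> exists2 r, 0 < r & forall t1 t2 u1 u2,
    b <= t1 -> t1 <= t -> t <= t2 -> t2 <= 1 -> u1 <= u -> u <= u2 ->
    t2 - t1 < r -> u2 - u1 < r ->
    `|E t1 t2 u1 u2| <= eps * ((t2 - t1) + (u2 - u1)) ^+ 2.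
Proof.
move=> b0 /andP[bt tle1] eps eps0.
have t01 : 0 <= t <= 1 by rewrite tle1 andbT (le_trans (ltW b0)).
(* The sum of a bound for the kernel and a bound for t^-1 on [b, 1]; [eta] is then chosen so that
   the total error 4 * eta * Q equals [eps]. *)
pose Q := rho / (rho - normc z) + b^-1.
have Q1 : 0 < rho / (rho - normc z) by rewrite divr_gt0 ?subr_gt0.
have bi0 : 0 < b^-1 by rewrite invr_gt0.
have Q0 : 0 < Q by rewrite addr_gt0.
pose eta := eps / (4 * Q).
have eta0 : 0 < eta by rewrite divr_gt0 ?mulr_gt0.
have [a Ha] := derivable_expansion (af (Phi_disc u t01)).
have [d d0 {}Ha] := Ha _ eta0.
(* With both sides below d / 4, [Phi_lipschitz] keeps the image of the rectangle within distance 2 *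
   s < d of [Phi t u]. *)
exists (d / 4) => [|t1 t2 u1 u2 bt1 t1t tt2 t2le1 u1u uu2 tr ur]; first by rewrite divr_gt0.
set s := (t2 - t1) + (u2 - u1).
have t12 : t1 <= t2 by exact: le_trans tt2.
have u12 : u1 <= u2 by exact: le_trans uu2.
have t10 : 0 < t1 by exact: lt_le_trans bt1.
have t1P : 0 <= t1 <= 1 by rewrite (ltW t10) (le_trans t12).
have t2P : 0 <= t2 <= 1 by rewrite t2le1 andbT (le_trans (ltW t10)).
pose rr w := f w - f (Phi t u) - a * (w - Phi t u).
have rr_le t' u' : t1 <= t' <= t2 -> u1 <= u' <= u2 ->
    normc (rr (Phi t' u')) <= eta * (2 * s).
  move=> /andP[? ?] /andP[? ?].
  have H : normc (Phi t' u' - Phi t u) <= 2 * s.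
    apply: (le_trans (Phi_lipschitz _ _ _ t01)); rewrite ler_pM2l// /s lerD//.
      by rewrite ler_norml; apply/andP; split; lra.
    by rewrite ler_norml; apply/andP; split; lra.
  apply: (le_trans (Ha _ _)); last by rewrite ler_pM2l.
  by apply: (le_lt_trans H); rewrite /s; lra.
pose L := complex.Im (a * zeta u2) - complex.Im (a * zeta u1).
have cG : cont_on u1 u2 (fun v => complex.Re (a * (rho%:C * e) * gam v) * csec v ^+ 2).
  move=> v _; apply: cvgM; last first.
    have -> : (fun x : R => csec x ^+ 2) = (fun x => csec x * csec x).
      by apply/funext => x; rewrite expr2.
    by apply: (@cvgM R R^o); exact: continuous_csec.
  apply: (@continuous_comp R^o (R[i])^o R^o (fun v => a * (rho%:C * e) * gam v)).
    by apply: (@cvgM (R[i]) R^o); [exact: cvg_cst|exact: continuous_gam].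
  exact: continuous_Re.
have LE : rint u1 u2 (fun v => complex.Re (a * (rho%:C * e) * gam v) * csec v ^+ 2) = L.
  rewrite (rint_FTC u12 cG (fun v => is_derive_gam _ v)).
  by rewrite /L /arc !mulrA.
have H1 : `|rint u1 u2 (U t2) - rint u1 u2 (U t1) - (t2 - t1) * L| <=
    (rho / (rho - normc z) * (4 * eta * s)) * (u2 - u1).
  rewrite -LE -rintZ// -rintB; [|exact: continuous_U..].
  apply: ler_dist_rint => //.
  - by move=> v vP; apply: (@cvgB _ R^o); apply: continuous_U vP.
  - by move=> v vP; apply: cvgM; [exact: cvg_cst|exact: cG].
  move=> v vP.
  have -> : U t2 v - U t1 v -
      (t2 - t1) * (complex.Re (a * (rho%:C * e) * gam v) * csec v ^+ 2) =
    complex.Re ((rr (Phi t2 v) - rr (Phi t1 v)) * kappa v).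
    have -> : rr (Phi t2 v) - rr (Phi t1 v) =
        f (Phi t2 v) - f (Phi t1 v) - a * (t2 - t1)%:C * (zeta v - z).
      by rewrite /rr /cone rmorphB/=; ring.
    have -> : (f (Phi t2 v) - f (Phi t1 v) - a * (t2 - t1)%:C * (zeta v - z)) * kappa v =
       f (Phi t2 v) * kappa v - f (Phi t1 v) * kappa v -
       (t2 - t1)%:C * ((a * (rho%:C * e) * gam v) * (csec v ^+ 2)%:C).
      have -> : a * (rho%:C * e) * gam v = a * zeta v by rewrite /arc !mulrA.
      exact: mulr_split (zeta_neq v).
    rewrite /U; case: (f _ * _) => x1 y1; case: (f _ * _) => x2 y2.
    by case: (a * _ * _) => x3 y3 /=; ring.
  apply: (le_trans (ler_Re_normc _)); rewrite normcM mulrC.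
  apply: ler_pM; rewrite ?normc_ge0//.
    apply: (le_trans (normc_kappa_le _)); rewrite -[leRHS]mulr1.
    by rewrite ler_wpM2l ?sqr_csec_le1// ltW.
  apply: (le_trans (ler_normcD _ _)); rewrite normcN.
  have := rr_le t2 v; rewrite lexx t12 => /(_ erefl vP).
  by have := rr_le t1 v; rewrite lexx t12 => /(_ erefl vP); lra.
have H2 : `|rint t1 t2 (fun t => t^-1 * V t u2) - rint t1 t2 (fun t => t^-1 * V t u1) -
    (t2 - t1) * L| <= (b^-1 * (4 * eta * s)) * (t2 - t1).
  rewrite -rintB; [|exact: continuous_V..].
  rewrite [(t2 - t1) * L]mulrC -(rint_cst L t12); apply: ler_dist_rint => //.
  - by move=> v vP; apply: (@cvgB _ R^o); apply: continuous_V vP.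
  - exact: cont_on_cst.
  move=> v vP; have /andP[tv vt] := vP.
  have v0 : 0 < v by exact: lt_le_trans tv.
  have -> : v^-1 * V v u2 - v^-1 * V v u1 - L =
      v^-1 * complex.Im (rr (Phi v u2) - rr (Phi v u1)).
    have -> : rr (Phi v u2) - rr (Phi v u1) =
        f (Phi v u2) - f (Phi v u1) - v%:C * (a * zeta u2 - a * zeta u1).
      by rewrite /rr /cone; ring.
    rewrite /V /L; case: (f _) => x1 y1; case: (f _) => x2 y2.
    case: (a * _) => x3 y3; case: (a * _) => x4 y4 /=; field.
    by rewrite gt_eqF.
  rewrite normrM gtr0_norm ?invr_gt0//.
  apply: ler_pM; rewrite ?normr_ge0 ?invr_ge0 ?(ltW v0)//.
    by rewrite lef_pV2 ?posrE// (le_trans bt1).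
  apply: (le_trans (ler_Im_normc _)).
  apply: (le_trans (ler_normcD _ _)); rewrite normcN.
  have := rr_le v u2 vP; rewrite lexx u12 => /(_ erefl).
  by have := rr_le v u1 vP; rewrite lexx u12 => /(_ erefl); lra.
have -> : E t1 t2 u1 u2 = (rint u1 u2 (U t2) - rint u1 u2 (U t1) - (t2 - t1) * L) -
   (rint t1 t2 (fun t => t^-1 * V t u2) - rint t1 t2 (fun t => t^-1 * V t u1) -
    (t2 - t1) * L) by rewrite opprB addrA subrK.
apply: (le_trans (ler_normB _ _)); apply: (le_trans (lerD H1 H2)).
have s1 : t2 - t1 <= s by rewrite /s; lra.
have s2 : u2 - u1 <= s by rewrite /s; lra.
have s0 : 0 <= s by rewrite /s; lra.
have -> : eps = 4 * eta * Q by rewrite /eta; field; rewrite gt_eqF.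
have -> : 4 * eta * Q * s ^+ 2 = rho / (rho - normc z) * (4 * eta * s) * s +
   b^-1 * (4 * eta * s) * s by rewrite /Q; ring.
have es : 0 <= 4 * eta * s by apply: mulr_ge0 => //; apply: mulr_ge0 => //; exact: ltW.
apply: lerD; apply: ler_wpM2l => //; apply: mulr_ge0 => //; exact: ltW.
Qed.

Let sector_goursat b : 0 < b <= 1 -> E b 1 (-1) 1 = 0.
Proof.
move=> /andP[b0 b1]; have m11 : -1 <= 1 :> R by lra.
apply: (bisection_eq0 b1 m11).
- move=> t1 t2 t3 u1 u2 ? ? ? ? _ _ _; apply: E_split_l => //.
  exact: lt_le_trans b0 _.
- move=> t1 t2 u1 u2 u3 ? ? ? _ ? ? _; apply: E_split_r => //.
  exact: lt_le_trans b0 _.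
- move=> t u tP _ eps eps0; have [r r0 H] := E_local u b0 tP eps0.
  by exists r => // *; exact: H.
Qed.

(** Contracting the arc towards [z] costs only the integrals along the two straight sides, which
    neighbouring quarters share. The contraction stops at b > 0 because dt / t is singular at the
    vertex. *)
Lemma sector_cauchy b : 0 < b <= 1 ->
  rint (-1) 1 (fun u => complex.Re (f (zeta u) * kappa u)) -
  rint (-1) 1 (fun u => complex.Re (f (Phi b u) * kappa u)) =
  rint b 1 (fun t => t^-1 * complex.Im (f (Phi t 1))) -
  rint b 1 (fun t => t^-1 * complex.Im (f (Phi t (-1)))).
Proof.
move=> bP; apply/eqP; rewrite -subr_eq0; apply/eqP; rewrite -[RHS](sector_goursat bP).
rewrite /E (_ : U 1 = (fun u => complex.Re (f (zeta u) * kappa u)))//.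
by apply/funext => u; rewrite /U /cone mul1r addrC subrK.
Qed.

Lemma cont_on_sector t a b : 0 <= t <= 1 ->
  cont_on a b (fun u => complex.Re (f (Phi t u) * kappa u)).
Proof. exact: continuous_U. Qed.

Lemma cone_center t u : 0 <= t -> normc (Phi t u - z) <= 2 * t.
Proof.
move=> t0; rewrite /cone addrC addKr normcM normcR ger0_norm//.
by rewrite mulrC ler_wpM2r.
Qed.

Lemma cont_on_arc a b : cont_on a b (fun u => normc (f (zeta u)) * csec u ^+ 2).
Proof.
move=> u _; apply: cvgM; last first.
  have -> : (fun x : R => csec x ^+ 2) = (fun x => csec x * csec x).
    by apply/funext => x; rewrite expr2.
  by apply: (@cvgM R R^o); exact: continuous_csec.
apply: (@continuous_comp R^o (R[i])^o R^o (fun u => f (zeta u))).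
  apply: (@continuous_comp R^o (R[i])^o (R[i])^o zeta f).
    exact: continuous_zeta.
  by apply: continuous_analytic => //; rewrite discE normc_zeta.
exact: continuous_normc.
Qed.

End SectorGoursat.

Section CircleBound.
Variable R : realType.

(** When [F e] is an integral over the quarter arc centred at the direction [e], this is the
    integral over the whole circle. *)
Definition quad_sum (F : R[i] -> R) : R := F 1 + F 'i + F (-1) + F (- 'i).

(** An integral in the angle, not divided by the length of the arc. *)
Definition arc_mean (f : R[i] -> R[i]) rho e : R :=
  rint (-1) 1 (fun u => normc (f (arc rho e u)) * csec u ^+ 2).

Lemma ler_quad_sum F G :
  (forall e, normc e = 1 -> F e <= G e) -> quad_sum F <= quad_sum G.
Proof.
have n1 : normc (1 : R[i]) = 1 by exact: normc1.
have ni : normc ('i : R[i]) = 1 by rewrite /= expr0n expr1n add0r sqrtr1.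
have nN1 : normc (-1 : R[i]) = 1 by rewrite (normcN 1).
have nNi : normc (- 'i : R[i]) = 1 by rewrite (normcN 'i).
by move=> FG; rewrite /quad_sum !lerD// FG.
Qed.

Lemma eq_quad_sum F G :
  (forall e, normc e = 1 -> F e = G e) -> quad_sum F = quad_sum G.
Proof.
by move=> FG; apply/eqP; rewrite eq_le; apply/andP; split; apply: ler_quad_sum => e /FG ->.
Qed.

Lemma quad_sumZ a F : quad_sum (fun e => a * F e) = a * quad_sum F.
Proof. by rewrite /quad_sum !mulrDr. Qed.

(** By [gam1] the side of slope 1 of one quarter is the side of slope -1 of the next, so the side
    integrals telescope around the circle. *)
Lemma quad_sum_cauchy f z rho b : analytic_disc f -> normc z < rho -> rho < 1 ->
  0 < b <= 1 ->
  quad_sum (fun e => rint (-1) 1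
    (fun u => complex.Re (f (arc rho e u) * cauchy_kernel z rho e u))) =
  quad_sum (fun e => rint (-1) 1
    (fun u => complex.Re (f (cone z rho e b u) * cauchy_kernel z rho e u))).
Proof.
move=> af zr r1 bP.
pose W e s := rint b 1 (fun t => t^-1 * complex.Im (f (cone z rho e t s))).
have WE e : W e 1 = W (e * 'i) (-1).
  have -> : W e 1 = rint b 1 (fun t => t^-1 * complex.Im (f (cone z rho e t 1))) by [].
  by rewrite /W /cone /arc gam1 !mulrA.
have H e : normc e = 1 -> rint (-1) 1
    (fun u => complex.Re (f (arc rho e u) * cauchy_kernel z rho e u)) =
    rint (-1) 1 (fun u => complex.Re (f (cone z rho e b u) * cauchy_kernel z rho e u))
    + (W (e * 'i) (-1) - W e (-1)).
  move=> e1; rewrite -WE.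
  by rewrite -(sector_cauchy af e1 zr r1 bP) addrC subrK.
rewrite (eq_quad_sum H) /quad_sum mul1r.
have -> : 'i * 'i = -1 :> R[i] by rewrite -expr2 sqr_i.
have -> : -1 * 'i = - 'i :> R[i] by rewrite mulN1r.
have -> : - 'i * 'i = 1 :> R[i] by rewrite mulNr -expr2 sqr_i opprK.
by ring.
Qed.

(** Contract the circle to a small loop around [z], where [f] is nearly [f z]. The loop integral is
    at least about 4 * A * k0 by [Re_kappa_ge]; on the original circle it is at most [Q] times the
    integral of |f|. *)
Lemma circle_bound f z rho : analytic_disc f -> normc z < rho -> rho < 1 ->
  normc (f z) * (rho - normc z) ^+ 2 <= quad_sum (arc_mean f rho).
Proof.
move=> af zr r1.
have z0 := normc_ge0 z; have r0 : 0 < rho by exact: le_lt_trans zr.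
set n := normc z in zr z0 *.
pose Q := rho / (rho - n).
pose k0 := rho * (rho - n) / (rho + n) ^+ 2.
have Q0 : 0 < Q by rewrite divr_gt0// subr_gt0.
have k00 : 0 < k0.
  by apply: divr_gt0; [apply: mulr_gt0; rewrite ?subr_gt0|rewrite exprn_gt0 ?ltr_wpDr].
have m11 : -1 <= 1 :> R by lra.
have M_ge0 : 0 <= quad_sum (arc_mean f rho).
  have -> : 0 = quad_sum (fun=> 0) :> R by rewrite /quad_sum !addr0.
  apply: ler_quad_sum => e e1; rewrite -(mul0r (1 - -1)) -(rint_cst _ m11).
  apply: ler_rint => //; first exact: cont_on_cst.
    exact: (cont_on_arc af e1 zr r1).
  by move=> u _; rewrite mulr_ge0 ?normc_ge0 ?sqr_ge0.
have [->|fz0] := eqVneq (f z) 0; first by rewrite normc0 mul0r.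
set A := normc (f z).
have A0 : 0 < A.
  by rewrite lt_neqAle normc_ge0 andbT eq_sym; apply: contraNneq fz0 => /eq0_normc ->.
(* The unimodular factor [al] makes [g z] real and positive, so the lower bound on the real part of
   the kernel applies to the product. *)
pose al := (f z)^-1 * A%:C; pose g w := al * f w.
have al1 : normc al = 1.
  by rewrite normcM normcV normcR (gtr0_norm A0) mulVf// gt_eqF.
have gz : g z = A%:C by rewrite /g /al mulrAC mulVf// mul1r.
have ag : analytic_disc g.
  move=> w wd; exact: (@derivableZ (R[i]) (R[i])^o (R[i])^o f al w 1 (af w wd)).
have gf w : normc (g w) = normc (f w) by rewrite normcM al1 mul1r.
have zd : disc z by rewrite discE (lt_trans zr).
suff main (eps : R) : 0 < eps -> 4 * (A * k0) <= Q * quad_sum (arc_mean f rho) + eps.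
  have : 4 * (A * k0) <= Q * quad_sum (arc_mean f rho).
    by apply/ler_addgt0Pr => eps eps0; exact: main.
  move=> H.
  have : 4 * (A * k0) * ((rho - n) / rho) <= quad_sum (arc_mean f rho).
    have -> : (rho - n) / rho = Q^-1 by rewrite /Q invf_div.
    by rewrite ler_pdivrMr// [leRHS]mulrC.
  apply: le_trans.
  (* The leftover factor 4 / (rho + n)^2 is at least 1 because n < rho < 1. *)
  have -> : 4 * (A * k0) * ((rho - n) / rho) =
      A * (rho - n) ^+ 2 * (4 / (rho + n) ^+ 2).
    by rewrite /k0; field; rewrite !gt_eqF ?ltr_wpDr.
  apply: ler_peMr; first by rewrite mulr_ge0 ?(ltW A0) ?sqr_ge0.
  rewrite ler_pdivlMr ?exprn_gt0 ?ltr_wpDr// mul1r.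
  by nra.
(* An error of dl * Q over four slope intervals of length 2 adds up to [eps], whence the 8. *)
move=> eps0; pose dl := eps / (8 * Q).
have dl0 : 0 < dl by apply: divr_gt0 => //; apply: mulr_gt0.
have [a /(_ 1 ltr01)[d d0 Ha]] := derivable_expansion (ag _ zd).
pose L := normc a + 1.
have L0 : 0 < L by rewrite ltr_wpDl ?normc_ge0.
(* The bound d / 4 keeps the loop, of radius at most 2 * b, inside the range of the expansion; the
   last one makes the variation L * (2 * b) of [g] at most [dl]. *)
pose b := Num.min 1 (Num.min (d / 4) (dl / (2 * L))).
have b0 : 0 < b.
  rewrite !lt_min ltr01/=; apply/andP; split; apply: divr_gt0 => //.
  exact: mulr_gt0.
have b1 : b <= 1 by rewrite ge_min lexx.
have bd : b <= d / 4 by rewrite !ge_min lexx orbT.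
have bL : b <= dl / (2 * L) by rewrite !ge_min lexx !orbT.
have bP : 0 < b <= 1 by rewrite b0.
have b01 : 0 <= b <= 1 by rewrite ltW.
have near w : normc (w - z) <= 2 * b -> normc (g w - g z) <= dl.
  move=> wz; have wd : normc (w - z) < d by lra.
  have -> : g w - g z = (g w - g z - a * (w - z)) + a * (w - z) by rewrite subrK.
  apply: (le_trans (ler_normcD _ _)); rewrite normcM.
  apply: (le_trans (lerD (Ha _ wd) (lexx _))); rewrite -mulrDl addrC -/L.
  apply: (@le_trans _ _ (L * (2 * b))); first by rewrite ler_wpM2l// ltW.
  by move: bL; rewrite ler_pdivlMr ?mulr_gt0//; lra.
have kQ e u : normc e = 1 -> normc (cauchy_kernel z rho e u) <= Q.
  move=> e1; apply: (le_trans (normc_kappa_le e1 zr u)).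
  by rewrite -[leRHS]mulr1 ler_wpM2l ?(ltW Q0)// sqr_csec_le1.
have := quad_sum_cauchy ag zr r1 bP; set S1 := quad_sum _; set S2 := quad_sum _ => S12.
have HS1 : S1 <= Q * quad_sum (arc_mean f rho).
  rewrite -quad_sumZ; apply: ler_quad_sum => e e1.
  rewrite -rintZ; last exact: (cont_on_arc af e1 zr r1).
  apply: ler_rint.
  - have := cont_on_sector ag e1 zr r1 (a := -1) (b := 1) (t := 1).
    have -> : (fun u => complex.Re (g (cone z rho e 1 u) * cauchy_kernel z rho e u)) =
              (fun u => complex.Re (g (arc rho e u) * cauchy_kernel z rho e u)).
      by apply/funext => u; rewrite /cone mul1r addrC subrK.
    by apply; rewrite ler01 lexx.
  - move=> u uP; apply: cvgM; first exact: cvg_cst.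
    exact: (cont_on_arc af e1 zr r1 uP).
  move=> u _; apply: (le_trans (ler_norm _)); apply: (le_trans (ler_Re_normc _)).
  rewrite normcM gf mulrCA ler_wpM2l ?normc_ge0//.
  exact: normc_kappa_le.
have HS2 : 4 * (A * k0) - eps <= S2.
  have -> : 4 * (A * k0) - eps = quad_sum (fun=> A * k0 - 2 * dl * Q).
    by rewrite /quad_sum /dl; field; rewrite gt_eqF.
  apply: ler_quad_sum => e e1.
  have -> : A * k0 - 2 * dl * Q = (A * (k0 / 2) - dl * Q) * (1 - -1) by field.
  rewrite -rint_cst//; apply: ler_rint; first exact: cont_on_cst.
    exact: (cont_on_sector ag e1 zr r1).
  move=> u uP.
  have -> : g (cone z rho e b u) * cauchy_kernel z rho e u =
      A%:C * cauchy_kernel z rho e u +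
      (g (cone z rho e b u) - g z) * cauchy_kernel z rho e u.
    by rewrite -mulrDl gz addrC subrK.
  rewrite raddfD/= lerD//.
    have -> : complex.Re (A%:C * cauchy_kernel z rho e u) =
        A * complex.Re (cauchy_kernel z rho e u).
      by case: (cauchy_kernel _ _ _ _) => x y /=; rewrite mul0r subr0.
    rewrite ler_wpM2l ?(ltW A0)//; apply: le_trans (Re_kappa_ge e1 zr u).
    by rewrite ler_wpM2l ?(ltW k00)// sqr_csec_ge2.
  have : normc ((g (cone z rho e b u) - g z) * cauchy_kernel z rho e u) <= dl * Q.
    rewrite normcM ler_pM ?normc_ge0 ?kQ//; apply: near.
    by apply: cone_center => //; rewrite ltW.
  by have := ler_Re_normc ((g (cone z rho e b u) - g z) * cauchy_kernel z rho e u);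
    rewrite ler_norml => /andP[+ _]; lra.
lra.
Qed.

End CircleBound.

(** * Integrals of non-measurable functions *)

Section AlmostEverywhere.
Context d (T : measurableType d) (R : realType).
Variable mu : {measure set T -> \bar R}.
Implicit Types P Q : T -> Prop.

Lemma ae_imp P Q : (forall x, P x -> Q x) ->
  {ae mu, forall x, P x} -> {ae mu, forall x, Q x}.
Proof. by move=> PQ; apply: (@filterS _ _ (ae_filter_ringOfSetsType mu)). Qed.

Lemma ae_imp2 P Q P' : (forall x, P x -> P' x -> Q x) ->
  {ae mu, forall x, P x} -> {ae mu, forall x, P' x} -> {ae mu, forall x, Q x}.
Proof. by move=> PQ; apply: (@filterS2 _ _ (ae_filter_ringOfSetsType mu)). Qed.

End AlmostEverywhere.

Section LowerIntegral.
Local Open Scope ereal_scope.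
Context d (T : measurableType d) (R : realType).
Variable mu : {measure set T -> \bar R}.
Implicit Types (f g : T -> \bar R) (D : set T).

Import HBNNSimple.

(** Every simple minorant of [f] is one of [g], so monotonicity is immediate from the definition as
    a supremum. *)
Lemma ge0_le_lower_integral D f g : (forall x, D x -> 0 <= f x) ->
  (forall x, D x -> f x <= g x) ->
  \int[mu]_(x in D) f x <= \int[mu]_(x in D) g x.
Proof.
move=> f0 fg.
have g0 x : D x -> 0 <= g x by move=> Dx; exact: le_trans (f0 _ Dx) (fg _ Dx).
rewrite !ge0_integralE//; apply: le_ereal_sup => _ [h hf <-]; exists h => //= x.
apply: (le_trans (hf x)); rewrite !patchE.
by case: ifPn => //; rewrite inE; exact: fg.
Qed.

(* The integral of a non-measurable non-negative function is determined by its
   measurable minorants. *)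
Lemma lower_integral_leP D f (c : \bar R) : measurable D ->
  (forall x, D x -> 0 <= f x) ->
  (forall h : T -> \bar R, measurable_fun setT h -> (forall x, 0 <= h x) ->
    (forall x, D x -> h x <= f x) -> \int[mu]_(x in D) h x <= c) ->
  \int[mu]_(x in D) f x <= c.
Proof.
move=> mD f0 H; rewrite ge0_integralE//; apply: ge_ereal_sup => _ [h /= hf <-].
rewrite -integralT_nnsfun.
have hE x : (h x)%:E = ((EFin \o h) \_ D) x.
  rewrite patchE; case: ifPn => // /negP xD; apply/eqP; rewrite eq_le lee_fin/=.
  apply/andP; split; last by rewrite lee_fin.
  by have := hf x; rewrite patchE; case: ifPn => // /xD.
under eq_integral do rewrite hE.
rewrite -integral_mkcond; apply: H.
- exact/measurable_EFinP.
- by move=> x; rewrite /= lee_fin.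
- by move=> x Dx; have := hf x; rewrite patchE mem_set.
Qed.

(** Deleting the measurable null set [N] from a measurable minorant of [f] leaves its integral
    unchanged and puts it below [g] everywhere. *)
Lemma ge0_ae_le_lower_integral D f g : measurable D ->
  (forall x, D x -> 0 <= f x) -> (forall x, D x -> 0 <= g x) ->
  {ae mu, forall x, D x -> f x <= g x} ->
  \int[mu]_(x in D) f x <= \int[mu]_(x in D) g x.
Proof.
move=> mD f0 g0 [N [mN N0 subN]]; apply: lower_integral_leP => // h mh h0 hf.
rewrite (ge0_negligible_integral mN mD _ _ N0)//; last exact: measurable_funTS.
rewrite setDE integral_mkcondr; apply: ge0_le_lower_integral => x Dx.
  by apply: erestrict_ge0.
rewrite patchE; case: ifPn => [|_]; last exact: g0.
rewrite inE => Nx; apply: (le_trans (hf _ Dx)).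
by apply: contrapT => fg; apply: Nx; apply: subN => /(_ Dx).
Qed.

Lemma ge0_ae_eq_lower_integral D f g : measurable D ->
  (forall x, D x -> 0 <= f x) -> (forall x, D x -> 0 <= g x) ->
  {ae mu, forall x, D x -> f x = g x} ->
  \int[mu]_(x in D) f x = \int[mu]_(x in D) g x.
Proof.
move=> mD f0 g0 fg; apply/eqP; rewrite eq_le; apply/andP; split;
  apply: ge0_ae_le_lower_integral => //; move: fg; apply: ae_imp => x + Dx;
  by move=> /(_ Dx) ->.
Qed.

End LowerIntegral.

Section ScaleIntegral.
Local Open Scope ereal_scope.
Variable R : realType.
Local Notation RT := (measurableTypeR R).
Local Notation mu := (@lebesgue_measure R).

Let measurable_scale (a : R) : measurable_fun setT (fun u : RT => (a * u)%R : RT).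
Proof. by apply: measurable_funM => //; exact: measurable_cst. Qed.

Let preimage_scale_pos (a x y : R) : (0 < a)%R ->
  (fun u : RT => (a * u)%R : RT) @^-1` `]x, y]%classic = `](x / a)%R, (y / a)%R]%classic.
Proof.
move=> a0; apply/seteqP; split=> u /=; rewrite !in_itv/=.
  by rewrite ltr_pdivrMr// ler_pdivlMr// mulrC.
by rewrite ltr_pdivrMr// ler_pdivlMr// mulrC.
Qed.

Let preimage_scale_neg (a x y : R) : (a < 0)%R ->
  (fun u : RT => (a * u)%R : RT) @^-1` `]x, y]%classic = `[(y / a)%R, (x / a)%R[%classic.
Proof.
move=> a0; apply/seteqP; split=> u /=; rewrite !in_itv/=.
  by rewrite ltr_ndivlMr// ler_ndivrMr// mulrC andbC.
by rewrite ltr_ndivlMr// ler_ndivrMr// mulrC andbC.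
Qed.

Let push_scale (a : R) : {measure set RT -> \bar R}.
Proof.
pose m : {measure set RT -> \bar R} := pushforward mu (fun u : RT => (a * u)%R : RT).
exact: (m (measurable_scale a)).
Defined.

(** Uniqueness of Lebesgue measure reduces this to intervals open on the left and closed on the
    right; a negative factor exchanges their ends, hence two preimage computations. *)
Let lebesgue_measure_scale (a : R) (A : set RT) : a != 0%R -> measurable A ->
  mu A = mscale (NngNum (normr_ge0 a)) (push_scale a) A.
Proof.
move=> a0 mA; apply: lebesgue_measure_unique => // X [[x y] _ <-].
change (mu `]x, y]%classic =
  `|a|%:E * mu ((fun u : RT => (a * u)%R : RT) @^-1` `]x, y]%classic)).
rewrite lebesgue_measure_itv/= lte_fin.
have [apos|aneg|/eqP] := ltgtP a 0%R; last by rewrite (negPf a0).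
- rewrite preimage_scale_neg// lebesgue_measure_itv/= lte_fin ltr_nM2r ?invr_lt0//.
  case: ifPn; last by rewrite mule0.
  by rewrite ltr0_norm// -!EFinD -EFinM => _; congr (_%:E); field.
- rewrite preimage_scale_pos// lebesgue_measure_itv/= lte_fin ltr_pM2r ?invr_gt0//.
  case: ifPn; last by rewrite mule0.
  by rewrite gtr0_norm// -!EFinD -EFinM => _; congr (_%:E); field.
Qed.

Lemma ge0_integral_scale (a : R) (g : R -> \bar R) : a != 0%R ->
  measurable_fun setT (g : RT -> \bar R) -> (forall x, 0 <= g x) ->
  \int[mu]_x g x = `|a|%:E * \int[mu]_x g (a * x)%R.
Proof.
move=> a0 mg g0; have ms := measurable_scale a.
rewrite (eq_measure_integral (mscale (NngNum (normr_ge0 a)) (push_scale a))).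
  rewrite ge0_integral_mscale//; congr (_ * _).
  by rewrite ge0_integral_pushforward.
by move=> A mA _; exact: lebesgue_measure_scale.
Qed.

End ScaleIntegral.

(** * Polar coordinates *)

Section PlanePolar.
Local Open Scope ereal_scope.
Variable R : realType.
Local Notation RT := (measurableTypeR R).
Local Notation mu := (@lebesgue_measure R).

Lemma ae_neq (a : R) : {ae mu, forall x, x != a}.
Proof.
exists [set a]; split; [exact: measurable_set1|exact: lebesgue_measure_set1|].
by move=> x /= /negP; rewrite negbK => /eqP.
Qed.

Lemma measurable_csec : measurable_fun setT (@csec R : RT -> RT).
Proof. by apply: continuous_measurable_fun; exact: continuous_csec. Qed.

(** For fixed x substitute y = x * u, exchange the integrals, then for fixed u substitute x = csec u
    * r. The radius runs over the whole line, so each non-vertical line through the origin is met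
    once, by its slope. *)
Lemma plane_polar (F : RT * RT -> \bar R) : measurable_fun setT F ->
  (forall x, 0 <= F x) ->
  \int[@plane_leb R]_x F x =
  \int[mu]_u \int[mu]_r (F ((r * csec u)%R, (r * csec u * u)%R) * (`|r| * csec u ^+ 2)%:E).
Proof.
move=> mF F0.
pose H (z : RT * RT) := `|z.1|%:E * F (z.1, (z.1 * z.2)%R).
have mH : measurable_fun setT H.
  apply: emeasurable_funM.
    by apply/measurable_EFinP; apply: measurableT_comp.
  apply: measurableT_comp => //; apply: measurable_fun_pair => //.
  exact: measurable_funM.
have H0 z : 0 <= H z by rewrite mule_ge0.
have -> : \int[@plane_leb R]_x F x = \int[mu]_x \int[mu]_y F (x, y).
  exact: (@fubini_tonelli1 _ _ RT RT R mu mu F mF F0).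
have -> : \int[mu]_x \int[mu]_y F (x, y) = \int[mu]_x \int[mu]_u H (x, u).
  apply: ge0_ae_eq_lower_integral => //.
  - by move=> x _; exact: integral_ge0.
  - by move=> x _; exact: integral_ge0.
  (* The slope is undefined on the vertical axis, which is the single abscissa x = 0. *)
  have := ae_neq 0%R; apply: ae_imp => x x0 _.
  rewrite (ge0_integral_scale x0)//; last exact: measurable_fun_pair2.
  rewrite -ge0_integralZl//.
  apply: (measurableT_comp (measurable_fun_pair2 x mF)).
  exact: measurable_funM.
have -> : \int[mu]_x \int[mu]_u H (x, u) = \int[mu]_u \int[mu]_x H (x, u).
  exact: (@fubini_tonelli _ _ RT RT R mu mu H mH H0).
apply: eq_integral => u _.
have c0 : csec u != 0%R by rewrite gt_eqF// csec_gt0.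
rewrite (ge0_integral_scale c0)//; last exact: measurable_fun_pair1.
have mHc : measurable_fun setT (fun r : RT => H ((csec u * r)%R, u)).
  apply: (measurableT_comp (measurable_fun_pair1 u mH)).
  exact: measurable_funM.
rewrite -ge0_integralZl//.
apply: eq_integral => r _; rewrite /H/= [(csec u * r)%R]mulrC muleA muleC.
congr (_ * _); rewrite -EFinM normrM (gtr0_norm (csec_gt0 u)).
by congr (_%:E); ring.
Qed.

Lemma ge0_integral_sym (g : R -> \bar R) : measurable_fun setT (g : RT -> \bar R) ->
  (forall r, 0 <= g r) -> (forall r, (1 <= `|r|)%R -> g r = 0) ->
  \int[mu]_r g r = \int[mu]_(r in `]0%R, 1%R[) g r + \int[mu]_(r in `]0%R, 1%R[) g (- r)%R.
Proof.
move=> mg g0 g1.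
have mgN : measurable_fun setT (fun r : RT => g (- r)%R).
  by apply: (measurableT_comp mg); exact: oppr_measurable.
pose h1 := g \_ `]0%R, 1%R[; pose h2 := g \_ `](-1)%R, 0%R[.
have h10 r : 0 <= h1 r by exact: erestrict_ge0.
have h20 r : 0 <= h2 r by exact: erestrict_ge0.
have mh1 : measurable_fun setT (h1 : RT -> \bar R).
  by apply/(measurable_restrictT _ _).1 => //; exact: measurable_funTS.
have mh2 : measurable_fun setT (h2 : RT -> \bar R).
  by apply/(measurable_restrictT _ _).1 => //; exact: measurable_funTS.
have -> : \int[mu]_r g r = \int[mu]_r (h1 r + h2 r).
  apply: ge0_ae_eq_lower_integral => // [r _|]; first by rewrite adde_ge0.
  have := ae_neq 0%R; apply: ae_imp => r r0 _; rewrite /h1 /h2 !patchE !mem_setE !in_itv/=.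
  have [r1|r1] := leP 1%R `|r|%R.
    by rewrite g1// !fun_if/= !if_same adde0.
  move: r1; rewrite ltr_norml => /andP[-> ->]; rewrite andbT/=.
  case: (ltgtP r 0%R) r0 => // [r0 _|r0 _]; first by rewrite add0e.
  by rewrite adde0.
rewrite ge0_integralD//; congr (_ + _); first by rewrite [RHS]integral_mkcond.
rewrite (@ge0_integral_scale _ (-1)) ?oppr_eq0 ?oner_eq0//.
rewrite normrN normr1 mul1e [RHS]integral_mkcond; apply: eq_integral => r _.
rewrite /h2 !patchE !mem_setE !in_itv/= mulN1r ltrN2 oppr_lt0.
by rewrite andbC.
Qed.

End PlanePolar.

Section DiscPolar.
Local Open Scope ereal_scope.
Variable R : realType.
Local Notation RT := (measurableTypeR R).
Local Notation mu := (@lebesgue_measure R).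
Implicit Types (F G : R[i] -> \bar R) (e : R[i]) (r u : R).

Lemma arcM r (e e' : R[i]) u : (e * arc r e' u)%R = arc r (e * e')%R u.
Proof. by rewrite /arc !mulrA [(e * _)%R]mulrC. Qed.

Lemma normc_arc r e u : normc e = 1%R -> normc (arc r e u) = `|r|%R.
Proof. by move=> e1; rewrite /arc !normcM e1 normc_gam normcR !mulr1. Qed.

Lemma disc_arc r e u : normc e = 1%R -> (0 < r < 1)%R -> disc (arc r e u).
Proof.
by move=> e1 /andP[r0 r1]; rewrite discE normc_arc// gtr0_norm.
Qed.

Lemma cptK (z : R[i]) : cpt (complex.Re z, complex.Im z) = z.
Proof. by case: z. Qed.

Lemma plane_discE : @plane_disc R = [set x | (x.1 ^+ 2 + x.2 ^+ 2 < 1)%R].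
Proof.
apply/seteqP; split=> x; rewrite /plane_disc/= discE /cpt => H.
  have := sqr_normc (x.1 +i* x.2); rewrite /= => <-.
  by rewrite exprn_ilt1// sqrtr_ge0.
by rewrite /= -[ltRHS]sqrtr1 ltr_sqrt.
Qed.

Lemma measurable_plane_disc : measurable (@plane_disc R).
Proof.
rewrite plane_discE.
have mf : measurable_fun setT (fun x : RT * RT => (x.1 ^+ 2 + x.2 ^+ 2)%R : RT).
  by apply: measurable_funD; apply: measurable_funX.
have := mf measurableT `]-oo, 1%R[%classic (measurable_itv _); rewrite setTI.
by congr measurable; apply/seteqP; split=> x; rewrite /= in_itv.
Qed.

(* The integral of [F] over half of the disc, in the coordinates
   [z = r * e * gam u]. *)
Definition sector e F : \bar R :=
  \int[mu]_u \int[mu]_(r in `]0%R, 1%R[) (F (arc r e u) * (r * csec u ^+ 2)%:E).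

Lemma le_sector e F G : normc e = 1%R -> (forall z, disc z -> 0 <= F z) ->
  (forall z, disc z -> F z <= G z) -> sector e F <= sector e G.
Proof.
move=> e1 F0 FG.
have j r u : (0 < r < 1)%R -> 0 <= (r * csec u ^+ 2)%:E.
  by move=> /andP[r0 _]; rewrite lee_fin mulr_ge0 ?sqr_ge0// ltW.
apply: ge0_le_lower_integral => u _.
  apply: integral_ge0 => r; rewrite /= in_itv/= => r01.
  by apply: mule_ge0; [exact/F0/disc_arc|exact: j].
apply: ge0_le_lower_integral => r; rewrite /= in_itv/= => r01.
  by apply: mule_ge0; [exact/F0/disc_arc|exact: j].
by apply: lee_wpmul2r; [exact: j|exact/FG/disc_arc].
Qed.

Definition measurable_on_disc F := measurable_fun (@plane_disc R) (F \o @cpt R).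

(** Extension by zero to the plane, so that Tonelli's theorem can be applied to functions measurable
    on the disc only. *)
Let ext F : RT * RT -> \bar R := (F \o @cpt R) \_ (@plane_disc R).

Let measurable_ext F : measurable_on_disc F -> measurable_fun setT (ext F).
Proof.
by move=> mF; apply/(measurable_restrictT _ _).1 => //; exact: measurable_plane_disc.
Qed.

Let ext_ge0 F : (forall z, disc z -> 0 <= F z) -> forall x, 0 <= ext F x.
Proof. by move=> F0 x; apply: erestrict_ge0 => // y; exact: F0. Qed.

Let amap e (z : RT * RT) : RT * RT :=
  (complex.Re (arc z.2 e z.1), complex.Im (arc z.2 e z.1)).

Let measurable_amap e : measurable_fun setT (amap e).
Proof.
have mc : measurable_fun setT (fun z : RT * RT => csec z.1 : RT).
  by apply: (measurableT_comp (@measurable_csec R)).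
have muc : measurable_fun setT (fun z : RT * RT => (z.1 * csec z.1)%R : RT).
  exact: measurable_funM.
apply: measurable_fun_pair.
  have -> : (fun z : RT * RT => complex.Re (arc z.2 e z.1)) =
      (fun z => z.2 * (complex.Re e * csec z.1 - complex.Im e * (z.1 * csec z.1)))%R.
    by apply/funext => -[u r]; rewrite /arc; case: e => a b /=; ring.
  apply: measurable_funM => //; apply: measurable_funB; exact: measurable_funM.
have -> : (fun z : RT * RT => complex.Im (arc z.2 e z.1)) =
    (fun z => z.2 * (complex.Re e * (z.1 * csec z.1) + complex.Im e * csec z.1))%R.
  by apply/funext => -[u r]; rewrite /arc; case: e => a b /=; ring.
apply: measurable_funM => //; apply: measurable_funD; exact: measurable_funM.
Qed.

Let ext_amap F e (z : RT * RT) : normc e = 1%R -> (0 < z.2 < 1)%R ->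
  ext F (amap e z) = F (arc z.2 e z.1).
Proof.
move=> e1 z01; rewrite /ext patchE.
have cE : cpt (amap e z) = arc z.2 e z.1.
  exact: cptK.
by rewrite mem_set /= ?cE// /plane_disc/= cE; exact: disc_arc.
Qed.

Let pol e F (z : RT * RT) : \bar R :=
  ((fun z => ext F (amap e z) * (z.2 * csec z.1 ^+ 2)%:E)
    \_ [set z | (0 < z.2 < 1)%R]) z.

Let measurable_strip : measurable [set z : RT * RT | (0 < z.2 < 1)%R].
Proof.
have ms : measurable_fun setT (snd : RT * RT -> RT) := measurable_snd.
have := ms measurableT `]0%R, 1%R[%classic (measurable_itv _); rewrite setTI; congr measurable; apply/seteqP; split=> z; by rewrite /= in_itv.
Qed.

Let measurable_pol e F : measurable_on_disc F -> measurable_fun setT (pol e F).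
Proof.
move=> mF; apply/(measurable_restrictT _ _).1; first exact: measurable_strip.
apply: measurable_funTS; apply: emeasurable_funM.
  exact: (measurableT_comp (measurable_ext mF) (measurable_amap e)).
apply/measurable_EFinP; apply: measurable_funM => //.
apply: measurable_funX; exact: (measurableT_comp (@measurable_csec R)).
Qed.

Let pol_ge0 e F : (forall z, disc z -> 0 <= F z) -> forall z, 0 <= pol e F z.
Proof.
move=> F0 z; apply: erestrict_ge0 => -[u r] /= /andP[r0 _].
by rewrite mule_ge0 ?ext_ge0// lee_fin mulr_ge0 ?sqr_ge0// ltW.
Qed.

Let inner_pol e F u : normc e = 1%R ->
  \int[mu]_(r in `]0%R, 1%R[) (F (arc r e u) * (r * csec u ^+ 2)%:E) =
  \int[mu]_r pol e F (u, r).
Proof.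
move=> e1; rewrite integral_mkcond; apply: eq_integral => r _.
rewrite /pol !patchE; case: ifPn; rewrite mem_setE in_itv/=.
  by move=> r01; rewrite mem_set// (@ext_amap F e (u, r)).
by move=> r01; rewrite memNset//=; apply/negP.
Qed.

Let sector_pol e F : normc e = 1%R ->
  sector e F = \int[mu]_u \int[mu]_r pol e F (u, r).
Proof. by move=> e1; apply: eq_integral => u _; rewrite inner_pol. Qed.

Lemma measurable_sector e F : normc e = 1%R -> measurable_on_disc F ->
  (forall z, disc z -> 0 <= F z) ->
  measurable_fun setT (fun u : RT =>
    \int[mu]_(r in `]0%R, 1%R[) (F (arc r e u) * (r * csec u ^+ 2)%:E)).
Proof.
move=> e1 mF F0; under eq_fun do rewrite inner_pol//.
exact: (@measurable_fun_fubini_tonelli_F _ _ RT RT R mu (pol e F) (measurable_pol e mF)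
  (pol_ge0 e F0)).
Qed.

Lemma sector_swap e F : normc e = 1%R -> measurable_on_disc F ->
  (forall z, disc z -> 0 <= F z) ->
  sector e F = \int[mu]_(r in `]0%R, 1%R[)
    \int[mu]_u (F (arc r e u) * (r * csec u ^+ 2)%:E).
Proof.
move=> e1 mF F0; rewrite (sector_pol F e1).
have -> : \int[mu]_u \int[mu]_r pol e F (u, r) = \int[mu]_r \int[mu]_u pol e F (u, r).
  exact: (@fubini_tonelli _ _ RT RT R mu mu _ (measurable_pol e mF) (pol_ge0 e F0)).
rewrite [RHS]integral_mkcond; apply: eq_integral => r _; rewrite patchE.
case: ifPn; rewrite mem_setE in_itv/= => r01.
  apply: eq_integral => u _.
  by rewrite /pol !patchE mem_set// (@ext_amap F e (u, r)).
by rewrite integral0_eq// => u _; rewrite /pol patchE memNset//=; apply/negP.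
Qed.

Lemma measurable_sector_radius e F : normc e = 1%R -> measurable_on_disc F ->
  (forall z, disc z -> 0 <= F z) ->
  measurable_fun (`]0%R, 1%R[%classic : set RT) (fun r : RT =>
    \int[mu]_u (F (arc r e u) * (r * csec u ^+ 2)%:E)).
Proof.
move=> e1 mF F0.
apply: (@eq_measurable_fun _ _ _ _ _ (fun r : RT => \int[mu]_u pol e F (u, r))).
  move=> r; rewrite mem_setE in_itv/= => r01; apply: eq_integral => u _.
  by rewrite /pol !patchE mem_set// (@ext_amap F e (u, r)).
apply: measurable_funTS.
exact: (@measurable_fun_fubini_tonelli_G _ _ RT RT R mu (pol e F) (measurable_pol e mF)
  (pol_ge0 e F0)).
Qed.

Lemma measurable_on_disc_arc e F u : normc e = 1%R -> measurable_on_disc F ->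
  measurable_fun (`]0%R, 1%R[%classic : set RT) (fun r : RT => F (arc r e u)).
Proof.
move=> e1 mF.
apply: (@eq_measurable_fun _ _ _ _ _ (fun r : RT => ext F (amap e (u, r)))).
  by move=> r; rewrite mem_setE in_itv/= => r01; rewrite (@ext_amap F e (u, r)).
apply: measurable_funTS; apply: (measurableT_comp (measurable_ext mF)).
by apply: (measurableT_comp (measurable_amap e)).
Qed.

Lemma disc_polar F : measurable_on_disc F -> (forall z, disc z -> 0 <= F z) ->
  \int[@plane_leb R]_(x in @plane_disc R) F (cpt x) = sector 1%R F + sector (-1)%R F.
Proof.
move=> mF F0; rewrite integral_mkcond.
rewrite (plane_polar (measurable_ext mF) (ext_ge0 F0)).
have n1 : normc (1%R : R[i]) = 1%R by exact: normc1.
have nN1 : normc ((-1)%R : R[i]) = 1%R by rewrite (normcN 1%R).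
have pt u r : ((r * csec u)%R, (r * csec u * u)%R) = amap 1%R (u, r).
  by rewrite /amap /arc/=; congr pair; ring.
have ptN u r : amap 1%R (u, - r)%R = amap (-1)%R (u, r).
  by rewrite /amap /arc/=; congr pair; ring.
rewrite /sector -ge0_integralD//; last first.
- exact: measurable_sector.
- by move=> u _; rewrite inner_pol//; apply: integral_ge0 => r _; exact: pol_ge0.
- exact: measurable_sector.
- by move=> u _; rewrite inner_pol//; apply: integral_ge0 => r _; exact: pol_ge0.
apply: eq_integral => u _; rewrite ge0_integral_sym; last 3 first.
- apply: emeasurable_funM.
    under eq_fun do rewrite pt.
    apply: (measurableT_comp (measurable_ext mF)).
    by apply: (measurableT_comp (measurable_amap 1%R)); exact: pair1_measurable.
  by apply/measurable_EFinP; apply: measurable_funM => //; exact: measurableT_comp.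
- by move=> r; rewrite mule_ge0 ?ext_ge0// lee_fin mulr_ge0// sqr_ge0.
- move=> r r1; rewrite /ext patchE memNset ?mul0e//= /plane_disc/=.
  have -> : cpt ((r * csec u)%R, (r * csec u * u)%R) = arc r 1%R u.
    by rewrite pt; exact: cptK.
  by rewrite discE normc_arc// ltNge r1.
congr (_ + _); apply: eq_integral => r; rewrite mem_setE in_itv/= => r01.
  rewrite pt (@ext_amap F 1%R (u, r))//= ger0_norm//.
  by case/andP: r01 => /ltW.
rewrite pt ptN (@ext_amap F (-1)%R (u, r))//= normrN ger0_norm//.
by case/andP: r01 => /ltW.
Qed.

(** Multiplication by ['i] is (x, y) -> (-y, x): a reflection of one coordinate and an exchange of
    the two integrals. *)
Lemma disc_rot F : measurable_on_disc F -> (forall z, disc z -> 0 <= F z) ->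
  measurable_on_disc (fun z => F ('i * z)%R) /\
  \int[@plane_leb R]_(x in @plane_disc R) F ('i * cpt x)%R =
  \int[@plane_leb R]_(x in @plane_disc R) F (cpt x).
Proof.
move=> mF F0.
have mG := measurable_ext mF; have G0 := ext_ge0 F0.
pose rot (x : RT * RT) : RT * RT := ((- x.2)%R, x.1).
have mrot : measurable_fun setT rot.
  apply: measurable_fun_pair => //.
  by apply: (measurableT_comp (@oppr_measurable R setT)).
have cr x : ('i * cpt x)%R = cpt (rot x).
  by case: x => a b; rewrite /cpt /rot; apply/eqP; rewrite eq_complex/=; apply/andP; split; apply/eqP; ring.
have dr x : plane_disc (rot x) = plane_disc x.
  by rewrite plane_discE/= sqrrN addrC.
have mGr : measurable_fun setT (ext F \o rot) by exact: measurableT_comp.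
have extr : (fun x : RT * RT => F ('i * cpt x)%R) \_ (@plane_disc R) = ext F \o rot.
  apply/funext => x; rewrite /ext/= !patchE/= cr.
  rewrite (_ : (rot x \in @plane_disc R) = (x \in @plane_disc R))//.
  by apply/idP/idP; rewrite !inE dr.
split.
  apply/(measurable_restrictT _ _).2; first exact: measurable_plane_disc.
  by rewrite extr.
rewrite integral_mkcond [RHS]integral_mkcond.
transitivity (\int[@plane_leb R]_x (ext F \o rot) x).
  by rewrite -extr.
have -> : \int[@plane_leb R]_x (ext F \o rot) x = \int[mu]_x \int[mu]_y ext F ((- y)%R, x).
  exact: (@fubini_tonelli1 _ _ RT RT R mu mu (ext F \o rot) mGr (fun x => G0 (rot x))).
have -> : \int[mu]_x \int[mu]_y ext F ((- y)%R, x) = \int[mu]_x \int[mu]_y ext F (y, x).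
  apply: eq_integral => x _.
  rewrite (@ge0_integral_scale R (-1)%R (fun y => ext F (y, x))) ?oppr_eq0 ?oner_eq0//.
    by rewrite normrN normr1 mul1e; apply: eq_integral => y _; rewrite mulN1r.
  exact: measurable_fun_pair1.
have <- : \int[mu]_y \int[mu]_x ext F (y, x) = \int[mu]_x \int[mu]_y ext F (y, x).
  exact: (@fubini_tonelli _ _ RT RT R mu mu _ mG G0).
by rewrite -(@fubini_tonelli1 _ _ RT RT R mu mu _ mG G0).
Qed.

Lemma disc_polar_i F : measurable_on_disc F -> (forall z, disc z -> 0 <= F z) ->
  \int[@plane_leb R]_(x in @plane_disc R) F (cpt x) = sector 'i F + sector (- 'i)%R F.
Proof.
move=> mF F0; have [mFr <-] := disc_rot mF F0.
have H e : sector e (fun z => F ('i * z)%R) = sector ('i * e)%R F.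
  by apply: eq_integral => u _; apply: eq_integral => r _; rewrite arcM.
have i1 : normc ('i : R[i]) = 1%R by rewrite /= expr0n expr1n add0r sqrtr1.
have FrF z : disc z -> 0 <= F ('i * z)%R.
  by move=> zd; apply: F0; move: zd; rewrite !discE normcM i1 mul1r.
by rewrite (disc_polar mFr FrF) !H mulr1 mulrN1.
Qed.

(** Intended for [absT]: each measurable minorant satisfies the polar formula, and its sectors are
    below those of [F]. Only this inequality passes to the supremum. *)
Lemma disc_polar_le F : (forall z, disc z -> 0 <= F z) ->
  \int[@plane_leb R]_(x in @plane_disc R) F (cpt x) <= sector 1%R F + sector (-1)%R F.
Proof.
move=> F0; apply: lower_integral_leP; first exact: measurable_plane_disc.
  by move=> x; exact: F0.
move=> h mh h0 hF.
pose H (z : R[i]) := h (complex.Re z, complex.Im z).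
have Hc x : H (cpt x) = h x by rewrite /H /cpt/=; case: x.
have HF z : disc z -> H z <= F z.
  by move=> zd; have := hF (complex.Re z, complex.Im z); rewrite /plane_disc/= /cpt/=; case: (z) zd => a b zd; exact.
have mH : measurable_on_disc H.
  rewrite /measurable_on_disc (_ : H \o _ = h); last by apply/funext.
  exact: measurable_funTS.
have H0 z : disc z -> 0 <= H z by move=> _; exact: h0.
under eq_integral do rewrite -Hc.
rewrite (disc_polar mH H0); apply: leeD; apply: le_sector => //.
  exact: normc1.
by rewrite (normcN 1%R) normc1.
Qed.

(** The polar formula for the indicator of the exceptional null set gives zero, so almost every ray
    meets that set in a null set of radii; the Jacobian is positive for r > 0. *)
Lemma ae_ray (P : R[i] -> Prop) :
  {ae @plane_leb R, forall x, plane_disc x -> P (cpt x)} ->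
  {ae mu, forall u, {ae mu, forall r, (0 < r < 1)%R -> P (arc r 1%R u)}}.
Proof.
move=> [N [mN N0 subN]].
have n1 : normc (1%R : R[i]) = 1%R by exact: normc1.
pose F (z : R[i]) : \bar R := (\1_N (complex.Re z, complex.Im z))%:E.
have Fc x : F (cpt x) = (\1_N x)%:E by rewrite /F /cpt/=; case: x.
have mF : measurable_on_disc F.
  rewrite /measurable_on_disc (_ : F \o _ = EFin \o \1_N); last by apply/funext.
  by apply/measurable_EFinP; apply: measurable_funTS; exact: measurable_indic.
have F0 z : disc z -> 0 <= F z by move=> _; rewrite lee_fin.
have S0 : sector 1%R F = 0.
  have : sector 1%R F + sector (-1)%R F = 0.
    rewrite -disc_polar//.
    under eq_integral do rewrite Fc.
    rewrite integral_indic//; last exact: measurable_plane_disc.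
    apply: (subset_measure0 _ mN _ N0); last exact: subIsetl.
    by apply: measurableI => //; exact: measurable_plane_disc.
  move/eqP; rewrite padde_eq0.
  - by case/andP => /eqP.
  - by rewrite sector_pol//; do 2 (apply: integral_ge0 => ? _); exact: pol_ge0.
  - rewrite sector_pol; last by rewrite (normcN 1%R).
    by do 2 (apply: integral_ge0 => ? _); exact: pol_ge0.
have mpol := measurable_pol 1%R mF; have pol0 := pol_ge0 1%R F0.
pose I u := \int[mu]_r pol 1%R F (u, r).
have I0 u : 0 <= I u by exact: integral_ge0.
have mI : measurable_fun setT (I : RT -> \bar R).
  exact: (@measurable_fun_fubini_tonelli_F _ _ RT RT R mu (pol 1%R F) mpol pol0).
have H1 : {ae mu, forall u, I u = 0}.
  have : \int[mu]_u `|I u| = 0.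
    rewrite -[RHS]S0 sector_pol//; apply: eq_integral => u _.
    by rewrite gee0_abs.
  by move/(ae_eq_integral_abs mu measurableT mI); apply: ae_imp => u; exact.
apply: ae_imp H1 => u Iu0.
have : \int[mu]_r `|pol 1%R F (u, r)| = 0.
  by rewrite -[RHS]Iu0; apply: eq_integral => r _; rewrite gee0_abs.
move/(ae_eq_integral_abs mu measurableT (measurable_fun_pair2 u mpol)).
apply: ae_imp => r /(_ Logic.I) H r01; apply: contrapT => nP.
move: H; rewrite /pol patchE mem_set// (@ext_amap F 1%R (u, r))// /F/=.
have : N (complex.Re (arc r 1%R u), complex.Im (arc r 1%R u)).
  apply: subN => /= H; apply: nP; rewrite -(cptK (arc r 1%R u)); apply: H.
  change (disc (cpt (complex.Re (arc r 1%R u), complex.Im (arc r 1%R u)))).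
  by rewrite cptK; exact: disc_arc.
move=> Nr; rewrite indicE mem_set// mul1e => /eqP; rewrite eqe.
by case/andP: r01 => r0 _; rewrite mulf_eq0 expf_eq0/= !gt_eqF// csec_gt0.
Qed.

End DiscPolar.

(** * Measurability of the modulus of an analytic function *)

Section MeasurableAnalytic.
Variable R : realType.
Local Notation RT := (measurableTypeR R).

(** An open set of the plane is the countable union of the rational squares it contains, and squares
    are measurable for the product structure. *)
Lemma measurable_open_rect (U : set (RT * RT)) :
  (forall x, U x -> exists2 e, 0 < e &
    forall y, `|y.1 - x.1| < e -> `|y.2 - x.2| < e -> U y) ->
  measurable U.
Proof.
move=> oU.
pose rect (q : rat * rat * rat) : set (RT * RT) :=
  [set y | `|y.1 - ratr q.1.1| < ratr q.2 /\ `|y.2 - ratr q.1.2| < ratr q.2].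
have mrect q : measurable (rect q).
  have m1 : measurable_fun setT (fun y : RT * RT => `|y.1 - ratr q.1.1| : RT).
    by apply: measurableT_comp => //; apply: measurable_funB => //; exact: measurable_cst.
  have m2 : measurable_fun setT (fun y : RT * RT => `|y.2 - ratr q.1.2| : RT).
    by apply: measurableT_comp => //; apply: measurable_funB => //; exact: measurable_cst.
  have := m1 measurableT `]-oo, ratr q.2[%classic (measurable_itv _); rewrite setTI => h1.
  have := m2 measurableT `]-oo, ratr q.2[%classic (measurable_itv _); rewrite setTI => h2.
  apply: (eq_ind _ (fun A => measurable A) (measurableI _ _ h1 h2)).
  by apply/seteqP; split=> y; rewrite /rect/= !in_itv.
pose V q := if `[< rect q `<=` U >] then rect q else set0.
suff -> : U = \bigcup_q V q.
  apply: countable_bigcupT_measurable => [|q]; first exact: countableP.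
  by rewrite /V; case: ifP.
apply/seteqP; split=> x.
  move=> /oU[e e0 He].
  have [d] := rat_in_itvoo (divr_gt0 e0 (ltr0n R 2)); rewrite in_itv/= => /andP[d0 de].
  have [a] := @rat_in_itvoo R (x.1 - ratr d) (x.1 + ratr d) ltac:(lra).
  rewrite in_itv/= => /andP[a1 a2].
  have [b] := @rat_in_itvoo R (x.2 - ratr d) (x.2 + ratr d) ltac:(lra).
  rewrite in_itv/= => /andP[b1 b2].
  exists (a, b, d) => //; rewrite /V asboolT.
    by rewrite /rect/= !ltr_norml; split; apply/andP; split; lra.
  move=> y; rewrite /rect/= !ltr_norml => -[/andP[? ?] /andP[? ?]].
  by apply: He; rewrite ltr_norml; apply/andP; split; lra.
move=> [q _]; rewrite /V.
by case: asboolP => // qU; exact: qU.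
Qed.

Lemma analytic_lipschitz_at (f : R[i] -> R[i]) z : analytic_disc f -> disc z ->
  exists L d : R, [/\ 0 < L, 0 < d &
    forall w, normc (w - z) < d -> normc (f w - f z) <= L * normc (w - z)].
Proof.
move=> af zd; have [a /(_ 1 ltr01)[d d0 H]] := derivable_expansion (af _ zd).
exists (normc a + 1), d; split => //; first by rewrite ltr_wpDl ?normc_ge0.
move=> w wz; have -> : f w - f z = (f w - f z - a * (w - z)) + a * (w - z) by rewrite subrK.
apply: (le_trans (ler_normcD _ _)); rewrite normcM mulrDl addrC lerD2l.
exact: H.
Qed.

Lemma measurable_analytic (f : R[i] -> R[i]) : analytic_disc f ->
  measurable_on_disc (absf f).
Proof.
move=> af; apply/measurable_EFinP.
apply: (measurability _ (RGenOInfty.measurableE R)) => _ [_ [a ->] <-].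
apply: measurable_open_rect => x [xd /=]; rewrite in_itv/= andbT modcE => ax.
have [L [d [L0 d0 H]]] := analytic_lipschitz_at af xd.
move: xd; rewrite /plane_disc/= discE => xd.
(* The three bounds keep the square within the range of the Lipschitz estimate, inside the disc, and
   in the region where |f| > a. *)
pose e := Num.min (d / 2) (Num.min ((1 - normc (cpt x)) / 2)
  ((normc (f (cpt x)) - a) / (2 * L))).
have e0 : 0 < e.
  rewrite !lt_min !divr_gt0 ?subr_gt0 ?mulr_gt0//.
exists e => // y y1 y2.
have yx : normc (cpt y - cpt x) < 2 * e.
  apply: (le_lt_trans (normc_le_ReIm _)) => /=.
  by rewrite mulr2n mulrDl !mul1r ltrD.
have ed : e <= d / 2 by rewrite ge_min lexx.
have e1 : e <= (1 - normc (cpt x)) / 2 by rewrite !ge_min lexx orbT.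
have e2 : e <= (normc (f (cpt x)) - a) / (2 * L) by rewrite !ge_min lexx !orbT.
split.
  rewrite /plane_disc/= discE -(subrK (cpt x) (cpt y)).
  by apply: (le_lt_trans (ler_normcD _ _)); lra.
rewrite /= in_itv/= andbT modcE.
have {}H : normc (f (cpt y) - f (cpt x)) <= L * normc (cpt y - cpt x) by apply: H; lra.
have := ler_dist_normc (f (cpt y)) (f (cpt x)); rewrite ler_norml => /andP[+ _].
move: e2; rewrite ler_pdivlMr ?mulr_gt0// => e2.
have : L * normc (cpt y - cpt x) < L * (2 * e) by rewrite ltr_pM2l.
lra.
Qed.

End MeasurableAnalytic.

(** * From circles to an annulus *)

Section AnnulusBound.
Local Open Scope ereal_scope.
Variable R : realType.
Local Notation RT := (measurableTypeR R).
Local Notation mu := (@lebesgue_measure R).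

Lemma measurable_normc_cpt (D : set (RT * RT)) :
  measurable_fun D (fun x => normc (cpt x) : RT).
Proof.
apply: measurable_funTS.
have -> : (fun x : RT * RT => normc (cpt x)) =
    (fun x => Num.sqrt (x.1 ^+ 2 + x.2 ^+ 2)) by [].
apply: (measurableT_comp (f := @Num.sqrt R : RT -> RT)).
  by apply: continuous_measurable_fun; exact: sqrt_continuous.
by apply: measurable_funD; apply: measurable_funX.
Qed.

Lemma measurable_radial (g : R -> \bar R) : measurable_fun setT (g : RT -> \bar R) ->
  measurable_on_disc (fun z => g (normc z)).
Proof.
move=> mg; rewrite /measurable_on_disc.
by apply: (measurableT_comp mg); exact: measurable_normc_cpt.
Qed.

(** [circle_bound] is integrated over the radii b' < r < c: the factors are the distance r - |z|, at
    least b' - b, the Jacobian r, at least b', and the length c - b'. *)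
Lemma annulus_bound (f : R[i] -> R[i]) z (b b' c : R) : analytic_disc f ->
  (normc z <= b)%R -> (b < b')%R -> (b' < c)%R -> (c <= 1)%R ->
  (normc (f z) * ((b' - b) ^+ 2 * b' * (c - b')))%:E <=
  2%:E * \int[@plane_leb R]_(x in @plane_disc R)
    (absf f (cpt x) * (\1_(`]b', c[%classic : set R) (normc (cpt x)))%:E).
Proof.
move=> af zb bb' b'c c1.
have b'0 : (0 < b')%R by apply: (le_lt_trans (normc_ge0 z)); apply: (le_lt_trans zb).
pose F z : \bar R := absf f z * (\1_(`]b', c[%classic : set R) (normc z))%:E.
have mF : measurable_on_disc F.
  apply: emeasurable_funM; first exact: measurable_analytic.
  apply: (measurable_radial (g := fun r => (\1_(`]b', c[%classic : set R) r)%:E)).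
  by apply/measurable_EFinP; exact: measurable_indic.
have F0 z' : disc z' -> 0 <= F z'.
  by move=> _; rewrite mule_ge0 ?lee_fin// modcE normc_ge0.
have n1 : normc (1%R : R[i]) = 1%R by exact: normc1.
have ni : normc ('i : R[i]) = 1%R by rewrite /= expr0n expr1n add0r sqrtr1.
have nN1 : normc ((-1)%R : R[i]) = 1%R by rewrite (normcN 1%R).
have nNi : normc ((- 'i)%R : R[i]) = 1%R by rewrite (normcN 'i).
(* The half discs in the directions 1, i, -1, -i cover the disc twice, whence the factor 2. *)
have -> : 2%:E * \int[@plane_leb R]_(x in @plane_disc R) F (cpt x) =
    (sector 1%R F + sector 'i F) + (sector (-1)%R F + sector (- 'i)%R F).
  have e2 x : 2%:E * x = x + x :> \bar R by rewrite -mule2n -mule_natl.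
  rewrite e2 {1}(disc_polar mF F0) (disc_polar_i mF F0).
  exact: addeACA.
pose I e r := \int[mu]_u (F (arc r e u) * (r * csec u ^+ 2)%:E).
have I0 e r : (0 < r < 1)%R -> normc e = 1%R -> 0 <= I e r.
  move=> /[dup] r01 /andP[r0 _] e1; apply: integral_ge0 => u _.
  apply: mule_ge0; first exact/F0/disc_arc.
  by rewrite lee_fin mulr_ge0 ?sqr_ge0// ltW.
(* Only the slopes in [-1, 1] of each half circle are kept, which are the quarters of
   [circle_bound]. *)
have I_arc e r : (b' < r < c)%R -> normc e = 1%R -> (r * arc_mean f r e)%:E <= I e r.
  move=> /andP[b'r rc] e1.
  have r0 : (0 < r)%R by exact: lt_trans b'r.
  have r1 : (r < 1)%R by exact: lt_le_trans c1.
  have zr : (normc z < r)%R by apply: (le_lt_trans zb); exact: lt_trans b'r.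
  have ca := cont_on_arc af e1 zr r1 (a := -1) (b := 1).
  have ir := cont_on_integrable ca.
  rewrite /arc_mean /rint EFinM fineK; last exact: integrable_fin_num.
  rewrite -ge0_integralZl//; last 3 first.
  - exact: measurable_int ir.
  - by move=> u _; rewrite lee_fin mulr_ge0 ?normc_ge0 ?sqr_ge0.
  - by rewrite lee_fin ltW.
  rewrite integral_mkcond; apply: ge0_le_lower_integral => u _.
    apply: erestrict_ge0 => v _; rewrite mule_ge0 ?lee_fin ?(ltW r0)//.
    by rewrite mulr_ge0 ?normc_ge0 ?sqr_ge0.
  rewrite patchE; case: ifPn => _; last first.
    apply: mule_ge0; first by apply/F0/disc_arc => //; rewrite r0.
    by rewrite lee_fin mulr_ge0 ?sqr_ge0// ltW.
  rewrite /F normc_arc// gtr0_norm// indicE mem_set ?mule1; last first.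
    by rewrite /= in_itv/= b'r.
  by rewrite /absf modcE -!EFinM lee_fin mulrCA.
have mI e : normc e = 1%R -> measurable_fun (`]0%R, 1%R[%classic : set RT) (I e).
  by move=> e1; exact: measurable_sector_radius.
pose D : set RT := `]0%R, 1%R[%classic.
have mD : measurable D by exact: measurable_itv.
have i01 r : D r -> (0 < r < 1)%R by rewrite /D/= in_itv.
have sectorD (g h : RT -> \bar R) : (forall r, D r -> 0 <= g r) ->
    (forall r, D r -> 0 <= h r) -> measurable_fun D g -> measurable_fun D h ->
    \int[mu]_(r in D) g r + \int[mu]_(r in D) h r = \int[mu]_(r in D) (g r + h r).
  by move=> g0 h0 mg mh; apply/esym; exact: (ge0_integralD mu mD g0 mg h0 mh).
have I0D e : normc e = 1%R -> forall r, D r -> 0 <= I e r.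
  by move=> e1 r /i01 r01; exact: I0.
have sE e : normc e = 1%R -> sector e F = \int[mu]_(r in D) I e r.
  by move=> e1; exact: sector_swap.
have sum4 a1 a2 a3 a4 : normc a1 = 1%R -> normc a2 = 1%R -> normc a3 = 1%R ->
    normc a4 = 1%R -> (sector a1 F + sector a2 F) + (sector a3 F + sector a4 F) =
    \int[mu]_(r in D) ((I a1 r + I a2 r) + (I a3 r + I a4 r)).
  move=> h1 h2 h3 h4; rewrite !sE//.
  transitivity (\int[mu]_(r in D) (I a1 r + I a2 r) +
    \int[mu]_(r in D) (I a3 r + I a4 r)).
    congr (_ + _).
      exact: (sectorD _ _ (I0D _ h1) (I0D _ h2) (mI _ h1) (mI _ h2)).
    exact: (sectorD _ _ (I0D _ h3) (I0D _ h4) (mI _ h3) (mI _ h4)).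
  apply: sectorD.
  - by move=> r Dr; apply: adde_ge0; exact: I0D.
  - by move=> r Dr; apply: adde_ge0; exact: I0D.
  - by apply: emeasurable_funD; exact: mI.
  - by apply: emeasurable_funD; exact: mI.
rewrite (sum4 _ _ _ _ n1 ni nN1 nNi).
have -> : ((normc (f z) * ((b' - b) ^+ 2 * b' * (c - b')))%:E =
   \int[mu]_(r in `]b', c[) (normc (f z) * (b' - b) ^+ 2 * b')%:E).
  rewrite integral_cst//= lebesgue_measure_itv/= lte_fin b'c -EFinD -EFinM.
  by congr (_%:E); ring.
rewrite [leLHS]integral_mkcond [leRHS]integral_mkcond.
apply: ge0_le_lower_integral => r _.
  apply: erestrict_ge0 => ? _; rewrite lee_fin.
  apply: mulr_ge0; last exact: ltW.
  by apply: mulr_ge0; [exact: normc_ge0|exact: sqr_ge0].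
rewrite /D !patchE !mem_setE !in_itv/=; case: ifPn => [/andP[b'r rc]|_]; last first.
  case: ifPn => // r01.
  by apply: adde_ge0; apply: adde_ge0; exact: I0.
have r0 : (0 < r)%R by exact: lt_trans b'r.
have r1 : (r < 1)%R by exact: lt_le_trans c1.
have brc : (b' < r < c)%R by rewrite b'r.
rewrite r0 r1/=.
apply: (@le_trans _ _ ((r * arc_mean f r 1%R)%:E + (r * arc_mean f r 'i)%:E +
   ((r * arc_mean f r (-1)%R)%:E + (r * arc_mean f r (- 'i)%R)%:E))); last first.
  by apply: leeD; apply: leeD; exact: I_arc.
rewrite -!EFinD lee_fin.
have zr : (normc z < r)%R by apply: (le_lt_trans zb); exact: lt_trans b'r.
have := circle_bound af zr r1; rewrite /quad_sum => H.
have {}H : (r * (normc (f z) * (r - normc z) ^+ 2) <= r *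
  (arc_mean f r 1 + arc_mean f r 'i + arc_mean f r (-1) + arc_mean f r (- 'i)))%R.
  by rewrite ler_pM2l.
apply: (@le_trans _ _ (r * (normc (f z) * (r - normc z) ^+ 2)))%R; last first.
  by apply: (le_trans H); rewrite le_eqVlt; apply/orP; left; apply/eqP; ring.
rewrite [leRHS]mulrC; apply: ler_pM => //.
- by rewrite mulr_ge0 ?normc_ge0 ?sqr_ge0.
- exact: ltW.
- apply: ler_wpM2l; first exact: normc_ge0.
  have d0 : (0 <= b' - b)%R by rewrite subr_ge0 ltW.
  rewrite ler_sqr ?nnegrE//; first by lra.
  by lra.
exact: ltW.
Qed.

End AnnulusBound.

(** * One-dimensional estimates for the tail of a density *)

Section Tail.
Local Open Scope ereal_scope.
Variable R : realType.
Local Notation RT := (measurableTypeR R).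
Local Notation mu := (@lebesgue_measure R).
Implicit Types r s t : R.

Lemma ge0_integral_itv_split (g : R -> \bar R) r s t :
  measurable_fun setT (g : RT -> \bar R) -> (forall x, 0 <= g x) ->
  (r <= s)%R -> (s <= t)%R ->
  \int[mu]_(x in `[r, t[) g x = \int[mu]_(x in `[r, s[) g x + \int[mu]_(x in `[s, t[) g x.
Proof.
move=> mg g0 rs st; rewrite -ge0_integral_setU//=.
- by rewrite -itv_bndbnd_setU// bnd_simp.
- exact: measurable_funTS.
- apply/disj_setPS => x [] /=; rewrite !in_itv/= => /andP[_ xs] /andP[sx _].
  by move: xs; rewrite ltNge sx.
Qed.

Variable k : R -> R.

Definition tail r : R := fine (\int[mu]_(s in `[r, 1%R[) (k s)%:E).

Hypothesis mk : measurable_fun setT (k : RT -> RT).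
Hypothesis k_ge0 : forall x, (0 <= k x)%R.
Hypothesis k_fin : \int[mu]_x (k x)%:E < +oo.
Hypothesis tail_pos : forall r, (r < 1)%R -> 0 < \int[mu]_(s in `[r, 1%R[) (k s)%:E.

Let mkE : measurable_fun setT (EFin \o k : RT -> \bar R).
Proof. exact/measurable_EFinP. Qed.

Lemma integrable_density : mu.-integrable setT (EFin \o k).
Proof.
apply/integrableP; split => //.
by under eq_integral do rewrite /= ger0_norm//.
Qed.

Lemma tail_fin (D : set RT) : measurable D -> \int[mu]_(s in D) (k s)%:E < +oo.
Proof.
move=> mD; apply: le_lt_trans k_fin.
by apply: ge0_subset_integral => // x _; rewrite lee_fin.
Qed.

Lemma tailE r : \int[mu]_(s in `[r, 1%R[) (k s)%:E = (tail r)%:E.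
Proof.
rewrite fineK// ge0_fin_numE; last by apply: integral_ge0 => x _; rewrite lee_fin.
exact: tail_fin.
Qed.

Lemma tail_gt0 r : (r < 1)%R -> (0 < tail r)%R.
Proof. by move=> r1; rewrite -lte_fin -tailE; exact: tail_pos. Qed.

Lemma tail_ge0 r : (0 <= tail r)%R.
Proof. by rewrite -lee_fin -tailE; apply: integral_ge0 => x _; rewrite lee_fin. Qed.

Lemma integral_density r t : (r <= t)%R -> (t <= 1)%R ->
  \int[mu]_(s in `[r, t[) (k s)%:E = (tail r - tail t)%:E.
Proof.
move=> rt t1; have := tailE r.
rewrite (ge0_integral_itv_split mkE _ rt t1); last by move=> x; rewrite lee_fin.
rewrite tailE; have : \int[mu]_(s in `[r, t[) (k s)%:E < +oo by exact: tail_fin.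
have : 0 <= \int[mu]_(s in `[r, t[) (k s)%:E.
  by apply: integral_ge0 => x _; rewrite lee_fin.
case: (integral _ _ _) => // a _ _ []; rewrite /= => <-.
by congr (_%:E); rewrite addrK.
Qed.

Lemma tail_nonincreasing r t : (r <= t)%R -> (tail t <= tail r)%R.
Proof.
move=> rt; rewrite -lee_fin -!tailE; apply: ge0_subset_integral => //.
- exact: measurable_funTS.
- by move=> x _; rewrite lee_fin.
- by apply: subset_itvr; rewrite bnd_simp.
Qed.

Lemma measurable_tail : measurable_fun setT (tail : RT -> RT).
Proof.
apply: (measurability _ (RGenOInfty.measurableE R)) => _ [_ [a ->] <-].
rewrite setTI; apply: is_interval_measurable => x y /=; rewrite !in_itv/= !andbT.
move=> ax ay z /andP[xz zy]; rewrite in_itv/= andbT; apply: (lt_le_trans ay).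
exact: tail_nonincreasing.
Qed.

Lemma tail_IVT r t y : (r <= t)%R -> (t <= 1)%R -> (tail t <= y <= tail r)%R ->
  exists2 s, (r <= s <= t)%R & tail s = y.
Proof.
move=> rt t1 /andP[ty yr].
have ig : mu.-integrable `[r, t] (EFin \o k).
  by apply: integrableS integrable_density.
have tailB s : (r <= s)%R -> (s <= t)%R ->
    parameterized_integral mu r s k = (tail r - tail s)%R.
  move=> rs st; rewrite /parameterized_integral -Rintegral_itv_bndo_bndc.
    by rewrite /Rintegral integral_density// (le_trans st).
  by apply: integrableS integrable_density.
pose F x := parameterized_integral mu r x k.
have H : (Num.min (F r) (F t) <= tail r - y <= Num.max (F r) (F t))%R.
  have rr : (0 <= tail r - tail t)%R by rewrite subr_ge0 tail_nonincreasing.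
  by rewrite /F !tailB// subrr (min_l rr) (max_r rr) subr_ge0 yr lerB.
have [s] := IVT rt (parameterized_integral_continuous rt ig) H.
rewrite in_itv/= => /andP[rs st]; rewrite tailB// => /eqP.
rewrite (inj_eq (addrI _)) (inj_eq oppr_inj) => /eqP sy.
by exists s; rewrite ?rs.
Qed.

(* Enough to check [P] on intervals where the tail drops by a factor at most
   [4]: by continuity of the tail every interval is a finite union of those. *)
Lemma tail_chain (P : R -> R -> Prop) (a : R) :
  (forall r s t, (a <= r)%R -> (r <= s)%R -> (s <= t)%R -> (t < 1)%R ->
    P r s -> P s t -> P r t) ->
  (forall r t, (a <= r)%R -> (r <= t)%R -> (t < 1)%R -> (tail r <= 4 * tail t)%R -> P r t) ->
  forall r t, (a <= r)%R -> (r <= t)%R -> (t < 1)%R -> P r t.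
Proof.
move=> Ptrans Pbase r t ar rt t1.
have [n] : exists n, (tail r <= 4 ^+ n * tail t)%R.
  have tt := tail_gt0 t1.
  have H : (0 <= tail r / tail t)%R by rewrite divr_ge0 ?tail_ge0.
  exists (Num.bound (tail r / tail t)); rewrite -ler_pdivrMr//.
  apply: ltW; apply: (lt_le_trans (archi_boundP H)).
  by rewrite -natrX ler_nat ltnW// ltn_expl.
elim: n t rt t1 => [|n IH] t rt t1 Ht.
  apply: Pbase => //; apply: (le_trans Ht); rewrite expr0 ler_wpM2r ?tail_ge0//.
  by rewrite ler1n.
have [H|H] := leP (tail r) (4 * tail t)%R; first exact: Pbase.
(* The last piece [s, t] is cut where the tail is exactly 4 * tail t; the rest [r, s] needs one
   factor 4 less. *)
have [|s /andP[rs st] Es] := @tail_IVT r t (4 * tail t)%R rt (ltW t1).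
  by rewrite (ltW H) andbT ler_peMl ?tail_ge0 ?ler1n.
have s1 : (s < 1)%R by exact: le_lt_trans t1.
apply: (@Ptrans r s t) => //.
  by apply: IH => //; rewrite Es mulrA -exprSr.
by apply: Pbase; rewrite ?Es// (le_trans ar).
Qed.

Definition stail r : R := Num.sqrt (tail r).

Lemma stail_gt0 r : (r < 1)%R -> (0 < stail r)%R.
Proof. by move=> r1; rewrite sqrtr_gt0 tail_gt0. Qed.

Lemma stail_nonincreasing r t : (r <= t)%R -> (stail t <= stail r)%R.
Proof. by move=> rt; rewrite ler_sqrt ?tail_ge0 ?tail_nonincreasing. Qed.

Lemma sqr_stail r : (stail r ^+ 2 = tail r)%R.
Proof. by rewrite sqr_sqrtr ?tail_ge0. Qed.

(** The function is monotone on r < 1, but from 1 on the tail is 0 and its inverse is 0 by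
    convention; preimages of half-lines are therefore split at 1. *)
Lemma measurable_stailV : measurable_fun setT (fun r : RT => (stail r)^-1%R : RT).
Proof.
apply: (measurability _ (RGenOInfty.measurableE R)) => _ [_ [a ->] <-].
rewrite setTI (_ : _ @^-1` _ = [set r : RT | (a < (stail r)^-1)%R /\ (r < 1)%R] `|`
   (if (a < 0)%R then `[1%R, +oo[%classic else set0)).
  apply: measurableU; last by case: ifP.
  apply: is_interval_measurable => x y /= [ax x1] [ay y1] z /andP[xz zy].
  have z1 : (z < 1)%R by exact: le_lt_trans y1.
  split => //; apply: (lt_le_trans ax); rewrite lef_pV2 ?posrE ?stail_gt0//.
  exact: stail_nonincreasing.
have s0 r : (1 <= r)%R -> stail r = 0%R.
  by move=> r1; rewrite /stail /tail set_itv_ge ?bnd_simp ?ltNge ?r1// integral_set0 sqrtr0.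
apply/seteqP; split=> r /=; rewrite in_itv/= andbT.
  move=> ar; have [r1|r1] := ltP r 1%R; [by left|right].
  by move: ar; rewrite s0// invr0 => ->; rewrite /= in_itv/= r1.
case=> [[]//|]; case: ifPn => // a0; rewrite /= in_itv/= andbT => r1.
by rewrite s0// invr0.
Qed.

Let k_stailV_measurable n :
  measurable_fun setT (fun r : RT => (k r * (stail r)^-1 ^+ n)%:E).
Proof.
apply/measurable_EFinP; apply: measurable_funM => //; apply: measurable_funX.
exact: measurable_stailV.
Qed.

Let k_stailV_ge0 n r : 0 <= (k r * (stail r)^-1 ^+ n)%:E.
Proof. by rewrite lee_fin mulr_ge0// exprn_ge0// invr_ge0 sqrtr_ge0. Qed.

(** Freezes [stail] at its smallest value, at [t]. The loss is bounded once the tail drops by at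
    most a factor 4. *)
Let int_k_stailV_le n r t : (r <= t)%R -> (t < 1)%R ->
  \int[mu]_(s in `[r, t[) (k s * (stail s)^-1 ^+ n)%:E <=
  ((stail r ^+ 2 - stail t ^+ 2) * (stail t)^-1 ^+ n)%:E.
Proof.
move=> rt t1; have tp := stail_gt0 t1.
apply: (@le_trans _ _ (\int[mu]_(s in `[r, t[) ((stail t)^-1 ^+ n * k s)%:E)).
  apply: ge0_le_lower_integral => s; rewrite /= in_itv/= => /andP[rs st] //.
  rewrite lee_fin mulrC ler_wpM2r//; case: n => // n.
  rewrite ler_pXn2r ?nnegrE ?invr_ge0 ?sqrtr_ge0//.
  rewrite lef_pV2 ?posrE; first exact/stail_nonincreasing/ltW.
    by apply: stail_gt0; exact: lt_trans t1.
  exact: stail_gt0.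
under eq_integral do rewrite EFinM.
rewrite ge0_integralZl//; last 3 first.
- exact: measurable_funTS.
- by move=> x _; rewrite lee_fin.
- by rewrite lee_fin exprn_ge0// invr_ge0 sqrtr_ge0.
by rewrite integral_density ?(ltW t1)// -EFinM !sqr_stail mulrC.
Qed.

Lemma integral_density_stailV r t : (r <= t)%R -> (t < 1)%R ->
  \int[mu]_(s in `[r, t[) (k s * (stail s)^-1)%:E <= (3 * (stail r - stail t))%:E.
Proof.
move=> rt t1.
pose P r t := \int[mu]_(s in `[r, t[) (k s * (stail s)^-1 ^+ 1)%:E <= (3 * (stail r - stail t))%:E.
apply: (@tail_chain P r) => // [{rt t1} r' s t' _ rs st t1 P1 P2|{rt t1} r' t' _ rt t1 H].
  rewrite /P (ge0_integral_itv_split (k_stailV_measurable 1) (k_stailV_ge0 1) rs st).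
  by apply: (le_trans (leeD P1 P2)); rewrite -EFinD lee_fin; lra.
apply: (le_trans (int_k_stailV_le 1 rt t1)); rewrite lee_fin expr1.
have tp := stail_gt0 t1; have tr := stail_nonincreasing rt.
have H2 : (stail r' <= 2 * stail t')%R.
  rewrite -ler_sqr ?nnegrE ?sqrtr_ge0 ?mulr_ge0 ?ler0n ?sqrtr_ge0//.
  by rewrite exprMn !sqr_stail -natrX.
by rewrite ler_pdivrMr//; nra.
Qed.

Lemma integral_density_stailV3 r t : (r <= t)%R -> (t < 1)%R ->
  \int[mu]_(s in `[r, t[) (k s * (stail s)^-1 ^+ 3)%:E <=
  (6 * ((stail t)^-1 - (stail r)^-1))%:E.
Proof.
move=> rt t1.
pose P r t := \int[mu]_(s in `[r, t[) (k s * (stail s)^-1 ^+ 3)%:E <= (6 * ((stail t)^-1 - (stail r)^-1))%:E.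
apply: (@tail_chain P r) => // [{rt t1} r' s t' _ rs st t1 P1 P2|{rt t1} r' t' _ rt t1 H].
  rewrite /P (ge0_integral_itv_split (k_stailV_measurable 3) (k_stailV_ge0 3) rs st).
  by apply: (le_trans (leeD P1 P2)); rewrite -EFinD lee_fin; lra.
apply: (le_trans (int_k_stailV_le 3 rt t1)); rewrite lee_fin.
have tp := stail_gt0 t1; have tr := stail_nonincreasing rt.
have rp := stail_gt0 (le_lt_trans rt t1).
have H2 : (stail r' <= 2 * stail t')%R.
  rewrite -ler_sqr ?nnegrE ?sqrtr_ge0 ?mulr_ge0 ?ler0n ?sqrtr_ge0//.
  by rewrite exprMn !sqr_stail -natrX.
set x := stail r' in tr rp H2 *; set y := stail t' in tp tr H2 *.
have -> : (6 * (y^-1 - x^-1) = (x - y) * (6 * y ^+ 2) / (x * y ^+ 3))%R.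
  by field; rewrite !gt_eqF.
have -> : ((x ^+ 2 - y ^+ 2) * y^-1 ^+ 3 = (x - y) * ((x + y) * x) / (x * y ^+ 3))%R.
  by field; rewrite !gt_eqF.
have D0 : (0 <= (x * y ^+ 3)^-1)%R.
  by rewrite invr_ge0; apply: mulr_ge0; [exact: ltW|apply/exprn_ge0/ltW].
by apply: ler_wpM2r => //; apply: ler_wpM2l; [rewrite subr_ge0|nra].
Qed.

(** The chain argument stops short of 1, where the tail vanishes; monotone convergence along the
    radii [u n] reaches it. This makes [nu] integrable. *)
Lemma integral_density_stailV_le1 r : (r < 1)%R ->
  \int[mu]_(s in `[r, 1%R[) (k s * (stail s)^-1)%:E <= (3 * stail r)%:E.
Proof.
move=> r1; pose u n := (1 - (1 - r) / n.+1%:R)%R.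
have d0 : (0 < 1 - r)%R by rewrite subr_gt0.
have u1 n : (u n < 1)%R by rewrite ltrBlDr ltrDl divr_gt0.
have ru n : (r <= u n)%R.
  have H : ((1 - r) / n.+1%:R <= 1 - r)%R.
    by rewrite ler_pdivrMr ?ltr0n// ler_peMr ?ler1n//; exact: ltW.
  by rewrite /u lerBrDr -lerBrDl.
have uE : `[r, 1%R[%classic = \bigcup_n `[r, u n[%classic.
  apply/seteqP; split=> x /=; last first.
    by move=> [n _] /=; rewrite !in_itv/= => /andP[-> /lt_trans]; apply.
  rewrite in_itv/= => /andP[rx x1].
  have H : (0 <= (1 - r) / (1 - x))%R by rewrite divr_ge0 ?subr_ge0 ?ltW.
  exists (Num.bound ((1 - r) / (1 - x))) => //=; rewrite in_itv/= rx/= /u.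
  rewrite ltrBrDr -ltrBrDl ltr_pdivrMr// mulrC -ltr_pdivrMr ?subr_gt0//.
  by apply: (lt_trans (archi_boundP H)); rewrite ltr_nat.
have mg := k_stailV_measurable 1; have g0 := k_stailV_ge0 1.
have := @ge0_nondecreasing_set_cvg_integral _ RT R (fun n => `[r, u n[%classic)
  (fun s => (k s * (stail s)^-1 ^+ 1)%:E) mu.
rewrite -uE => H.
have cv : \int[mu]_(x in `[r, u n[) (k x * (stail x)^-1 ^+ 1)%:E @[n --> \oo] -->
    \int[mu]_(x in `[r, 1%R[) (k x * (stail x)^-1 ^+ 1)%:E.
  apply: H => //.
  - move=> m n mn; apply/subsetPset => x /=; rewrite !in_itv/= => /andP[-> /=].
    move/lt_le_trans; apply; rewrite lerD2l lerN2 ler_pM2l// lef_pV2 ?posrE ?ltr0n//.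
    by rewrite ler_nat.
  - by move=> i; exact: measurable_funTS.
rewrite -(cvg_lim _ cv)//; apply: lime_le; first by apply/cvg_ex; eexists; exact: cv.
apply: nearW => n; apply: (le_trans (integral_density_stailV (ru n) (u1 n))).
by rewrite lee_fin; have := sqrtr_ge0 (tail (u n)); rewrite -/(stail _); lra.
Qed.

End Tail.

(** * A Jensen inequality with constant *)

Section JensenPower.
Local Open Scope ereal_scope.
Context d (T : measurableType d) (R : realType).
Variable mu : {measure set T -> \bar R}.
Implicit Types (D : set T) (phi w : T -> R).

(** If x > y, then x = x^p * x^(1-p) <= x^p * y^(1-p) since the exponent 1 - p is negative. *)
Lemma le_weighted_power (p x y : R) : (1 < p)%R -> (0 <= x)%R -> (0 < y)%R ->
  (x <= y + x `^ p * y `^ (1 - p))%R.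
Proof.
move=> p1 x0 y0; have [xy|yx] := leP x y.
  by apply: (le_trans xy); rewrite lerDl mulr_ge0 ?powR_ge0.
have xp : (0 < x)%R by exact: lt_trans yx.
apply: (@le_trans _ _ (x `^ p * y `^ (1 - p)))%R; last by rewrite lerDr ltW.
have {1}-> : (x = x `^ p * x `^ (1 - p))%R.
  rewrite -powRD; last by rewrite (gt_eqF xp) implybT.
  by rewrite addrC subrK powRr1.
rewrite ler_wpM2l ?powR_ge0//.
have e : (1 - p = - (p - 1))%R by rewrite opprB.
rewrite e !powRN lef_pV2 ?posrE ?powR_gt0//.
by rewrite ge0_ler_powR ?nnegrE ?(ltW y0) ?(ltW xp) ?(ltW yx)// subr_ge0 ltW.
Qed.

Lemma lee_poweR (p : R) (x y : \bar R) : (0 <= p)%R -> 0 <= x -> x <= y ->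
  x `^ p <= y `^ p.
Proof.
move=> p0 x0 xy; apply: gt0_ler_poweR => //; rewrite in_itv/= leey andbT//.
exact: le_trans xy.
Qed.

(* Up to the constant [2 `^ p] this is Jensen's inequality; it only needs
   [x <= y + x^p y^(1-p)] at [y = (\int phi^p w / M)^(1/p)]. *)
Lemma jensen_power D phi w (M p : R) : (1 < p)%R -> (0 < M)%R -> measurable D ->
  measurable_fun D phi -> measurable_fun D w ->
  (forall x, D x -> 0 <= phi x)%R -> (forall x, D x -> 0 <= w x)%R ->
  \int[mu]_(x in D) (w x)%:E <= M%:E ->
  (\int[mu]_(x in D) (phi x * w x)%:E) `^ p <=
  (2 `^ p * M `^ (p - 1))%:E * \int[mu]_(x in D) (phi x `^ p * w x)%:E.
Proof.
move=> p1 M0 mD mphi mw phi0 w0 wM.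
have p0 : (0 < p)%R by exact: lt_trans p1.
have pn0 : p != 0%R by rewrite gt_eqF.
have mpw : measurable_fun D (fun x => phi x `^ p * w x)%R.
  by apply: measurable_funM => //; apply: (measurableT_comp (measurable_powR _)).
have pw0 x : D x -> (0 <= phi x `^ p * w x)%R.
  by move=> Dx; rewrite mulr_ge0 ?powR_ge0 ?w0.
set A := \int[mu]_(x in D) _; set B := \int[mu]_(x in D) _.
have A0 : 0 <= A by apply: integral_ge0 => x Dx; rewrite lee_fin mulr_ge0 ?phi0 ?w0.
have B0 : 0 <= B by apply: integral_ge0 => x Dx; rewrite lee_fin pw0.
have C0 : (0 < 2 `^ p * M `^ (p - 1))%R by rewrite mulr_gt0 ?powR_gt0.
have AB y : (0 < y)%R -> A <= (y * M)%:E + (y `^ (1 - p))%:E * B.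
  move=> y0.
  apply: (@le_trans _ _ (\int[mu]_(x in D) (y%:E * (w x)%:E + (y `^ (1 - p))%:E * (phi x `^ p * w x)%:E))).
    apply: ge0_le_lower_integral => x Dx; first by rewrite lee_fin mulr_ge0 ?phi0 ?w0.
    rewrite -!EFinM -EFinD lee_fin mulrA -mulrDl ler_wpM2r ?w0//.
    by rewrite [X in (_ + X)%R]mulrC; apply: le_weighted_power => //; exact: phi0.
  rewrite ge0_integralD//; last 4 first.
  - by move=> x Dx; rewrite mule_ge0 ?lee_fin ?w0// ltW.
  - by apply/measurable_EFinP; apply: measurable_funM.
  - by move=> x Dx; rewrite mule_ge0 ?lee_fin ?pw0// powR_ge0.
  - by apply/measurable_EFinP; apply: measurable_funM.
  rewrite !ge0_integralZl ?lee_fin ?powR_ge0 ?(ltW y0)//;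
    try exact/measurable_EFinP; try (by move=> x Dx; rewrite lee_fin ?w0 ?pw0).
  by rewrite leeD2r// EFinM lee_pmul2l.
case: B B0 AB => [b b0 AB|_ _|//]; last by rewrite gt0_muley ?leey ?lte_fin.
rewrite lee_fin in b0.
(* For b = 0 the good value of [y] would be 0, so [y] tends to 0 instead, through e / M. *)
have [b00|bn0] := eqVneq b 0%R.
  suff -> : A = 0 by rewrite poweR0r// b00 mule0.
  apply/eqP; rewrite eq_le A0 andbT; apply/lee_addgt0Pr => e e0; rewrite add0e.
  have := AB (e / M)%R (divr_gt0 e0 M0).
  by rewrite b00 mule0 adde0 divfK// gt_eqF.
have bp : (0 < b)%R by rewrite lt_neqAle eq_sym bn0.
pose y := ((b / M) `^ p^-1)%R.
have y0 : (0 < y)%R by apply/powR_gt0/divr_gt0.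
have yp : (y `^ p = b / M)%R.
  by rewrite -powRrM mulVf// powRr1//; apply/ltW/divr_gt0.
have AY : A <= (2 * (y * M))%:E.
  apply: (le_trans (AB _ y0)); rewrite -EFinM -EFinD lee_fin.
  have -> : (y `^ (1 - p) * b = y * M)%R.
    rewrite powRB; last by rewrite (gt_eqF y0) implybT.
    rewrite powRr1 ?(ltW y0)//.
    by rewrite yp; field; rewrite bn0 (gt_eqF M0).
  by rewrite mulr_natl mulr2n.
apply: (@le_trans _ _ ((2 * (y * M))%:E `^ p)).
  exact: (lee_poweR (ltW p0) A0 AY).
rewrite poweR_EFin -EFinM lee_fin !powRM ?mulr_ge0 ?ler0n ?(ltW y0) ?(ltW M0)// yp.
rewrite -!mulrA ler_wpM2l ?powR_ge0//.
have -> : (M `^ p = M `^ (p - 1) * M)%R.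
  rewrite -[X in (_ * X)%R]powRr1 ?(ltW M0)// -powRD ?subrK//.
  by rewrite (gt_eqF M0) implybT.
rewrite le_eqVlt; apply/orP; left; apply/eqP; field; rewrite (gt_eqF M0)//.
Qed.

End JensenPower.

Section TriangleSwap.
Local Open Scope ereal_scope.
Variable R : realType.
Local Notation RT := (measurableTypeR R).
Local Notation mu := (@lebesgue_measure R).

Lemma triangle_swap (g h : R -> R) : measurable_fun setT (g : RT -> RT) ->
  measurable_fun setT (h : RT -> RT) -> (forall x, 0 <= g x)%R ->
  (forall x, 0 <= h x)%R ->
  \int[mu]_r ((g r)%:E * \int[mu]_(s in `[r, +oo[) (h s)%:E) =
  \int[mu]_s ((h s)%:E * \int[mu]_(r in `]-oo, s]) (g r)%:E).
Proof.
move=> mg mh g0 h0.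
pose T : set (RT * RT) := [set z | (z.1 <= z.2)%R].
have mT : measurable T.
  have ms : measurable_fun setT (fun z : RT * RT => (z.2 - z.1)%R : RT).
    exact: measurable_funB.
  have := ms measurableT `[0%R, +oo[%classic (measurable_itv _); rewrite setTI.
  by congr measurable; apply/seteqP; split=> z; rewrite /T/= in_itv/= andbT subr_ge0.
pose G (z : RT * RT) : \bar R := (g z.1 * h z.2 * \1_T z)%:E.
have mG : measurable_fun setT G.
  apply/measurable_EFinP; apply: measurable_funM; last exact: measurable_indic.
  by apply: measurable_funM; [exact: (measurableT_comp mg)|exact: (measurableT_comp mh)].
have G0 z : 0 <= G z by rewrite lee_fin mulr_ge0// mulr_ge0.
transitivity (\int[mu]_r \int[mu]_s G (r, s)).
  apply: eq_integral => r _; rewrite [X in _ * X]integral_mkcond -ge0_integralZl//; last 3 first.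
  - apply/(measurable_restrictT _ _).1 => //.
    by apply: measurable_funTS; exact/measurable_EFinP.
  - by move=> s _; apply: erestrict_ge0 => x _; rewrite lee_fin.
  - by rewrite lee_fin.
  apply: eq_integral => s _; rewrite patchE mem_setE in_itv/= andbT /G indicE.
  have -> : ((r, s) \in T) = (r <= s)%R by apply/idP/idP; rewrite inE.
  by case: ifPn => _; rewrite ?mulr1 ?mulr0 ?mule0// EFinM.
have -> : \int[mu]_r \int[mu]_s G (r, s) = \int[mu]_s \int[mu]_r G (r, s).
  exact: (@fubini_tonelli _ _ RT RT R mu mu G mG G0).
apply: eq_integral => s _; rewrite [X in _ * X]integral_mkcond -ge0_integralZl//; last 3 first.
- apply/(measurable_restrictT _ _).1 => //.
  by apply: measurable_funTS; exact/measurable_EFinP.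
- by move=> r _; apply: erestrict_ge0 => x _; rewrite lee_fin.
- by rewrite lee_fin.
apply: eq_integral => r _; rewrite patchE mem_setE in_itv/= /G indicE.
have -> : ((r, s) \in T) = (r <= s)%R by apply/idP/idP; rewrite inE.
by case: ifPn => _; rewrite ?mulr1 ?mulr0 ?mule0// mulrC EFinM.
Qed.

Lemma poweRD_le (p : R) (x y : \bar R) : (0 <= p)%R -> 0 <= x -> 0 <= y ->
  (x + y) `^ p <= (2 `^ p)%:E * (x `^ p + y `^ p).
Proof.
move=> p0 x0 y0.
have two : 0 <= 2%:E :> \bar R by rewrite lee_fin.
wlog yx : x y x0 y0 / y <= x.
  move=> H; have [|/ltW] := leP y x; first exact: H.
  by rewrite addeC [X in _ * X]addeC; exact: H.
apply: (@le_trans _ _ ((2%:E * x) `^ p)).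
  apply: lee_poweR => //; first exact: adde_ge0.
  by rewrite mule_natl mule2n leeD2l.
rewrite poweRM// poweR_EFin lee_wpmul2l ?lee_fin ?powR_ge0//.
by rewrite leeDl// poweR_ge0.
Qed.

End TriangleSwap.

(** * Hardy's inequality on one ray *)

Section RayBound.
Local Open Scope ereal_scope.
Variable R : realType.
Local Notation RT := (measurableTypeR R).
Local Notation mu := (@lebesgue_measure R).
Variables (k : R -> R) (b c p : R).

(* The profile of the weight: it vanishes on [1/2 <= r < b], which kills the
   weak-type bound, and [k / sqrt K] is the part that carries Hardy's
   inequality; [K] is the tail of [k]. *)
Definition profile (r : R) : R :=
  if (r < 2^-1)%R then 1%R else if (r < b)%R then 0%R
  else ((r < c)%R%:R + k r * (stail k r)^-1)%R.

Hypothesis mk : measurable_fun setT (k : RT -> RT).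
Hypothesis k_ge0 : forall x, (0 <= k x)%R.
Hypothesis k_out : forall x, ~~ (0 < x < 1)%R -> k x = 0%R.
Hypothesis k_fin : \int[mu]_x (k x)%:E < +oo.
Hypothesis tail_pos : forall r, (r < 1)%R -> 0 < \int[mu]_(s in `[r, 1%R[) (k s)%:E.
Hypotheses (b_ge : (2^-1 < b)%R) (bc : (b < c)%R) (c_lt1 : (c < 1)%R).
Hypothesis p_gt1 : (1 < p)%R.

Local Notation K := (tail k).
Local Notation sK := (stail k).

Lemma profile_ge0 r : (0 <= profile r)%R.
Proof.
rewrite /profile; case: ifP => _ //; case: ifP => _ //.
by rewrite addr_ge0 ?ler0n// mulr_ge0// invr_ge0 sqrtr_ge0.
Qed.

Let measurable_lt (a : R) : measurable_fun setT (fun r : RT => (r < a)%R).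
Proof. exact: measurable_fun_ltr. Qed.

Let measurable_kV n : measurable_fun setT (fun r : RT => (k r * (sK r)^-1 ^+ n)%R : RT).
Proof.
apply: measurable_funM => //; apply: measurable_funX; exact: measurable_stailV.
Qed.

Lemma measurable_profile : measurable_fun setT (profile : RT -> RT).
Proof.
apply: (measurable_fun_ifT (measurable_lt (2^-1)%R)) => //.
apply: (measurable_fun_ifT (measurable_lt b)) => //.
apply: measurable_funD; last exact: (measurable_kV 1).
have -> : (fun r : RT => (r < c)%R%:R : RT) = \1_(`]-oo, c[%classic : set RT).
  apply/funext => r; rewrite indicE; congr (nat_of_bool _)%:R.
  by apply/idP/idP; rewrite inE/= in_itv.
exact: measurable_indic.
Qed.

(** The first two summands are the constants of [near_part], for the [S] term and for the [B b]
    term; the third is that of [far_part] on [b, c), where 1 / K r <= 1 / K c. *)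
Let D : R := ((2 / K b) `^ p * (2 `^ p * K 0 `^ p) +
  (2 / K b) `^ p * (2 `^ p * (2 `^ p * K b `^ (p - 1))) + 2 `^ p * 2 `^ p / K c)%R.

(** The factor 1 + 2 * sK b comes from [B_b_le], the constant 12 from [hardy_part]. *)
Definition ray_const : R := (D * (1 + 2 * sK b) + 12 * (2 `^ p * 2 `^ p))%R.

Let D1_ge0 : (0 <= (2 / K b) `^ p * (2 `^ p * K 0 `^ p))%R.
Proof. by rewrite mulr_ge0 ?mulr_ge0 ?powR_ge0. Qed.

Let D2_ge0 : (0 <= (2 / K b) `^ p * (2 `^ p * (2 `^ p * K b `^ (p - 1))))%R.
Proof. by rewrite mulr_ge0 ?mulr_ge0 ?mulr_ge0 ?powR_ge0. Qed.

Let D3_ge0 : (0 <= 2 `^ p * 2 `^ p / K c)%R.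
Proof. by rewrite mulr_ge0 ?mulr_ge0 ?powR_ge0// invr_ge0 tail_ge0. Qed.

Let D_ge0 : (0 <= D)%R.
Proof. by rewrite /D !addr_ge0. Qed.

Lemma ray_const_ge0 : (0 <= ray_const)%R.
Proof.
by rewrite addr_ge0// ?mulr_ge0 ?powR_ge0// addr_ge0// mulr_ge0// sqrtr_ge0.
Qed.

Section Ray.
(** To be read with [phi] the modulus of an analytic function along a ray. Since the profile has a
    gap below [b], the integral [Z] alone cannot control [phi] there, and the bound [S] takes
    over. *)
Variables (phi : R -> R) (S : R).
Hypothesis mphi : measurable_fun setT (phi : RT -> RT).
Hypothesis phi_ge0 : forall x, (0 <= phi x)%R.
Hypothesis S_ge0 : (0 <= S)%R.
Hypothesis phi_le : forall s, (0 < s <= b)%R -> (phi s <= S)%R.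

Let A r := \int[mu]_(s in `[r, 1%R[) (phi s * k s)%:E.
Let B r := \int[mu]_(s in `[r, 1%R[) (phi s `^ p * k s)%:E.
Let Z := \int[mu]_(r in `]0%R, 1%R[) (phi r `^ p * (profile r * r))%:E.

Let p_ge0 : (0 <= p)%R. Proof. exact: ltW (lt_trans ltr01 p_gt1). Qed.

Let b1 : (b < 1)%R. Proof. exact: lt_trans bc c_lt1. Qed.

Let b0 : (0 < b)%R. Proof. by apply: (@lt_trans _ _ (2^-1)%R) => //; rewrite invr_gt0. Qed.

Let mphik : measurable_fun setT (fun s : RT => (phi s * k s)%R : RT).
Proof. exact: measurable_funM. Qed.

Let mphip : measurable_fun setT (fun s : RT => (phi s `^ p)%R : RT).
Proof. exact: (measurableT_comp (measurable_powR _)). Qed.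

Let mpsi : measurable_fun setT (fun s : RT => (phi s `^ p * k s)%R : RT).
Proof. exact: measurable_funM. Qed.

Let psi_ge0 s : (0 <= phi s `^ p * k s)%R.
Proof. by rewrite mulr_ge0// powR_ge0. Qed.

Let A_ge0 r : 0 <= A r.
Proof. by apply: integral_ge0 => s _; rewrite lee_fin mulr_ge0. Qed.

Let B_ge0 r : 0 <= B r.
Proof. by apply: integral_ge0 => s _; rewrite lee_fin. Qed.

Let Z_ge0 : 0 <= Z.
Proof.
apply: integral_ge0 => s; rewrite /= in_itv/= => /andP[s0 _].
by rewrite lee_fin mulr_ge0 ?powR_ge0// mulr_ge0 ?profile_ge0// ltW.
Qed.

Let jensen_tail r : (r < 1)%R -> (A r) `^ p <= (2 `^ p * K r `^ (p - 1))%:E * B r.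
Proof.
move=> r1; apply: jensen_power => //; try exact: measurable_funTS.
- exact: tail_gt0.
- by rewrite tailE.
Qed.

(** The factor 2 absorbs the Jacobian, as 2 * s >= 1 beyond 1/2. *)
Let profile_ge s : (b <= s)%R -> (k s * (sK s)^-1 <= 2 * (profile s * s))%R.
Proof.
move=> bs; rewrite /profile !ifF; last 2 first.
- by apply/negbTE; rewrite -leNgt.
- by apply/negbTE; rewrite -leNgt (le_trans (ltW b_ge)).
have ks : (0 <= k s * (sK s)^-1)%R by rewrite mulr_ge0// invr_ge0 sqrtr_ge0.
have : (0 <= (s < c)%R%:R :> R)%R by exact: ler0n.
have s2 : (2^-1 <= s)%R by rewrite (le_trans (ltW b_ge)).
set x := (_%:R)%R; set y := (k s * _)%R in ks *; nra.
Qed.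

Let int_phi_stail_le : \int[mu]_(s in `[b, 1%R[) (phi s `^ p * (k s * (sK s)^-1))%:E <= 2%:E * Z.
Proof.
rewrite /Z -ge0_integralZl//; last 2 first.
- apply/measurable_EFinP; apply: measurable_funTS; apply: measurable_funM => //.
  by apply: measurable_funM => //; exact: measurable_profile.
- move=> s; rewrite /= in_itv/= => /andP[s0 _].
  by rewrite lee_fin mulr_ge0 ?powR_ge0// mulr_ge0 ?profile_ge0// ltW.
rewrite [leLHS]integral_mkcond [leRHS]integral_mkcond.
have nn s : (0 <= phi s `^ p * (k s * (sK s)^-1))%R.
  by rewrite mulr_ge0 ?powR_ge0// mulr_ge0// invr_ge0 sqrtr_ge0.
apply: ge0_le_lower_integral => s _.
  by apply: erestrict_ge0 => x _; rewrite lee_fin.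
rewrite !patchE !mem_setE !in_itv/=; case: ifPn => [/andP[bs s1]|_].
  rewrite (lt_le_trans b0 bs) s1/= -EFinM lee_fin [leRHS]mulrCA ler_wpM2l ?powR_ge0//.
  exact: profile_ge.
case: ifPn => // /andP[s0 _].
by rewrite lee_fin mulr_ge0// mulr_ge0 ?powR_ge0// mulr_ge0 ?profile_ge0// ltW.
Qed.

(** On [b, 1) the density [k] is at most sK b times k / sK, which [Z] controls. *)
Let B_b_le : B b <= (2 * sK b)%:E * Z.
Proof.
apply: (@le_trans _ _ ((sK b)%:E * (2%:E * Z))); last by rewrite muleA -EFinM mulrC.
apply: le_trans (lee_wpmul2l _ int_phi_stail_le); last by rewrite lee_fin sqrtr_ge0.
rewrite -ge0_integralZl//; last 3 first.
- apply/measurable_EFinP; apply: measurable_funTS; apply: measurable_funM => //.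
  exact: (measurable_kV 1).
- move=> s _; rewrite lee_fin mulr_ge0 ?powR_ge0// mulr_ge0// invr_ge0 sqrtr_ge0//.
- by rewrite lee_fin sqrtr_ge0.
apply: ge0_le_lower_integral => s; rewrite /= in_itv/= => /andP[bs s1].
  by rewrite lee_fin.
rewrite -EFinM lee_fin [leRHS]mulrCA ler_wpM2l ?powR_ge0//.
have sp : (0 < sK s)%R by exact: stail_gt0.
rewrite [leRHS]mulrCA ler_peMr// ler_pdivlMr// mul1r.
exact: stail_nonincreasing.
Qed.

(** The product of the factor 1 / K left by [far_part] with the density k / sqrt K of the
    profile. *)
Let kappa r : R := if (r < b)%R then 0%R else (k r * (sK r)^-1 ^+ 3)%R.

Let kappa_ge0 r : (0 <= kappa r)%R.
Proof.
rewrite /kappa; case: ifP => // _.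
by rewrite mulr_ge0// exprn_ge0// invr_ge0 sqrtr_ge0.
Qed.

Let measurable_kappa : measurable_fun setT (kappa : RT -> RT).
Proof. by apply: (measurable_fun_ifT (measurable_lt b)). Qed.

Let B_itv r : \int[mu]_(s in `[r, +oo[) (phi s `^ p * k s)%:E = B r.
Proof.
rewrite /B [LHS]integral_mkcond [RHS]integral_mkcond; apply: eq_integral => s _.
rewrite !patchE !mem_setE !in_itv/= andbT.
have [rs|//] := boolP (r <= s)%R; rewrite /=.
by case: ifPn => // s1; rewrite k_out ?mulr0// (negbTE s1) andbF.
Qed.

(** After exchanging the integrals, the inner one is at most 6 / sK s, which restores the density k
    / sK; the constant is 6 times the 2 of [int_phi_stail_le]. *)
Let hardy_part : \int[mu]_r ((kappa r)%:E * B r) <= 12%:E * Z.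
Proof.
under eq_integral do rewrite -B_itv.
rewrite triangle_swap//.
apply: (@le_trans _ _ (6%:E * (2%:E * Z))); last by rewrite muleA -EFinM -natrM.
apply: le_trans (lee_wpmul2l _ int_phi_stail_le); last by rewrite lee_fin.
rewrite -ge0_integralZl//; last 2 first.
- apply/measurable_EFinP; apply: measurable_funTS; apply: measurable_funM => //.
  exact: (measurable_kV 1).
- move=> s _; rewrite lee_fin mulr_ge0 ?powR_ge0// mulr_ge0// invr_ge0 sqrtr_ge0//.
rewrite [leRHS]integral_mkcond; apply: ge0_le_lower_integral => s _.
  by rewrite mule_ge0 ?lee_fin//; apply: integral_ge0 => r _; rewrite lee_fin.
have nn t : (0 <= phi t `^ p * (k t * (sK t)^-1))%R.
  by rewrite mulr_ge0 ?powR_ge0// mulr_ge0// invr_ge0 sqrtr_ge0.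
rewrite patchE mem_setE in_itv/=; case: ifPn => [/andP[bs s1]|]; last first.
  rewrite negb_and -leNgt -ltNge => /orP[sb|s1].
    rewrite integral0_eq ?mule0// => r; rewrite /= in_itv/= => rs.
    by rewrite /kappa (le_lt_trans rs sb).
  by rewrite k_out ?mulr0 ?mul0e// negb_and -!leNgt s1 orbT.
have sp : (0 < sK s)%R by exact: stail_gt0.
have inner : \int[mu]_(r in `]-oo, s]) (kappa r)%:E <= (6 * (sK s)^-1)%:E.
  apply: (@le_trans _ _ (\int[mu]_(r in `[b, s]) (k r * (sK r)^-1 ^+ 3)%:E)).
    rewrite [leLHS]integral_mkcond [leRHS]integral_mkcond.
    apply: ge0_le_lower_integral => r _.
      by apply: erestrict_ge0 => x _; rewrite lee_fin.
    rewrite !patchE !mem_setE !in_itv/= /kappa.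
    by have [rb|br] := ltP r b; rewrite /= ?if_same.
  rewrite -integral_itv_bndo_bndc; last first.
    by apply: measurable_funTS; apply/measurable_EFinP; exact: measurable_kV.
  apply: (le_trans (integral_density_stailV3 mk k_ge0 k_fin tail_pos bs s1)).
  rewrite lee_fin ler_wpM2l// lerBlDr lerDl invr_ge0 sqrtr_ge0//.
apply: (le_trans (lee_wpmul2l _ inner)); first by rewrite lee_fin.
rewrite -!EFinM lee_fin le_eqVlt; apply/orP; left; apply/eqP; ring.
Qed.

Let far_part r : (r < 1)%R ->
  ((2 / K r)%:E * A r) `^ p <= (2 `^ p * 2 `^ p / K r)%:E * B r.
Proof.
move=> r1; have Kr : (0 < K r)%R by exact: tail_gt0.
have q0 : (0 <= 2 / K r)%R by rewrite divr_ge0// ltW.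
rewrite poweRM ?lee_fin// poweR_EFin.
apply: (le_trans (lee_wpmul2l _ (jensen_tail r1))); first by rewrite lee_fin powR_ge0.
rewrite muleA -EFinM lee_wpmul2r// lee_fin le_eqVlt; apply/orP; left; apply/eqP.
have -> : (K r `^ (p - 1) = K r `^ p / K r)%R.
  by rewrite powRB ?powRr1 ?(ltW Kr)// (gt_eqF Kr) implybT.
have E : ((2 / K r) `^ p * K r `^ p = 2 `^ p)%R.
  by rewrite -powRM ?(ltW Kr)// divfK// gt_eqF.
by rewrite -E; ring.
Qed.

(** The average is split at [b]: below [b] use [phi] <= [S] and total mass at most K 0, above [b]
    use Jensen. The normalisation 1 / K r is at most 1 / K b. *)
Let near_part r : (0 < r)%R -> (r < b)%R ->
  ((2 / K r)%:E * A r) `^ p <=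
  ((2 / K b) `^ p * (2 `^ p * K 0 `^ p) * S `^ p)%:E +
  ((2 / K b) `^ p * (2 `^ p * (2 `^ p * K b `^ (p - 1))))%:E * B b.
Proof.
move=> r0 rb; have Kr : (0 < K r)%R by apply: tail_gt0 => //; exact: lt_trans b1.
have Kb : (0 < K b)%R by exact: tail_gt0.
have AS : A r <= (S * K 0)%:E + A b.
  rewrite /A (@ge0_integral_itv_split R (fun s => (phi s * k s)%:E) r b 1)//.
  - rewrite leeD2r//; apply: (@le_trans _ _ (\int[mu]_(s in `[r, b[) (S%:E * (k s)%:E))).
      apply: ge0_le_lower_integral => s; rewrite /= in_itv/= => /andP[rs sb].
        by rewrite lee_fin mulr_ge0.
      by rewrite -EFinM lee_fin ler_wpM2r// phi_le// (lt_le_trans r0 rs) ltW.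
    rewrite ge0_integralZl//; last 2 first.
    + by apply: measurable_funTS; exact/measurable_EFinP.
    + by move=> s _; rewrite lee_fin.
    rewrite integral_density ?(ltW rb) ?(ltW b1)// -EFinM lee_fin ler_wpM2l//.
    rewrite lerBlDr (le_trans (tail_nonincreasing mk k_ge0 k_fin (ltW r0)))//.
    by rewrite lerDl tail_ge0.
  - exact/measurable_EFinP.
  - by move=> s; rewrite lee_fin mulr_ge0.
  - exact: ltW.
  - exact: ltW.
have q0 : (0 <= 2 / K b)%R by rewrite divr_ge0// ltW.
have SK0 : (0 <= S * K 0)%R by rewrite mulr_ge0// tail_ge0.
apply: (@le_trans _ _ (((2 / K b)%:E * ((S * K 0)%:E + A b)) `^ p)).
  apply: lee_poweR => //; first by rewrite mule_ge0// lee_fin divr_ge0// ltW.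
  apply: lee_pmul => //; first by rewrite lee_fin divr_ge0// ltW.
  rewrite lee_fin ler_wpM2l// lef_pV2 ?posrE//.
  by apply: tail_nonincreasing => //; exact: ltW.
have SA0 : 0 <= (S * K 0)%:E + A b by apply: adde_ge0.
rewrite poweRM ?lee_fin// poweR_EFin.
apply: (@le_trans _ _ (((2 / K b) `^ p)%:E *
  ((2 `^ p)%:E * (((S * K 0) `^ p)%:E + (2 `^ p * K b `^ (p - 1))%:E * B b)))).
  rewrite lee_wpmul2l ?lee_fin ?powR_ge0//.
  apply: (le_trans (poweRD_le _ _ _)) => //.
  rewrite lee_wpmul2l ?lee_fin ?powR_ge0// poweR_EFin leeD2l//.
  exact: jensen_tail.
have w0 : 0 <= (2 `^ p * K b `^ (p - 1))%:E * B b.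
  by rewrite mule_ge0// lee_fin mulr_ge0 ?powR_ge0.
have mulE (x y z : R) (q : \bar R) :
    (x * (y * z))%:E * q = x%:E * (y%:E * (z%:E * q)).
  by rewrite !EFinM -!muleA.
have Sp0 : 0 <= ((S * K 0) `^ p)%:E by rewrite lee_fin powR_ge0.
have e0 : 0 <= (2 `^ p)%:E :> \bar R by rewrite lee_fin powR_ge0.
rewrite (ge0_muleDr _ Sp0 w0) ge0_muleDr; [|exact: mule_ge0|exact: mule_ge0].
rewrite mulE leeD2r// -!EFinM lee_fin powRM ?tail_ge0//.
by rewrite le_eqVlt; apply/orP; left; apply/eqP; ring.
Qed.

Variable Y : R -> \bar R.
Hypothesis Y_ge0 : forall r, (0 < r < 1)%R -> 0 <= Y r.
Hypothesis Y_le : forall r, (0 < r < 1)%R -> Y r <= ((2 / K r)%:E * A r) `^ p.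

Let pointwise r : (0 < r < 1)%R -> Y r * (profile r * r)%:E <=
  D%:E * ((S `^ p)%:E + B b) + (2 `^ p * 2 `^ p)%:E * ((kappa r)%:E * B r).
Proof.
move=> /[dup] r01 /andP[r0 r1].
have c40 : (0 <= 2 `^ p * 2 `^ p :> R)%R by rewrite mulr_ge0 ?powR_ge0.
have t1 : 0 <= D%:E * ((S `^ p)%:E + B b).
  by rewrite mule_ge0 ?lee_fin// adde_ge0// lee_fin powR_ge0.
have t2 : 0 <= (2 `^ p * 2 `^ p)%:E * ((kappa r)%:E * B r).
  by rewrite mule_ge0 ?lee_fin// mule_ge0// lee_fin.
have Y1 (n : R) : (0 <= n)%R -> Y r * (n * r)%:E <= Y r * n%:E.
  move=> n0; apply: lee_wpmul2l; first exact: Y_ge0.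
  by rewrite lee_fin ler_piMr// ltW.
apply: (le_trans (Y1 _ (profile_ge0 r))).
have [rb|br] := ltP r b.
  apply: (@le_trans _ _ (D%:E * ((S `^ p)%:E + B b))); last by rewrite leeDl.
  have YD : Y r <= D%:E * ((S `^ p)%:E + B b).
    apply: (le_trans (Y_le r01)); apply: (le_trans (near_part r0 rb)).
    have Sp0 : 0 <= (S `^ p)%:E by rewrite lee_fin powR_ge0.
    rewrite (ge0_muleDr _ Sp0 (B_ge0 b)) -EFinM.
    apply: leeD.
      by rewrite lee_fin ler_wpM2r ?powR_ge0// /D -addrA lerDl addr_ge0.
    by rewrite lee_wpmul2r// lee_fin /D addrAC lerDr addr_ge0.
  rewrite /profile rb; case: ifP => _; first by rewrite mule1.
  by rewrite mule0.
have sp : (0 < sK r)%R by exact: stail_gt0.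
have Kr : (0 < K r)%R by exact: tail_gt0.
rewrite /profile !ifF; last 2 first.
- by apply/negbTE; rewrite -leNgt.
- by apply/negbTE; rewrite -leNgt (le_trans (ltW b_ge)).
have ks : (0 <= k r * (sK r)^-1)%R by rewrite mulr_ge0// invr_ge0 sqrtr_ge0.
rewrite EFinD ge0_muleDr ?lee_fin ?ler0n//.
have YB : Y r <= (2 `^ p * 2 `^ p / K r)%:E * B r by exact: le_trans (Y_le r01) (far_part r1).
apply: leeD.
  have [rc|_] := ltP r c; last by rewrite mule0.
  rewrite mule1; apply: (le_trans YB).
  apply: (@le_trans _ _ (D%:E * B b)); last first.
    by rewrite lee_wpmul2l ?lee_fin// leeDr// lee_fin powR_ge0.
  apply: lee_pmul => //; first by rewrite lee_fin divr_ge0// ltW.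
    rewrite lee_fin; apply: (@le_trans _ _ (2 `^ p * 2 `^ p / K c)%R).
      rewrite ler_wpM2l// lef_pV2 ?posrE ?tail_gt0//.
      by apply: tail_nonincreasing => //; exact: ltW.
    by rewrite /D lerDr addr_ge0.
  rewrite /B [leRHS](@ge0_integral_itv_split R (fun s => (phi s `^ p * k s)%:E) b r 1)//.
  - by rewrite leeDr//; apply: integral_ge0 => s _; rewrite lee_fin.
  - exact/measurable_EFinP.
  - exact: (ltW r1).
apply: (le_trans (lee_wpmul2r _ YB)); first by rewrite lee_fin.
(* Here the identity is (1 / K) * (k / sqrt K) = k * (sqrt K)^(-3), with K = sK^2. *)
rewrite /kappa ifF; last by apply/negbTE; rewrite -leNgt.
rewrite -muleA [B r * _]muleC !muleA -!EFinM lee_wpmul2r// lee_fin.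
rewrite le_eqVlt; apply/orP; left; apply/eqP.
by rewrite -(sqr_stail mk k_ge0 k_fin r); field; rewrite gt_eqF.
Qed.

Lemma ray_bound :
  \int[mu]_(r in `]0%R, 1%R[) (Y r * (profile r * r)%:E) <=
  ray_const%:E * ((S `^ p)%:E + Z).
Proof.
have c40 : (0 <= 2 `^ p * 2 `^ p :> R)%R by rewrite mulr_ge0 ?powR_ge0.
set U := D%:E * ((S `^ p)%:E + B b).
have SB0 : 0 <= (S `^ p)%:E + B b by rewrite adde_ge0// lee_fin powR_ge0.
have U0 : 0 <= U by rewrite mule_ge0 ?lee_fin.
have mB : measurable_fun setT (B : RT -> \bar R).
  have -> : (B : RT -> \bar R) = fun r => \int[mu]_s
      (phi s `^ p * k s * \1_[set z : RT * RT | (z.1 <= z.2)%R] (r, s))%:E.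
    apply/funext => r; rewrite -B_itv [LHS]integral_mkcond.
    apply: eq_integral => s _; rewrite patchE mem_setE in_itv/= andbT indicE.
    have -> : ((r, s) \in [set z : RT * RT | (z.1 <= z.2)%R]) = (r <= s)%R.
      by apply/idP/idP; rewrite inE.
    by case: ifPn => _; rewrite ?mulr1 ?mulr0.
  have mT : measurable [set z : RT * RT | (z.1 <= z.2)%R].
    have ms : measurable_fun setT (fun z : RT * RT => (z.2 - z.1)%R : RT).
      exact: measurable_funB.
    have := ms measurableT `[0%R, +oo[%classic (measurable_itv _); rewrite setTI.
    by congr measurable; apply/seteqP; split=> z; rewrite /= in_itv/= andbT subr_ge0.
  apply: (@measurable_fun_fubini_tonelli_F _ _ RT RT R mu (fun z : RT * RT =>
    (phi z.2 `^ p * k z.2 * \1_[set z : RT * RT | (z.1 <= z.2)%R] z)%:E)).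
    apply/measurable_EFinP; apply: measurable_funM; last exact: measurable_indic.
    exact: (measurableT_comp mpsi).
  by move=> z; rewrite lee_fin mulr_ge0.
apply: (@le_trans _ _ (\int[mu]_(r in `]0%R, 1%R[)
    (U + (2 `^ p * 2 `^ p)%:E * ((kappa r)%:E * B r)))).
  apply: ge0_le_lower_integral => r; rewrite /= in_itv/= => /[dup] r01 /andP[r0 _].
    by rewrite mule_ge0 ?Y_ge0// lee_fin mulr_ge0 ?profile_ge0// ltW.
  exact: pointwise.
have mkB : measurable_fun setT (fun r : RT => (kappa r)%:E * B r).
  by apply: emeasurable_funM => //; exact/measurable_EFinP.
have kB0 r : 0 <= (kappa r)%:E * B r by rewrite mule_ge0 ?lee_fin.
rewrite ge0_integralD//; last 2 first.
- by move=> r _; rewrite mule_ge0 ?lee_fin.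
- by apply: measurable_funTS; apply: measurable_funeM.
rewrite integral_cst//= lebesgue_measure_itv/= lte01 oppr0 adde0 mule1.
rewrite ge0_integralZl//; last exact: measurable_funTS.
have H : \int[mu]_(r in `]0%R, 1%R[) ((kappa r)%:E * B r) <= 12%:E * Z.
  by apply: le_trans hardy_part; apply: ge0_subset_integral.
apply: (@le_trans _ _ (D%:E * ((S `^ p)%:E + (2 * sK b)%:E * Z) +
    (2 `^ p * 2 `^ p)%:E * (12%:E * Z))).
  apply: leeD; first by rewrite lee_wpmul2l ?lee_fin// leeD2l.
  by rewrite lee_wpmul2l ?lee_fin.
have Sp0 : 0 <= (S `^ p)%:E by rewrite lee_fin powR_ge0.
have s0 : (0 <= 2 * sK b)%R by rewrite mulr_ge0// sqrtr_ge0.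
have sZ0 : 0 <= (2 * sK b)%:E * Z by apply: mule_ge0.
rewrite (ge0_muleDr _ Sp0 sZ0) (ge0_muleDr _ Sp0 Z_ge0) -addeA.
have Ds0 : (0 <= D * (2 * sK b))%R by apply: mulr_ge0.
have c120 : (0 <= 12 * (2 `^ p * 2 `^ p) :> R)%R by apply: mulr_ge0.
have rcE : ray_const = (D + D * (2 * sK b) + 12 * (2 `^ p * 2 `^ p))%R.
  by rewrite /ray_const mulrDr mulr1.
apply: leeD.
  by rewrite lee_wpmul2r// lee_fin rcE -addrA lerDl addr_ge0.
have Ds0E : 0 <= (D * (2 * sK b))%:E by rewrite lee_fin.
have c120E : 0 <= (2 `^ p * 2 `^ p * 12)%:E :> \bar R by rewrite lee_fin mulrC.
rewrite !muleA -!EFinM -(ge0_muleDl _ Ds0E c120E) -EFinD.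
by rewrite lee_wpmul2r// lee_fin rcE [leLHS]addrC [leRHS]addrC mulrC lerD2l lerDr.
Qed.

End Ray.

End RayBound.

(** * The weight *)

Section RadialDensity.
Local Open Scope ereal_scope.
Variable R : realType.
Local Notation RT := (measurableTypeR R).
Local Notation mu := (@lebesgue_measure R).

Lemma ae_exists (P : R -> Prop) : {ae mu, forall u, P u} -> exists u, P u.
Proof.
move=> [N [mN N0 subN]]; apply: contrapT => nP.
have : mu `[0%R, 1%R]%classic <= mu N.
  apply: le_measure; rewrite ?inE//= => x _; apply: subN => /= Px; apply: nP.
  by exists x.
by rewrite N0 lebesgue_measure_itv/= lte01 oppr0 adde0 leNgt lte01.
Qed.

Lemma normC_normc (z : R[i]) : `|z|%R = (normc z)%:C.
Proof. by rewrite normc_def; case: z. Qed.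

Lemma dA_int_lty (F : R[i] -> \bar R) : (forall z, disc z -> 0 <= F z) ->
  dA_int F < +oo -> \int[@plane_leb R]_(x in @plane_disc R) F (cpt x) < +oo.
Proof.
move=> F0; rewrite /dA_int.
have : 0 <= \int[@plane_leb R]_(x in @plane_disc R) F (cpt x).
  by apply: integral_ge0 => x; exact: F0.
case: (integral _ _ _) => [r _ _|_|//]; first by rewrite ltry.
by rewrite gt0_muley ?lte_fin ?invr_gt0 ?pi_gt0.
Qed.

Definition radial_data (w : R[i] -> R) (k : R -> R) : Prop :=
  [/\ measurable_fun setT (k : RT -> RT), forall x, (0 <= k x)%R,
      forall x, ~~ (0 < x < 1)%R -> k x = 0%R, \int[mu]_x (k x)%:E < +oo &
      {ae mu, forall r, (0 < r < 1)%R -> w r%:C = k r}].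

Lemma hat_density (w : R[i] -> R) (k : R -> R) (r : R) :
  (forall z, disc z -> 0 <= w z)%R -> (forall x, 0 <= k x)%R -> (0 <= r)%R ->
  {ae mu, forall r, (0 < r < 1)%R -> w r%:C = k r} ->
  \int[mu]_(s in `[r, 1%R[) (w s%:C)%:E = \int[mu]_(s in `[r, 1%R[) (k s)%:E.
Proof.
move=> w0 k0 r0 wk; apply: ge0_ae_eq_lower_integral => //.
- move=> s; rewrite /= in_itv/= => /andP[rs s1]; rewrite lee_fin w0// discE normcR.
  by rewrite ger0_norm// (le_trans r0 rs).
- by move=> s _; rewrite lee_fin.
apply: (ae_imp2 _ wk (ae_neq 0%R)) => s ws s0; rewrite /= in_itv/= => /andP[rs s1].
by rewrite ws// s1 andbT lt_neqAle eq_sym s0 (le_trans r0 rs).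
Qed.

(** Agreement of [w] with a Borel function almost everywhere in the plane says nothing about the
    real segment itself. Almost every ray is good by [ae_ray], and [w] takes the same values on it
    by radiality. *)
Lemma radial_density (w : R[i] -> R) : Dhat w -> exists k, radial_data w k.
Proof.
move=> [[[w0 [h mh wh] wfin] wrad wpos] [C C1 dbl]].
pose hh := h \_ (@plane_disc R).
have mhh : measurable_fun setT (hh : RT * RT -> RT).
  by apply/(measurable_restrictT _ _).1 => //; exact: measurable_plane_disc.
pose H (z : R[i]) : R := Num.max 0%R (hh (complex.Re z, complex.Im z)).
have H0 z : (0 <= H z)%R by rewrite le_max lexx.
have mH : measurable_fun setT (fun x : RT * RT => H (cpt x) : RT).
  have -> : (fun x : RT * RT => H (cpt x)) = (fun x => Num.max 0%R (hh x)).
    by apply/funext => -[x y].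
  exact: measurable_maxr.
have mHE : measurable_on_disc (fun z => (H z)%:E).
  by apply/measurable_EFinP; exact: measurable_funTS.
have H0E z : disc z -> 0 <= (H z)%:E by rewrite lee_fin.
have n1 : normc (1%R : R[i]) = 1%R by exact: normc1.
have wH : {ae @plane_leb R, forall x, plane_disc x -> w (cpt x) = H (cpt x)}.
  apply: ae_imp wh => x wx xd; rewrite /H /hh patchE.
  have -> : (complex.Re (cpt x), complex.Im (cpt x)) = x by case: x {wx xd}.
  by rewrite mem_set// -wx// max_r// w0.
have Hfin : sector 1%R (fun z => (H z)%:E) < +oo.
  have : \int[@plane_leb R]_(x in @plane_disc R) (H (cpt x))%:E < +oo.
    have <- : \int[@plane_leb R]_(x in @plane_disc R) (w (cpt x))%:E =
        \int[@plane_leb R]_(x in @plane_disc R) (H (cpt x))%:E.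
      apply: ge0_ae_eq_lower_integral.
      - exact: measurable_plane_disc.
      - by move=> x xd; rewrite lee_fin w0.
      - by move=> x xd; rewrite lee_fin.
      - by apply: ae_imp wH => x wx xd; rewrite wx.
    by apply: (dA_int_lty (F := fun z => (w z)%:E)) => // z zd; rewrite lee_fin w0.
  rewrite (disc_polar mHE H0E); apply: le_lt_trans.
  rewrite leeDl//; apply: integral_ge0 => u _; apply: integral_ge0 => r.
  by rewrite /= in_itv/= => /andP[r0 _]; rewrite mule_ge0 ?lee_fin// mulr_ge0 ?sqr_ge0// ltW.
pose I u := \int[mu]_(r in `]0%R, 1%R[) ((H (arc r 1%R u))%:E * (r * csec u ^+ 2)%:E).
have I0 u : 0 <= I u.
  apply: integral_ge0 => r.
  by rewrite /= in_itv/= => /andP[r0 _]; rewrite mule_ge0 ?lee_fin// mulr_ge0 ?sqr_ge0// ltW.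
have intI : mu.-integrable setT I.
  apply/integrableP; split; first exact: (measurable_sector n1 mHE H0E).
  by under eq_integral do rewrite gee0_abs//.
(* One slope is chosen that is good for the agreement and has a finite ray integral. *)
have [u0 [wk Iu0]] : exists u, {ae mu, forall r, (0 < r < 1)%R ->
    w (arc r 1%R u) = H (arc r 1%R u)} /\ I u \is a fin_num.
  apply: ae_exists; apply: ae_imp2 (ae_ray (P := fun z => w z = H z) wH) (integrable_ae measurableT intI).
  by move=> u hu hI; split => //; exact: hI.
pose k r := if (0 < r < 1)%R then H (arc r 1%R u0) else 0%R.
have k0 r : (0 <= k r)%R by rewrite /k; case: ifP.
have kE r : (0 < r < 1)%R -> k r = H (arc r 1%R u0) by rewrite /k => ->.
have mk : measurable_fun setT (k : RT -> RT).
  have -> : (k : RT -> RT) = (fun r => H (arc r 1%R u0)) \_ `]0%R, 1%R[.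
    by apply/funext => r; rewrite patchE mem_setE in_itv.
  apply/(measurable_restrictT _ _).1 => //; apply/measurable_EFinP.
  exact: (measurable_on_disc_arc u0 n1 mHE).
have wr : {ae mu, forall r, (0 < r < 1)%R -> w r%:C = k r}.
  apply: ae_imp wk => r wr r01; rewrite kE// -wr// [RHS]wrad; last exact: disc_arc.
  by rewrite normC_normc normc_arc// gtr0_norm//; case/andP: r01.
exists k; split => //; first by rewrite /k => x /negbTE ->.
have mkE : measurable_fun setT (fun x : RT => (k x)%:E) by exact/measurable_EFinP.
have half : \int[mu]_(s in `[2^-1%R, 1%R[) (k s)%:E < +oo.
  have c0 : (0 < csec u0 ^+ 2)%R by rewrite exprn_gt0// csec_gt0.
  apply: (@le_lt_trans _ _ ((2 / csec u0 ^+ 2)%:E * I u0)); last first.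
    by rewrite -(fineK Iu0) -EFinM ltry.
  rewrite /I -ge0_integralZl//; last 3 first.
  - apply: emeasurable_funM; first exact: (measurable_on_disc_arc u0 n1 mHE).
    by apply/measurable_EFinP; apply: measurable_funM => //; exact: measurable_cst.
  - move=> r; rewrite /= in_itv/= => /andP[r0 _].
    by rewrite mule_ge0 ?lee_fin// mulr_ge0 ?sqr_ge0// ltW.
  - by rewrite lee_fin divr_ge0// sqr_ge0.
  rewrite [leLHS]integral_mkcond [leRHS]integral_mkcond.
  apply: ge0_le_lower_integral => r _.
    by apply: erestrict_ge0 => ? _; rewrite lee_fin.
  rewrite !patchE !mem_setE !in_itv/=; case: ifPn => [/andP[r2 r1]|_].
    have r0 : (0 < r)%R by apply: lt_le_trans r2; rewrite invr_gt0.
    rewrite r0 r1/= kE ?r0// -!EFinM lee_fin.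
    have -> : (2 / csec u0 ^+ 2 * (H (arc r 1 u0) * (r * csec u0 ^+ 2)) =
      H (arc r 1 u0) * (2 * r))%R by field; rewrite gt_eqF// csec_gt0.
    by rewrite ler_peMr//; move: r2; lra.
  case: ifPn => // /andP[r0 r1].
  apply: mule_ge0; first by rewrite lee_fin; apply: divr_ge0 => //; exact: sqr_ge0.
  by apply: mule_ge0; rewrite lee_fin//; apply: mulr_ge0; [exact: ltW|exact: sqr_ge0].
(* Area integrability controls only r * k(r), hence the mass beyond 1/2; doubling at r = 0 bounds
   the whole mass by the mass beyond 1/2. *)
have : \int[mu]_(s in `[0%R, 1%R[) (k s)%:E < +oo.
  have := dbl 0%R; rewrite lexx ltr01 => /(_ erefl).
  rewrite /hat !modcE !normcR addr0 normr0 ger0_norm ?divr_ge0//.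
  rewrite !(hat_density w0 k0)// ?divr_ge0// div1r => /le_lt_trans; apply.
  rewrite -[X in _ * X]fineK; first by rewrite -EFinM ltry.
  by rewrite ge0_fin_numE//; apply: integral_ge0 => s _; rewrite lee_fin.
rewrite integral_mkcond; congr (_ < _); apply: eq_integral => r _.
rewrite patchE mem_setE in_itv/=; case: ifPn => // r01; rewrite /k ifF//.
by apply/negbTE; apply: contra r01 => /andP[/ltW -> ->].
Qed.

End RadialDensity.

(** * The constructed weight is integrable and doubling *)

Section RadialWeight.
Local Open Scope ereal_scope.
Variable R : realType.
Local Notation RT := (measurableTypeR R).
Local Notation mu := (@lebesgue_measure R).

(** The integrand is the derivative of the arctangent: this is the angle of a half circle. *)
Lemma integral_sqr_csec_lty : \int[mu]_u (csec u ^+ 2 : R)%:E < +oo.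
Proof.
have mc : measurable_fun setT (fun u : RT => (csec u ^+ 2)%:E : \bar R).
  by apply/measurable_EFinP; apply: measurable_funX; exact: measurable_csec.
have cE (u : R) : (csec u ^+ 2)%:E = (oneDsqr u)^-1%:E by rewrite sqr_csec.
have half : \int[mu]_(u in `[0%R, +oo[) (csec u ^+ 2 : R)%:E = (pi / 2)%:E.
  by rewrite -integral0y_oneDsqr; apply: eq_integral => u _; rewrite cE.
have -> : [set: R] = `[0%R, +oo[ `|` `]-oo, 0%R[.
  by apply/seteqP; split=> // x _ /=; rewrite !in_itv/= andbT; case: leP; [left|right].
rewrite ge0_integral_setU//=; last 3 first.
- exact: measurable_funTS.
- by move=> u _; rewrite lee_fin sqr_ge0.
- by apply/disj_setPS => x [] /=; rewrite !in_itv/= andbT leNgt => /negP.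
rewrite half lte_add_pinfty ?ltry//.
apply: (@le_lt_trans _ _ (\int[mu]_(u in `]-oo, 0%R]) (csec (- u) ^+ 2 : R)%:E)).
  apply: (@le_trans _ _ (\int[mu]_(u in `]-oo, 0%R]) (csec u ^+ 2 : R)%:E)).
    apply: ge0_subset_integral => //.
    - exact: measurable_funTS.
    - by move=> u _; rewrite lee_fin sqr_ge0.
    - by apply: subset_itvl; rewrite bnd_simp.
  rewrite le_eqVlt; apply/orP; left; apply/eqP; apply: eq_integral => u _.
  by rewrite !cE /oneDsqr sqrrN.
rewrite -(@ge0_integration_by_substitution0 R (fun u => (csec u ^+ 2)%:E))//.
  by rewrite half ltry.
by move=> u; rewrite lee_fin sqr_ge0.
Qed.

Lemma sector_radial_le (g : R -> R) e : normc e = 1%R ->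
  measurable_fun setT (g : RT -> RT) -> (forall r, (0 <= g r)%R) ->
  sector e (fun z => (g (normc z))%:E) <=
  \int[mu]_u (csec u ^+ 2)%:E * \int[mu]_(r in `]0%R, 1%R[) (g r)%:E.
Proof.
move=> e1 mg g0.
have Ig : 0 <= \int[mu]_(r in `]0%R, 1%R[) (g r)%:E.
  by apply: integral_ge0 => r _; rewrite lee_fin.
rewrite muleC -ge0_integralZl//; last 2 first.
- by apply/measurable_EFinP; apply: measurable_funX; exact: measurable_csec.
- by move=> u _; rewrite lee_fin sqr_ge0.
apply: ge0_le_lower_integral => u _.
  apply: integral_ge0 => r; rewrite /= in_itv/= => /andP[r0 _].
  by rewrite mule_ge0 ?lee_fin// mulr_ge0 ?sqr_ge0// ltW.
rewrite muleC -ge0_integralZl//; last 3 first.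
- by apply: measurable_funTS; exact/measurable_EFinP.
- by move=> r _; rewrite lee_fin.
- by rewrite lee_fin sqr_ge0.
apply: ge0_le_lower_integral => r; rewrite /= in_itv/= => /andP[r0 r1].
  by rewrite mule_ge0 ?lee_fin// mulr_ge0 ?sqr_ge0// ltW.
rewrite normc_arc// gtr0_norm// -!EFinM lee_fin mulrC ler_wpM2r//.
by rewrite ler_piMl ?sqr_ge0// ltW.
Qed.

Lemma disc_radial_lty (g : R -> R) : measurable_fun setT (g : RT -> RT) ->
  (forall r, (0 <= g r)%R) -> \int[mu]_(r in `]0%R, 1%R[) (g r)%:E < +oo ->
  \int[@plane_leb R]_(x in @plane_disc R) (g (normc (cpt x)))%:E < +oo.
Proof.
move=> mg g0 gfin.
have mG : measurable_on_disc (fun z : R[i] => (g (normc z))%:E).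
  by apply: (measurable_radial (g := EFin \o g)); exact/measurable_EFinP.
rewrite (disc_polar mG); last by move=> z _; rewrite lee_fin.
have H e : normc e = 1%R -> sector e (fun z : R[i] => (g (normc z))%:E) < +oo.
  move=> e1; apply: (le_lt_trans (sector_radial_le e1 mg g0)).
  apply: lte_mul_pinfty => //.
    by apply: integral_ge0 => u _; rewrite lee_fin sqr_ge0.
  rewrite ge0_fin_numE ?integral_sqr_csec_lty//.
  by apply: integral_ge0 => u _; rewrite lee_fin sqr_ge0.
by apply: lte_add_pinfty; apply: H; [exact: normc1|rewrite (normcN 1%R) normc1].
Qed.

Variables (k : R -> R) (b c C : R).
Hypothesis mk : measurable_fun setT (k : RT -> RT).
Hypothesis k_ge0 : forall x, (0 <= k x)%R.
Hypothesis k_fin : \int[mu]_x (k x)%:E < +oo.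
Hypothesis tail_pos : forall r, (r < 1)%R -> 0 < \int[mu]_(s in `[r, 1%R[) (k s)%:E.
Hypotheses (b_ge : (2^-1 < b)%R) (bc : (b < c)%R) (c_lt1 : (c < 1)%R).
Hypothesis C_gt1 : (1 < C)%R.
Hypothesis doubling : forall r, (0 <= r < 1)%R -> (tail k r <= C * tail k ((1 + r) / 2))%R.

Local Notation K := (tail k).
Local Notation sK := (stail k).
Local Notation N := (profile k b c).

Let b1 : (b < 1)%R. Proof. exact: lt_trans bc c_lt1. Qed.

Let ksK_ge0 s : (0 <= k s * (sK s)^-1)%R.
Proof. by rewrite mulr_ge0// invr_ge0 sqrtr_ge0. Qed.

Let mN : measurable_fun setT (fun s : RT => (N s)%:E).
Proof. by apply/measurable_EFinP; exact: measurable_profile. Qed.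

Let N_ge0 s : 0 <= (N s)%:E.
Proof. by rewrite lee_fin profile_ge0. Qed.

Let profileE s : (b <= s)%R -> N s = ((s < c)%R%:R + k s * (sK s)^-1)%R.
Proof.
move=> bs; rewrite /profile !ifF//; apply/negbTE; rewrite -leNgt//.
by rewrite (le_trans (ltW b_ge)).
Qed.

Let mksK : measurable_fun setT (fun s : RT => (k s * (sK s)^-1)%:E).
Proof. by apply/measurable_EFinP; apply: measurable_funM => //; exact: measurable_stailV. Qed.

Lemma integral_profile_le r : (0 <= r < 1)%R ->
  \int[mu]_(s in `[r, 1%R[) (N s)%:E <= (1 + 3 * sK b)%:E.
Proof.
move=> /andP[r0 r1].
apply: (@le_trans _ _ (\int[mu]_(s in `[0%R, 1%R[) (N s)%:E)).
  apply: ge0_subset_integral => //; first exact: measurable_funTS.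
  by apply: subset_itvr; rewrite bnd_simp.
pose g (s : R) : \bar R := ((fun s => (k s * (sK s)^-1)%:E) \_ `[b, 1%R[) s.
have g0 s : 0 <= g s by apply: erestrict_ge0 => x _; rewrite lee_fin.
have mg : measurable_fun setT (g : RT -> \bar R).
  by apply/(measurable_restrictT _ _).1 => //; exact: measurable_funTS.
apply: (@le_trans _ _ (\int[mu]_(s in `[0%R, 1%R[) (1 + g s))).
  apply: ge0_le_lower_integral => s //; rewrite /= in_itv/= => /andP[s0 s1].
  rewrite /g patchE mem_setE in_itv/= s1 andbT; have [bs|sb] := leP b s.
    by rewrite profileE// -EFinD lee_fin lerD2r; case: (s < c)%R.
  rewrite adde0 lee_fin /profile sb; case: ifP => //.
rewrite ge0_integralD//; last exact: measurable_funTS.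
rewrite integral_cst//= lebesgue_measure_itv/= lte01 oppr0 adde0 mul1e.
rewrite EFinD leeD2l//; apply: le_trans (integral_density_stailV_le1 mk k_ge0 k_fin tail_pos b1).
rewrite [leRHS]integral_mkcond; apply: ge0_subset_integral => //.
Qed.

(** Beyond [c] the profile is exactly k / sqrt K. Together with [integral_profile_ge] this makes its
    tail comparable to sqrt K. *)
Lemma integral_profile_le_stail r : (c <= r)%R -> (r < 1)%R ->
  \int[mu]_(s in `[r, 1%R[) (N s)%:E <= (3 * sK r)%:E.
Proof.
move=> cr r1; apply: le_trans (integral_density_stailV_le1 mk k_ge0 k_fin tail_pos r1).
rewrite le_eqVlt; apply/orP; left; apply/eqP; apply: eq_integral => s.
rewrite mem_setE in_itv/= => /andP[rs s1].
rewrite profileE; last by rewrite (le_trans (ltW bc))// (le_trans cr).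
by rewrite ltNge (le_trans cr rs) add0r.
Qed.

(** On [t, 1) the profile is at least k / sK t, whose integral is K t / sK t. Allowing t > r serves
    the radii r in front of or inside the gap. *)
Lemma integral_profile_ge r t : (r <= t)%R -> (b <= t)%R -> (t < 1)%R ->
  (sK t)%:E <= \int[mu]_(s in `[r, 1%R[) (N s)%:E.
Proof.
move=> rt bt t1; have st : (0 < sK t)%R by exact: stail_gt0.
apply: (@le_trans _ _ (\int[mu]_(s in `[t, 1%R[) (N s)%:E)); last first.
  apply: ge0_subset_integral => //; first exact: measurable_funTS.
  by apply: subset_itvr; rewrite bnd_simp.
have -> : (sK t)%:E = \int[mu]_(s in `[t, 1%R[) ((sK t)^-1%:E * (k s)%:E).
  rewrite ge0_integralZl//; last 3 first.
  - by apply: measurable_funTS; exact/measurable_EFinP.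
  - by move=> s _; rewrite lee_fin.
  - by rewrite lee_fin invr_ge0 ltW.
  rewrite tailE// -(sqr_stail mk k_ge0 k_fin) -EFinM; congr (_%:E).
  by field; rewrite gt_eqF.
apply: ge0_le_lower_integral => s; rewrite /= in_itv/= => /andP[ts s1].
  by rewrite mule_ge0 ?lee_fin// invr_ge0 ltW.
rewrite profileE ?(le_trans bt)// -EFinM lee_fin mulrC.
apply: (@le_trans _ _ (k s * (sK s)^-1)%R); last by rewrite lerDr ler0n.
rewrite ler_wpM2l// lef_pV2 ?posrE ?stail_gt0//.
exact: stail_nonincreasing.
Qed.

Definition radial_of (z : R[i]) : R := N (normc z).

Lemma hat_radial_of z : disc z ->
  hat radial_of z = \int[mu]_(s in `[normc z, 1%R[) (N s)%:E.
Proof.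
move=> zd; rewrite /hat modcE; apply: eq_integral => s.
rewrite mem_setE in_itv/= => /andP[zs _].
by rewrite /radial_of normcR ger0_norm// (le_trans (normc_ge0 z)).
Qed.

Lemma Dhat_radial_of : Dhat radial_of.
Proof.
have hat_pos z : disc z -> 0 < hat radial_of z.
  move=> zd; rewrite hat_radial_of//; move: zd; rewrite discE => z1.
  apply: (@lt_le_trans _ _ (sK (Num.max (normc z) b))%:E).
    by rewrite lte_fin stail_gt0// gt_max z1.
  by apply: integral_profile_ge; rewrite ?gt_max ?z1// le_max lexx ?orbT.
split.
  split => //.
  - split.
    + by move=> z _; exact: profile_ge0.
    + exists (fun x => N (normc (cpt x))).
        apply: (measurableT_comp (f := N : RT -> RT)); first exact: measurable_profile.
        exact: measurable_normc_cpt.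
      by exists set0; split => // x /= H; exfalso; apply: H.
    + rewrite /dA_int lte_mul_pinfty ?lee_fin ?invr_ge0 ?pi_ge0//.
      apply: (@disc_radial_lty N); first exact: measurable_profile.
        by move=> r; exact: profile_ge0.
      have := @integral_profile_le 0%R; rewrite lexx ltr01 => /(_ erefl) H.
      apply: le_lt_trans (le_lt_trans H (ltry _)).
      apply: ge0_subset_integral => //; first exact: measurable_funTS.
      by apply: subset_itvr; rewrite bnd_simp.
  - move=> z _; rewrite /radial_of normC_normc normcR ger0_norm//.
    exact: normc_ge0.
have m1 : ((1 + c) / 2 < 1)%R by rewrite ltr_pdivrMr// mul1r; have := c_lt1; lra.
have bm : (b <= (1 + c) / 2)%R.
  by rewrite ler_pdivlMr//; have := bc; have := c_lt1; lra.
have sm : (0 < sK ((1 + c) / 2))%R by exact: stail_gt0.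
have D0 : (0 <= (1 + 3 * sK b) / sK ((1 + c) / 2))%R.
  by rewrite divr_ge0 ?(ltW sm)// addr_ge0// mulr_ge0// sqrtr_ge0.
have E0 : (0 <= 3 * Num.sqrt C)%R by rewrite mulr_ge0// sqrtr_ge0.
(* The 2 gives a constant above 1; 3 * sqrt C serves r >= c; the quotient serves r < c, where (1 +
   r) / 2 <= (1 + c) / 2 leaves a tail of at least sK ((1 + c) / 2). *)
exists (2 + 3 * Num.sqrt C + (1 + 3 * sK b) / sK ((1 + c) / 2))%R; first by lra.
set C' := (2 + _ + _)%R.
have C'0 : (0 <= C')%R by rewrite /C'; lra.
move=> r /[dup] r01 /andP[r0 r1].
have rm : (0 <= (1 + r) / 2 < 1)%R.
  by rewrite divr_ge0 ?addr_ge0//= ltr_pdivrMr// mul1r; lra.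
have /andP[rm0 rm1] := rm.
rewrite !hat_radial_of ?discE ?normcR ?ger0_norm//.
have [cr|rc] := leP c r.
  have rr : (r <= (1 + r) / 2)%R by rewrite ler_pdivlMr//; lra.
  have cr2 : (b <= (1 + r) / 2)%R by rewrite (le_trans (ltW bc))// (le_trans cr).
  apply: (le_trans (integral_profile_le_stail cr r1)).
  apply: (@le_trans _ _ (C'%:E * (sK ((1 + r) / 2))%:E)); last first.
    by rewrite lee_wpmul2l ?lee_fin//; exact: integral_profile_ge.
  rewrite -EFinM lee_fin.
  have H : (sK r <= Num.sqrt C * sK ((1 + r) / 2))%R.
    by rewrite /stail -sqrtrM ?(ltW (lt_trans ltr01 C_gt1))// ler_wsqrtr ?doubling.
  apply: (@le_trans _ _ (3 * Num.sqrt C * sK ((1 + r) / 2)))%R.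
    by rewrite -mulrA ler_wpM2l.
  by rewrite ler_wpM2r ?sqrtr_ge0// /C'; lra.
apply: (le_trans (integral_profile_le r01)).
apply: (@le_trans _ _ (C'%:E * (sK ((1 + c) / 2))%:E)); last first.
  rewrite lee_wpmul2l ?lee_fin//; apply: integral_profile_ge => //.
  by rewrite ler_wpM2r ?invr_ge0// lerD2l ltW.
rewrite -EFinM lee_fin -ler_pdivrMr// /C' lerDr; lra.
Qed.

End RadialWeight.

(** * Failure of the weak-type bound *)

Section WeakTypeFails.
Local Open Scope ereal_scope.
Variable R : realType.
Local Notation RT := (measurableTypeR R).
Local Notation mu := (@lebesgue_measure R).
Variables (w : R[i] -> R) (k : R -> R) (b c p : R).
Hypothesis w_ge0 : forall z, disc z -> (0 <= w z)%R.
Hypothesis mk : measurable_fun setT (k : RT -> RT).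
Hypothesis k_ge0 : forall x, (0 <= k x)%R.
Hypothesis k_fin : \int[mu]_x (k x)%:E < +oo.
Hypothesis wk : {ae mu, forall r, (0 < r < 1)%R -> w r%:C = k r}.
Hypothesis tail_pos : forall r, (r < 1)%R -> 0 < \int[mu]_(s in `[r, 1%R[) (k s)%:E.
Hypothesis p_gt1 : (1 < p)%R.

Lemma hat_tail z : disc z -> hat w z = (tail k (normc z))%:E.
Proof.
move=> zd; rewrite /hat modcE (hat_density w_ge0 k_ge0 (normc_ge0 z) wk).
exact: tailE.
Qed.

Lemma normc_ray (z : R[i]) s : z != 0%R -> normc (s%:C * (z / `|z|))%R = `|s|%R.
Proof.
move=> z0; rewrite normC_normc !normcM normcV !normcR.
rewrite (ger0_norm (normc_ge0 z)) mulfV ?mulr1//.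
by apply: contraNneq z0 => /eq0_normc ->.
Qed.

Hypotheses (b_ge : (2^-1 < b)%R) (b_lt1 : (b < 1)%R).
Hypothesis tail_drop : (tail k b < tail k 2^-1)%R.

Let chi (r : R) : R := if (2^-1 <= r < b)%R then 1%R else 0%R.

Let bump (z : R[i]) : R[i] := (chi (normc z))%:C.

Let chi_ge0 r : (0 <= chi r)%R.
Proof. by rewrite /chi; case: ifP. Qed.

Let Lp_bump : Lp_norm (radial_of k b c) p (absf bump) = 0.
Proof.
have p0 : p != 0%R by rewrite gt_eqF// (lt_trans ltr01).
rewrite /Lp_norm /dA_int integral0_eq; first by rewrite mule0 poweR0r// invr_eq0.
move=> x _; rewrite /absf modcE /bump normcR /radial_of /chi /profile.
case: ifPn => [/andP[h1 h2]|_]; last by rewrite normr0 poweR0r ?mul0e.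
by rewrite ltNge h1/= h2 mule0.
Qed.

Let space_bump : Lp_space (radial_of k b c) p bump.
Proof.
split; last by rewrite Lp_bump.
- exists (fun x => chi (normc (cpt x))).
    apply: (measurableT_comp (f := chi : RT -> RT)); last exact: measurable_normc_cpt.
    have -> : (chi : RT -> RT) = \1_(`[2^-1%R, b[%classic : set RT).
      apply/funext => r; rewrite indicE /chi.
      have -> : (r \in (`[2^-1%R, b[%classic : set RT)) = (2^-1 <= r < b)%R.
        by apply/idP/idP; rewrite inE/= in_itv.
      by case: ifP.
    exact: measurable_indic.
  by exists set0; split => // x /= H; exfalso; apply: H.
- exists (fun=> 0%R); first exact: measurable_cst.
  by exists set0; split => // x /= H; exfalso; apply: H.
Qed.

Let TintegrandE z s : z != 0%R -> (0 <= s)%R ->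
  Tintegrand w bump z s = (chi s * w s%:C)%:C.
Proof.
by move=> z0 s0; rewrite /Tintegrand /bump normc_ray// ger0_norm// -rmorphM.
Qed.

Let integral_bump r : (0 <= r)%R -> (r < 2^-1)%R ->
  \int[mu]_(s in `[r, 1%R[) (chi s * w s%:C)%:E = (tail k 2^-1 - tail k b)%:E.
Proof.
move=> r0 r2.
have -> : \int[mu]_(s in `[r, 1%R[) (chi s * w s%:C)%:E =
    \int[mu]_(s in `[r, 1%R[) (chi s * k s)%:E.
  apply: ge0_ae_eq_lower_integral => //.
  - move=> s; rewrite /= in_itv/= => /andP[rs s1]; rewrite lee_fin mulr_ge0// w_ge0//.
    by rewrite discE normcR ger0_norm// (le_trans r0 rs).
  - by move=> s _; rewrite lee_fin mulr_ge0.
  apply: (ae_imp2 _ wk (ae_neq 0%R)) => s ws s0; rewrite /= in_itv/= => /andP[rs s1].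
  by rewrite ws// s1 andbT lt_neqAle eq_sym s0 (le_trans r0 rs).
rewrite -(integral_density mk k_ge0 k_fin (ltW b_ge) (ltW b_lt1)).
rewrite [LHS]integral_mkcond [RHS]integral_mkcond; apply: eq_integral => s _.
rewrite !patchE !mem_setE !in_itv/= /chi.
case: (boolP (2^-1 <= s < b)%R) => [/andP[h1 h2]|_]; last by rewrite mul0r if_same.
by rewrite mul1r (ltW (lt_le_trans r2 h1)) (lt_trans h2 b_lt1).
Qed.

Let absT_bump z : (0 < normc z)%R -> (normc z < 2^-1)%R ->
  absT w bump z = ((tail k 2^-1 - tail k b) / tail k (normc z))%:E.
Proof.
move=> z0 z2.
have zn0 : z != 0%R by apply: contraTneq z0 => ->; rewrite normc0 ltxx.
have nz := normc_ge0 z.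
have z1 : (normc z < 1)%R by apply: (lt_trans z2); rewrite invf_lt1// ltr1n.
have d0 : (0 <= tail k 2^-1 - tail k b)%R by rewrite subr_ge0 ltW.
have pos s : s \in `[normc z, 1%R[%classic -> (0 <= s)%R /\ (0 <= chi s * w s%:C)%R.
  rewrite mem_setE in_itv/= => /andP[zs s1]; have s0 := le_trans nz zs.
  by split => //; rewrite mulr_ge0// w_ge0// discE normcR ger0_norm.
have E1 : \int[mu]_(s in `[modc z, 1%R[) (modc (Tintegrand w bump z s))%:E =
    (tail k 2^-1 - tail k b)%:E.
  rewrite modcE -(integral_bump nz z2); apply: eq_integral => s /pos[s0 cs0].
  by rewrite TintegrandE// modcE normcR ger0_norm.
rewrite /absT E1 ltry /Tavg modcE; congr (_%:E).
have -> : (\int[mu]_(s in `[normc z, 1%R[) complex.Re (Tintegrand w bump z s) =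
    tail k 2^-1 - tail k b)%R.
  rewrite -[RHS]/(fine (_%:E)) -(integral_bump nz z2); congr fine.
  by apply: eq_integral => s /pos[s0 _]; rewrite TintegrandE.
have -> : (\int[mu]_(s in `[normc z, 1%R[) complex.Im (Tintegrand w bump z s) = 0)%R.
  rewrite /Rintegral integral0_eq// => s zs.
  by have [s0 _] := pos s (mem_set zs); rewrite TintegrandE.
have zd : disc z by rewrite discE.
rewrite (hat_tail zd) ?modcE -[fine _]/(tail k (normc z)).
rewrite -[_ +i* 0%R]/((tail k 2^-1 - tail k b)%R%:C) normcM normcV.
have tz : (0 < tail k (normc z))%R by exact: tail_gt0.
by rewrite !normcR !ger0_norm// ltW.
Qed.

Lemma not_weak_type : ~ T_bounded_Lp_weakLp w (radial_of k b c) p.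
Proof.
move=> [C0 HC]; pose d := (tail k 2^-1 - tail k b)%R.
have d0 : (0 < d)%R by rewrite subr_gt0.
have K0 : (0 < tail k 0)%R by exact: tail_gt0.
(* For 0 < |z| < 1/2 the average of [bump] is d / K(|z|), at least d / K(0); half of this is a level
   strictly exceeded. *)
have l0 : (0 < d / tail k 0 / 2)%R by rewrite divr_gt0// divr_gt0.
have := HC _ _ l0 space_bump.
have p0 : p != 0%R by rewrite gt_eqF// (lt_trans ltr01).
rewrite Lp_bump poweR0r// mule0 leNgt => /negP; apply.
rewrite /weight_measure /dA_int mule_gt0 ?lte_fin ?invr_gt0 ?pi_gt0//.
(* The square q x q has positive measure and lies in 0 < |z| < 1/2, where the weight is 1 and
   [absT_bump] applies. *)
pose q : set RT := `[8^-1%R, 4^-1%R]%classic.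
have mq : measurable q by exact: measurable_itv.
have rect_pos : 0 < @plane_leb R (q `*` q).
  have -> : @plane_leb R (q `*` q) = mu q * mu q by exact: product_measure1E.
  rewrite lebesgue_measure_itv/= lte_fin.
  by rewrite ltf_pV2 ?posrE// ltr_nat/= -EFinD -EFinM lte_fin mulr_gt0// subr_gt0 ltf_pV2 ?posrE// ltr_nat.
apply: (lt_le_trans rect_pos).
have qd x : (q `*` q) x -> (0 < normc (cpt x) < 2^-1)%R.
  rewrite /q => -[/=]; rewrite !in_itv/= => /andP[a1 a2] /andP[b1' b2'].
  have x0 : (0 < x.1)%R by apply: lt_le_trans a1; rewrite invr_gt0.
  have y0 : (0 < x.2)%R by apply: lt_le_trans b1'; rewrite invr_gt0.
  apply/andP; split.
    by apply: (lt_le_trans x0); apply: le_trans (ler_norm _) (ler_Re_normc (cpt x)).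
  have h : (0 <= 2^-1 :> R)%R by rewrite invr_ge0.
  suff: (normc (cpt x) ^+ 2 < 2^-1 ^+ 2)%R by rewrite ltr_sqr ?nnegrE ?normc_ge0.
  rewrite sqr_normc/=.
  have h2 : (2^-1 ^+ 2 = 4^-1 :> R)%R by rewrite exprVn -natrX.
  rewrite h2; have h3 : (4^-1 * 4^-1 = 16^-1 :> R)%R by rewrite -invfM -natrM.
  by move: a2 b2' x0 y0; rewrite !expr2; move: (x.1) (x.2) => s t; nra.
have half1 : (2^-1 < 1 :> R)%R by rewrite invf_lt1// ltr1n.
rewrite -(setIT (q `*` q)) -(integral_indic (@plane_leb R) measurableT (measurableX mq mq)).
rewrite [leRHS]integral_mkcond; apply: ge0_le_lower_integral => x _; first by rewrite lee_fin.
rewrite patchE indicE; have [xq|xq] := boolP (x \in q `*` q); last first.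
  case: ifPn => // _; rewrite lee_fin mulr_ge0//.
  exact: profile_ge0.
move: xq; rewrite inE => /qd /andP[x0 x2].
have xd : disc (cpt x) by rewrite discE (lt_trans x2).
rewrite mem_set//= indicE mem_set/=; last first.
  split => //; rewrite absT_bump// lte_fin -/d.
  have Kx : (0 < tail k (normc (cpt x)))%R by apply: tail_gt0 => //; exact: lt_trans half1.
  have KK : (tail k (normc (cpt x)) <= tail k 0)%R by apply: tail_nonincreasing => //; exact: ltW.
  apply: (@lt_le_trans _ _ (d / tail k 0)%R).
    by rewrite ltr_pdivrMr// ltr_pMr ?divr_gt0// ltr1n.
  by rewrite ler_wpM2l ?(ltW d0)// lef_pV2 ?posrE.
by rewrite /radial_of /profile x2 mul1r.
Qed.

End WeakTypeFails.

(** * Boundedness on analytic functions *)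

Section StrongType.
Local Open Scope ereal_scope.
Variable R : realType.
Local Notation RT := (measurableTypeR R).
Local Notation mu := (@lebesgue_measure R).

(** Dividing a measurable minorant of a * f by [a] gives a minorant of [f]. It is used to take the
    angular Jacobian out of an integral of [absT]. *)
Lemma lower_integralZl_le d (T : measurableType d) (m : {measure set T -> \bar R})
    (D : set T) (a : R) (f : T -> \bar R) : measurable D -> (0 < a)%R ->
  (forall x, D x -> 0 <= f x) ->
  \int[m]_(x in D) (a%:E * f x) <= a%:E * \int[m]_(x in D) f x.
Proof.
move=> mD a0 f0; have aE0 : 0 <= a%:E by rewrite lee_fin ltW.
apply: lower_integral_leP => // [x Dx|h mh h0 hf]; first by rewrite mule_ge0 ?f0.
have ai0 : 0 <= a^-1%:E by rewrite lee_fin invr_ge0 ltW.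
have -> : \int[m]_(x in D) h x = a%:E * \int[m]_(x in D) (a^-1%:E * h x).
  rewrite ge0_integralZl//; last exact: measurable_funTS.
  by rewrite muleA -EFinM mulfV ?gt_eqF// mul1e.
rewrite lee_wpmul2l//; apply: ge0_le_lower_integral => x Dx; first exact: mule_ge0.
apply: (le_trans (lee_wpmul2l ai0 (hf _ Dx))).
by rewrite muleA -EFinM mulVf ?gt_eqF// mul1e.
Qed.

(** The integrals of the positive and negative parts of [g] both lie in [0, x], hence so does the
    modulus of their difference. *)
Lemma ler_norm_lower_Rintegral (D : set RT) (g h : R -> R) (x : R) :
  (forall s, D s -> `|g s| <= h s)%R -> \int[mu]_(s in D) (h s)%:E = x%:E ->
  (`|\int[mu]_(s in D) g s| <= x)%R.
Proof.
move=> gh hx; rewrite /Rintegral integralE.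
set P := \int[mu]_(s in D) _; set Q := \int[mu]_(s in D) _.
have P0 : 0 <= P by exact: integral_ge0.
have Q0 : 0 <= Q by exact: integral_ge0.
have Px : P <= x%:E.
  rewrite -hx; apply: ge0_le_lower_integral => s Ds //.
  rewrite funeposE ge_max !lee_fin (le_trans _ (gh _ Ds)) ?ler_norm//=.
  exact: le_trans (gh _ Ds).
have Qx : Q <= x%:E.
  rewrite -hx; apply: ge0_le_lower_integral => s Ds //.
  rewrite funenegE ge_max -EFinN !lee_fin; apply/andP; split.
    by rewrite (le_trans _ (gh _ Ds))// -normrN ler_norm.
  exact: le_trans (gh _ Ds).
case: P P0 Px => // a; rewrite !lee_fin => a0 ax.
case: Q Q0 Qx => // q; rewrite !lee_fin => q0 qx /=.
by rewrite ler_norml; apply/andP; split; lra.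
Qed.

Variables (w : R[i] -> R) (k : R -> R) (b c p : R).
Hypothesis w_ge0 : forall z, disc z -> (0 <= w z)%R.
Hypothesis mk : measurable_fun setT (k : RT -> RT).
Hypothesis k_ge0 : forall x, (0 <= k x)%R.
Hypothesis k_out : forall x, ~~ (0 < x < 1)%R -> k x = 0%R.
Hypothesis k_fin : \int[mu]_x (k x)%:E < +oo.
Hypothesis wk : {ae mu, forall r, (0 < r < 1)%R -> w r%:C = k r}.
Hypothesis tail_pos : forall r, (r < 1)%R -> 0 < \int[mu]_(s in `[r, 1%R[) (k s)%:E.
Hypotheses (b_ge : (2^-1 < b)%R) (bc : (b < c)%R) (c_lt1 : (c < 1)%R).
Hypothesis p_gt1 : (1 < p)%R.

Local Notation nu := (radial_of k b c).
Local Notation N := (profile k b c).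

(** The factor 2 comes from bounding a modulus by |Re| + |Im|, each part being estimated by the
    integral of the modulus. When that integral diverges, both sides are [+oo]. *)
Lemma absT_le (f : R[i] -> R[i]) z : disc z -> z != 0%R ->
  absT w f z <= (2 / tail k (normc z))%:E *
    \int[mu]_(s in `[normc z, 1%R[) (normc (f (s%:C * (z / `|z|))) * k s)%:E.
Proof.
move=> zd z0; have := zd; rewrite discE => z1.
have tz : (0 < tail k (normc z))%R by exact: tail_gt0.
have nz := normc_ge0 z.
have TE s : normc (Tintegrand w f z s) =
    (normc (f (s%:C * (z / `|z|))) * `|w s%:C|)%R.
  by rewrite /Tintegrand normcM normcR.
have XE : \int[mu]_(s in `[normc z, 1%R[) (normc (Tintegrand w f z s))%:E =
    \int[mu]_(s in `[normc z, 1%R[) (normc (f (s%:C * (z / `|z|))) * k s)%:E.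
  apply: ge0_ae_eq_lower_integral => //.
  - by move=> s _; rewrite lee_fin normc_ge0.
  - by move=> s _; rewrite lee_fin mulr_ge0// normc_ge0.
  apply: (ae_imp2 _ wk (ae_neq 0%R)) => s ws s0; rewrite /= in_itv/= => /andP[zs s1].
  have s01 : (0 < s < 1)%R by rewrite s1 andbT lt_neqAle eq_sym s0 (le_trans nz zs).
  by rewrite TE (ws s01) (ger0_norm (k_ge0 s)).
rewrite -XE /absT.
have -> : \int[mu]_(s in `[modc z, 1%R[) (modc (Tintegrand w f z s))%:E =
    \int[mu]_(s in `[normc z, 1%R[) (normc (Tintegrand w f z s))%:E.
  by rewrite modcE; apply: eq_integral => s _; rewrite modcE.
have X0 : 0 <= \int[mu]_(s in `[normc z, 1%R[) (normc (Tintegrand w f z s))%:E.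
  by apply: integral_ge0 => s _; rewrite lee_fin normc_ge0.
case: ifPn => [Xfin|]; last first.
  rewrite -leNgt leye_eq => /eqP ->.
  by rewrite gt0_muley ?lte_fin ?divr_gt0.
have [x xE] : exists x, \int[mu]_(s in `[normc z, 1%R[) (normc (Tintegrand w f z s))%:E = x%:E.
  by move: X0 Xfin; case: (integral _ _ _) => // x _ _; exists x.
rewrite xE -EFinM lee_fin /Tavg modcE.
set A := (\int[mu]_(s in _) complex.Re _)%R; set B := (\int[mu]_(s in _) complex.Im _)%R.
have A1 : (`|A| <= x)%R.
  rewrite /A modcE.
  by apply: (ler_norm_lower_Rintegral (h := fun s => normc (Tintegrand w f z s))) => // s _; exact: ler_Re_normc.
have B1 : (`|B| <= x)%R.
  rewrite /B modcE.
  by apply: (ler_norm_lower_Rintegral (h := fun s => normc (Tintegrand w f z s))) => // s _; exact: ler_Im_normc.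
rewrite (hat_tail w_ge0 mk k_ge0 k_fin wk zd) -[fine _]/(tail k (normc z)).
rewrite normcM normcV normcR (gtr0_norm tz) mulrAC ler_wpM2r ?invr_ge0 ?(ltW tz)//.
by apply: (le_trans (normc_le_ReIm _)) => /=; lra.
Qed.

Section OneFunction.
Variable f : R[i] -> R[i].
Hypothesis af : analytic_disc f.

Let F (z : R[i]) : \bar R := (normc (f z) `^ p * nu z)%:E.
Let I := \int[@plane_leb R]_(x in @plane_disc R) F (cpt x).

Let mf : measurable_fun (@plane_disc R) (fun x => normc (f (cpt x)) : RT).
Proof.
apply/measurable_EFinP; have := measurable_analytic af.
by rewrite /measurable_on_disc; apply: eq_measurable_fun => x _; rewrite /absf/= modcE.
Qed.

Let F_ge0 z : 0 <= F z.
Proof. by rewrite lee_fin mulr_ge0 ?powR_ge0 ?profile_ge0. Qed.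

Let mF : measurable_on_disc F.
Proof.
apply/measurable_EFinP; apply: measurable_funM.
  exact: (measurableT_comp (measurable_powR _)).
apply: (measurableT_comp (f := N : RT -> RT)); first exact: measurable_profile.
exact: measurable_normc_cpt.
Qed.

Let sector_F_le e : e = 1%R \/ e = (-1)%R -> sector e F <= I.
Proof.
have s0 e' : 0 <= sector e' F.
  apply: integral_ge0 => u _; apply: integral_ge0 => r.
  by rewrite /= in_itv/= => /andP[r0 _]; rewrite mule_ge0// lee_fin mulr_ge0 ?sqr_ge0// ltW.
rewrite /I (disc_polar mF (fun z _ => F_ge0 z)).
by case=> ->; [rewrite leeDl|rewrite leeDr].
Qed.

Section OneSector.
Variables (e : R[i]) (S : R).
Hypothesis e_or : e = 1%R \/ e = (-1)%R.
Hypothesis S_ge0 : (0 <= S)%R.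
Hypothesis f_le : forall z, (normc z <= b)%R -> (normc (f z) <= S)%R.

Let e1 : normc e = 1%R.
Proof. by case: e_or => ->; rewrite ?(normcN 1%R) normc1. Qed.

Let J u := \int[mu]_(r in `]0%R, 1%R[) (F (arc r e u) * (r * csec u ^+ 2)%:E).

Let inner_le u :
  \int[mu]_(r in `]0%R, 1%R[) (((absT w f (arc r e u)) `^ p * (nu (arc r e u))%:E) *
     (r * csec u ^+ 2)%:E) <=
  (ray_const k b c p)%:E * ((S `^ p * csec u ^+ 2)%:E + J u).
Proof.
have c0 : (0 < csec u ^+ 2)%R by rewrite exprn_gt0// csec_gt0.
(* The cut-off provides the function on the whole line that [ray_bound] expects; the analytic
   modulus is measurable only inside the disc. *)
pose phi s := if (0 < s < 1)%R then normc (f (arc s e u)) else 0%R.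
have phi0 s : (0 <= phi s)%R by rewrite /phi; case: ifP => // _; exact: normc_ge0.
have mphi : measurable_fun setT (phi : RT -> RT).
  have -> : (phi : RT -> RT) = (fun s => normc (f (arc s e u))) \_ `]0%R, 1%R[.
    by apply/funext => s; rewrite patchE mem_setE in_itv.
  apply/(measurable_restrictT _ _).1 => //; apply/measurable_EFinP.
  have := measurable_on_disc_arc u e1 (measurable_analytic af).
  by apply: eq_measurable_fun => s _; rewrite /absf modcE.
have phi_le s : (0 < s <= b)%R -> (phi s <= S)%R.
  move=> /andP[s0 sb]; rewrite /phi; case: ifP => // _.
  by apply: f_le; rewrite normc_arc// gtr0_norm.
pose Y r := (absT w f (arc r e u)) `^ p.
have Y0 r : (0 < r < 1)%R -> 0 <= Y r by move=> _; exact: poweR_ge0.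
have p0 : (0 <= p)%R by exact: ltW (lt_trans ltr01 p_gt1).
have absT0 z : 0 <= absT w f z.
  by rewrite /absT; case: ifP => // _; rewrite ?leey// lee_fin modcE normc_ge0.
have YA r : (0 < r < 1)%R ->
    Y r <= ((2 / tail k r)%:E * \int[mu]_(s in `[r, 1%R[) (phi s * k s)%:E) `^ p.
  move=> /[dup] r01 /andP[r0 r1]; apply: lee_poweR => //.
  have z0 : arc r e u != 0%R.
    apply: contraTneq r0 => z0; have := normc_arc r u e1.
    by rewrite z0 normc0 => /esym/eqP; rewrite normr_eq0 => /eqP ->; rewrite ltxx.
  apply: (le_trans (absT_le f (disc_arc _ e1 r01) z0)).
  rewrite normc_arc// gtr0_norm// le_eqVlt; apply/orP; left; apply/eqP; congr (_ * _).
  apply: eq_integral => s; rewrite mem_setE in_itv/= => /andP[rs s1].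
  have s01 : (0 < s < 1)%R by rewrite s1 (lt_le_trans r0 rs).
  rewrite /phi s01; congr (normc (f _) * _)%:E.
  have cancel (L : fieldType) (x y a g : L) : x != 0%R -> (y * (x * a * g / x) = y * a * g)%R.
    by move=> x0; field.
  by rewrite normC_normc normc_arc// gtr0_norm// /arc cancel// eq_complex/= eqxx andbT gt_eqF.
have H := ray_bound mk k_ge0 k_out k_fin tail_pos b_ge bc c_lt1 p_gt1 mphi phi0 S_ge0 phi_le Y0 YA.
apply: (@le_trans _ _ ((csec u ^+ 2)%:E * \int[mu]_(r in `]0%R, 1%R[) (Y r * (N r * r)%:E))).
  have Yn r : (`]0%R, 1%R[%classic : set RT) r -> 0 <= Y r * (N r * r)%:E.
    rewrite /= in_itv/= => /[dup] r01 /andP[r0 _].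
    by rewrite mule_ge0 ?Y0// lee_fin mulr_ge0 ?profile_ge0// ltW.
  apply: le_trans (lower_integralZl_le mu (measurable_itv _) c0 Yn).
  rewrite le_eqVlt; apply/orP; left; apply/eqP; apply: eq_integral => r.
  rewrite mem_setE in_itv/= => /[dup] r01 /andP[r0 _].
  rewrite /radial_of normc_arc// gtr0_norm// -/(Y r) muleCA -!muleA; congr (_ * _).
  by rewrite -!EFinM; congr (_%:E); ring.
apply: (le_trans (lee_wpmul2l _ H)); first by rewrite lee_fin ltW.
rewrite muleCA lee_wpmul2l ?lee_fin ?ray_const_ge0//.
have Z0 r : (`]0%R, 1%R[%classic : set RT) r -> 0 <= (phi r `^ p * (N r * r))%:E.
  rewrite /= in_itv/= => /andP[r0 _].
  by rewrite lee_fin mulr_ge0 ?powR_ge0// mulr_ge0 ?profile_ge0// ltW.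
rewrite ge0_muleDr ?lee_fin ?powR_ge0//; last exact: integral_ge0.
rewrite -EFinM mulrC leeD2l// -ge0_integralZl//; last 2 first.
- apply/measurable_EFinP; apply: measurable_funTS; apply: measurable_funM.
    exact: (measurableT_comp (measurable_powR _)).
  by apply: measurable_funM => //; exact: measurable_profile.
- by rewrite lee_fin ltW.
rewrite le_eqVlt; apply/orP; left; apply/eqP; apply: eq_integral => r.
rewrite mem_setE in_itv/= => /[dup] r01 /andP[r0 _].
rewrite /phi r01 /F /radial_of normc_arc// gtr0_norm// -!EFinM; congr (_%:E); ring.
Qed.

Lemma sector_absT_le :
  sector e (fun z => (absT w f z) `^ p * (nu z)%:E) <=
  (ray_const k b c p)%:E * ((S `^ p)%:E * \int[mu]_u (csec u ^+ 2)%:E + I).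
Proof.
have J0 u : 0 <= J u.
  apply: integral_ge0 => r; rewrite /= in_itv/= => /andP[r0 _].
  by rewrite mule_ge0// lee_fin mulr_ge0 ?sqr_ge0// ltW.
have rc0 : 0 <= (ray_const k b c p)%:E by rewrite lee_fin ray_const_ge0.
have Sc0 u : 0 <= (S `^ p * csec u ^+ 2)%:E by rewrite lee_fin mulr_ge0 ?powR_ge0 ?sqr_ge0.
have mc : measurable_fun setT (fun u : RT => (csec u ^+ 2)%:E : \bar R).
  by apply/measurable_EFinP; apply: measurable_funX; exact: measurable_csec.
have mSc : measurable_fun setT (fun u : RT => (S `^ p * csec u ^+ 2)%:E : \bar R).
  by under eq_fun do rewrite EFinM; exact: measurable_funeM.
have mJ : measurable_fun setT (J : RT -> \bar R).
  exact: (measurable_sector e1 mF (fun z _ => F_ge0 z)).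
apply: (@le_trans _ _ (\int[mu]_u ((ray_const k b c p)%:E *
    ((S `^ p * csec u ^+ 2)%:E + J u)))).
  apply: ge0_le_lower_integral => u _; last exact: inner_le.
  apply: integral_ge0 => r; rewrite /= in_itv/= => /andP[r0 _].
  rewrite mule_ge0 ?mule_ge0 ?poweR_ge0 ?lee_fin ?profile_ge0//.
  by rewrite mulr_ge0 ?sqr_ge0// ltW.
rewrite ge0_integralZl//; last 2 first.
- exact: emeasurable_funD.
- by move=> u _; exact: adde_ge0.
rewrite lee_wpmul2l// ge0_integralD//.
apply: leeD; last exact: sector_F_le.
under eq_integral do rewrite EFinM.
rewrite ge0_integralZl ?lee_fin ?powR_ge0//.
by move=> u _; rewrite lee_fin sqr_ge0.
Qed.

End OneSector.

Lemma absT_power_le S : (0 <= S)%R ->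
  (forall z, (normc z <= b)%R -> (normc (f z) <= S)%R) ->
  \int[@plane_leb R]_(x in @plane_disc R) ((absT w f (cpt x)) `^ p * (nu (cpt x))%:E) <=
  (2 * ray_const k b c p)%:E * ((S `^ p)%:E * \int[mu]_u (csec u ^+ 2)%:E + I).
Proof.
move=> S0 fS.
apply: (le_trans (disc_polar_le (F := fun z => (absT w f z) `^ p * (nu z)%:E) _)).
  by move=> z _; rewrite mule_ge0 ?poweR_ge0 ?lee_fin ?profile_ge0.
apply: (le_trans (leeD (sector_absT_le (or_introl erefl) S0 fS)
  (sector_absT_le (or_intror erefl) S0 fS))).
by rewrite -mule2n -mule_natl muleA -EFinM.
Qed.

(** The midpoint: circles of radius above [b'] stay at positive distance from the closed disc of
    radius [b]. *)
Let b' : R := ((b + c) / 2)%R.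
Let kap : R := ((b' - b) ^+ 2 * b' * (c - b'))%R.
Let chi (x : RT * RT) : R := \1_(`]b', c[%classic : set R) (normc (cpt x)).

Let bb' : (b < b')%R. Proof. by rewrite ltr_pdivlMr//; have := bc; lra. Qed.
Let b'c : (b' < c)%R. Proof. by rewrite ltr_pdivrMr//; have := bc; lra. Qed.
Let b'0 : (0 < b')%R.
Proof.
apply: lt_trans bb'; apply: lt_trans b_ge; by rewrite invr_gt0.
Qed.
Let kap_gt0 : (0 < kap)%R.
Proof.
apply: mulr_gt0; last by rewrite subr_gt0.
by apply: mulr_gt0 => //; apply: exprn_gt0; rewrite subr_gt0.
Qed.

(** [annulus_bound] gives a bound by the integral [J1] of |f| over b' < |z| < c, and Jensen turns
    its p-th power into the integral of |f|^p there. The profile is at least 1 on that annulus, so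
    the latter is at most [I]. *)
Lemma sup_bound (M : R) : (0 < M)%R ->
  \int[@plane_leb R]_(x in @plane_disc R) 1%:E <= M%:E -> I < +oo ->
  exists2 S, (0 <= S)%R &
    (forall z, (normc z <= b)%R -> (normc (f z) <= S)%R) /\
    (S `^ p)%:E <= ((2 / kap) `^ p * (2 `^ p * M `^ (p - 1)))%:E * I.
Proof.
move=> M0 area Ifin.
have p0 : (0 < p)%R by exact: lt_trans p_gt1.
pose J1 := \int[@plane_leb R]_(x in @plane_disc R) (normc (f (cpt x)) * chi x)%:E.
have chi0 x : (0 <= chi x)%R by rewrite /chi indicE ler0n.
have J10 : 0 <= J1 by apply: integral_ge0 => x _; rewrite lee_fin mulr_ge0 ?normc_ge0.
have mchi : measurable_fun (@plane_disc R) (chi : RT * RT -> RT).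
  apply: (measurableT_comp (f := \1_(`]b', c[%classic : set RT) : RT -> RT)).
    exact: measurable_indic.
  exact: measurable_normc_cpt.
have mD := @measurable_plane_disc R.
have J1p : J1 `^ p <= (2 `^ p * M `^ (p - 1))%:E * I.
  apply: (le_trans (jensen_power p_gt1 M0 mD mf mchi _ _ _)).
  - by move=> x _; exact: normc_ge0.
  - by move=> x _; exact: chi0.
  - apply: le_trans area; apply: ge0_le_lower_integral => x _; rewrite lee_fin//.
    by rewrite /chi indicE; case: (_ \in _).
  rewrite lee_wpmul2l ?lee_fin ?mulr_ge0 ?powR_ge0//.
  apply: ge0_le_lower_integral => x _; first by rewrite lee_fin mulr_ge0 ?powR_ge0.
  rewrite lee_fin ler_wpM2l ?powR_ge0// /chi indicE.
  case: (boolP (_ \in _)) => [|_]; last exact: profile_ge0.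
  rewrite inE/= in_itv/= => /andP[h1 h2]; rewrite /radial_of /profile.
  have h3 : (b <= normc (cpt x))%R by rewrite ltW// (lt_trans bb').
  rewrite !ifF ?h2; first by rewrite lerDl mulr_ge0// invr_ge0 sqrtr_ge0.
    by apply/negbTE; rewrite -leNgt.
  by apply/negbTE; rewrite -leNgt (le_trans (ltW b_ge)).
have J1fin : J1 < +oo.
  apply: (@lty_poweRy _ _ p); first by rewrite gt_eqF.
  apply: (le_lt_trans J1p); apply: lte_mul_pinfty => //.
  by rewrite lee_fin mulr_ge0 ?powR_ge0.
have J1E : J1 = (fine J1)%:E by rewrite fineK// ge0_fin_numE.
have q0 : (0 <= 2 / kap)%R by rewrite divr_ge0// ltW.
have fJ0 : (0 <= fine J1)%R by exact: fine_ge0.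
exists (2 / kap * fine J1)%R; first exact: mulr_ge0.
split.
  move=> z zb; have := annulus_bound af zb bb' b'c (ltW c_lt1).
  have -> : \int[@plane_leb R]_(x in @plane_disc R)
      (absf f (cpt x) * (\1_(`]b', c[%classic : set R) (normc (cpt x)))%:E) = J1.
    by apply: eq_integral => x _; rewrite /absf modcE.
  rewrite -/kap J1E -EFinM lee_fin => H.
  by rewrite mulrAC ler_pdivlMr.
rewrite powRM// EFinM [X in _ <= X * _]EFinM -muleA lee_wpmul2l ?lee_fin ?powR_ge0//.
by rewrite -poweR_EFin -J1E.
Qed.

End OneFunction.

Lemma strong_type : T_bounded_Ap_Lp w nu p.
Proof.
have p0 : (0 < p)%R by exact: lt_trans p_gt1.
have G0 : 0 <= \int[mu]_u (csec u ^+ 2 : R)%:E.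
  by apply: integral_ge0 => u _; rewrite lee_fin sqr_ge0.
have Gfin : \int[mu]_u (csec u ^+ 2 : R)%:E = (fine (\int[mu]_u (csec u ^+ 2 : R)%:E))%:E.
  by rewrite fineK// ge0_fin_numE// integral_sqr_csec_lty.
set G := fine _ in Gfin; have G0' : (0 <= G)%R by rewrite -lee_fin -Gfin.
have area0 : 0 <= \int[@plane_leb R]_(x in @plane_disc R) 1%:E by exact: integral_ge0.
have area_fin : \int[@plane_leb R]_(x in @plane_disc R) 1%:E < +oo.
  apply: (disc_radial_lty (g := fun=> 1%R)) => //.
  by rewrite integral_cst//= lebesgue_measure_itv/= lte01 mul1e oppr0 adde0 ltry.
(* The [+ 1] makes [M] positive, as Jensen requires, without computing the area. *)
pose M := (fine (\int[@plane_leb R]_(x in @plane_disc R) 1%:E) + 1)%R.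
have M0 : (0 < M)%R by rewrite ltr_wpDl// fine_ge0.
have areaM : \int[@plane_leb R]_(x in @plane_disc R) 1%:E <= M%:E.
  by rewrite -[leLHS]fineK ?ge0_fin_numE// lee_fin lerDl.
pose kap : R := (((b + c) / 2 - b) ^+ 2 * ((b + c) / 2) * (c - (b + c) / 2))%R.
pose c2 : R := ((2 / kap) `^ p * (2 `^ p * M `^ (p - 1)))%R.
have c20 : (0 <= c2)%R by rewrite !mulr_ge0 ?powR_ge0.
pose rc := ray_const k b c p.
have rc0 : (0 <= rc)%R by exact: ray_const_ge0.
(* [c2] bounds S^p by [I], [G] is the integral of the angular Jacobian, and the 2 counts the two
   half discs. *)
pose B : R := (2 * rc * (c2 * G + 1))%R.
have B0 : (0 <= B)%R by rewrite mulr_ge0 ?mulr_ge0// addr_ge0// mulr_ge0.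
exists (B `^ p^-1)%R => f [af [_ _ Lpfin]].
pose I := \int[@plane_leb R]_(x in @plane_disc R) (normc (f (cpt x)) `^ p * nu (cpt x))%:E.
have IE : dA_int (fun z => absf f z `^ p * (nu z)%:E) = (pi^-1)%:E * I.
  by rewrite /dA_int; congr (_ * _).
have I0 : 0 <= I.
  by apply: integral_ge0 => x _; rewrite lee_fin mulr_ge0 ?powR_ge0 ?profile_ge0.
have Ifin : I < +oo.
  apply: (dA_int_lty (F := fun z => (normc (f z) `^ p * nu z)%:E)).
    by move=> z _; rewrite lee_fin mulr_ge0 ?powR_ge0 ?profile_ge0.
  have -> : dA_int (fun z => (normc (f z) `^ p * nu z)%:E) =
      dA_int (fun z => absf f z `^ p * (nu z)%:E) by rewrite IE.
  by apply: lty_poweRy Lpfin; rewrite invr_eq0 gt_eqF.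
have [S S0 [fS SI]] := sup_bound af M0 areaM Ifin.
have main : \int[@plane_leb R]_(x in @plane_disc R)
    ((absT w f (cpt x)) `^ p * (nu (cpt x))%:E) <= B%:E * I.
  apply: (le_trans (absT_power_le af S0 fS)); rewrite Gfin -/rc -/I.
  apply: (@le_trans _ _ ((2 * rc)%:E * (c2%:E * I * G%:E + I))).
    rewrite lee_wpmul2l ?lee_fin ?mulr_ge0// leeD2r// lee_wpmul2r// lee_fin.
  have -> : I = (fine I)%:E by rewrite fineK// ge0_fin_numE.
  rewrite -[c2%:E * _]EFinM -[X in X + _]EFinM -EFinD -!EFinM.
  by rewrite lee_fin le_eqVlt; apply/orP; left; apply/eqP; rewrite /B; ring.
have pi0 : 0 <= (pi^-1 : R)%:E by rewrite lee_fin invr_ge0 pi_ge0.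
have pV0 : (0 <= p^-1)%R by rewrite invr_ge0 ltW.
rewrite /Lp_norm IE.
apply: (@le_trans _ _ ((B%:E * ((pi^-1)%:E * I)) `^ p^-1)).
  apply: lee_poweR => //.
    rewrite /dA_int mule_ge0//; apply: integral_ge0 => x _.
    by rewrite mule_ge0 ?poweR_ge0 ?lee_fin ?profile_ge0.
  by rewrite /dA_int muleCA lee_wpmul2l.
by rewrite poweRM ?lee_fin ?mule_ge0// poweR_EFin.
Qed.

End StrongType.

(** * Choice of the radii and conclusion *)

Theorem corollary10 (R : realType) (p : R) (hp : 1 < p)
    (w : R[i] -> R) (hw : Dhat w) :
  exists nu : R[i] -> R,
    [/\ Dhat nu, T_bounded_Ap_Lp w nu p & ~ T_bounded_Lp_weakLp w nu p].
Proof.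
have [k [mk k0 kout kfin wk]] := radial_density hw.
have [[[w0 _ _] _ wpos] [C C1 dbl]] := hw.
have hatE r : 0 <= r -> hat w r%:C =
    (\int[@lebesgue_measure R]_(s in `[r, 1%R[) (k s)%:E)%E.
  move=> r0; rewrite /hat modcE normcR ger0_norm//.
  exact: hat_density.
have tail_pos r : r < 1 ->
    (0 < \int[@lebesgue_measure R]_(s in `[r, 1%R[) (k s)%:E)%E.
  (* Positivity of the tail is also wanted for negative r, where [hat] says nothing directly; the
     tail from max r 0 is a lower bound. *)
  move=> r1; pose m := Num.max r 0.
  have m0 : 0 <= m by rewrite le_max lexx orbT.
  have m1 : m < 1 by rewrite gt_max r1 ltr01.
  apply: (@lt_le_trans _ _ (hat w m%:C)).
    by apply: wpos; rewrite discE normcR ger0_norm.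
  rewrite hatE//; apply: ge0_subset_integral => //.
  - by apply/measurable_EFinP; exact: measurable_funTS.
  - by move=> x _; rewrite lee_fin.
  - by apply: subset_itvr; rewrite bnd_simp le_max lexx.
have doubling r : 0 <= r < 1 -> tail k r <= C * tail k ((1 + r) / 2).
  move=> /[dup] r01 /andP[r0 _]; have := dbl _ r01.
  rewrite !hatE//; last by rewrite divr_ge0// addr_ge0.
  by rewrite !(tailE mk k0 kfin) -EFinM lee_fin.
have half1 : 2^-1 < 1 :> R by rewrite invf_lt1// ltr1n.
have t2 : 0 < tail k 2^-1 by exact: tail_gt0.
have t1 : tail k 1 = 0 by rewrite /tail set_itv_ge ?bnd_simp ?ltxx// integral_set0.
(* Halving the tail forces [b] strictly between 1/2 and 1: the value differs from both K(1/2) > 0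
   and K(1) = 0. *)
have [|b /andP[b2 b1] tb] := @tail_IVT R k mk k0 kfin 2^-1 1 (tail k 2^-1 / 2) (ltW half1) (lexx 1).
  by rewrite t1 divr_ge0 ?(ltW t2)//= ler_pdivrMr// ler_peMr ?ler1n// ltW.
have drop : tail k b < tail k 2^-1 by rewrite tb ltr_pdivrMr// ltr_pMr// ltr1n.
have b_ge : 2^-1 < b.
  by rewrite lt_neqAle b2 andbT; apply: contraTneq drop => <-; rewrite ltxx.
have b_lt1 : b < 1.
  rewrite lt_neqAle b1 andbT; apply: contraTneq t2 => b_eq1.
  by move: tb; rewrite b_eq1 t1 -leNgt => h; lra.
pose c := (1 + b) / 2.
have bc : b < c by rewrite ltr_pdivlMr//; lra.
have c1 : c < 1 by rewrite ltr_pdivrMr//; lra.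
exists (radial_of k b c); split.
- exact: (Dhat_radial_of mk k0 kfin tail_pos b_ge bc c1 C1 doubling).
- exact: (strong_type w0 mk k0 kout kfin wk tail_pos b_ge bc c1 hp).
- exact: (not_weak_type w0 mk k0 kfin wk tail_pos hp b_ge b_lt1 drop).
Qed.
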